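(* Let $X\subseteq\mathbb{R}^2$ be any semi-algebraic set, i.e. a set of the form $$X=\bigcup_{i=1}^{I}\bigcap_{j=1}^{J}\{(x,y)\in\mathbb{R}^2: f_{i,j}(x,y)=0,\ g_{i,j}(x,y)>0\}$$ with $f_{i,j},g_{i,j}\in\mathbb{R}[x,y]$. Then $X$ has a cell decomposition with the finiteness property.
   Context: A cell decomposition of a set $X\subseteq\mathbb{R}^2$ is a partition of $X$ into (finitely or countably many) cells, each of which is a semi-algebraic set: 0-cells are points, 1-cells are subsets homeomorphic to an open interval, 2-cells are subsets homeomorphic to an open disk. A shortest-length curve in $X$ between two points $A,B\in X$ is a piecewise $C^2$ curve $\gamma$ from $A$ to $B$ lying entirely in $X$ whose length is minimal among all piecewise $C^2$ curves in $X$ from $A$ to $B$. A geodesic line segment (relative to the decomposition) is either a straight line segment or a connected arc contained (partially or entirely) in a 1-cell. A cell decomposition $\mathcal{A}$ of $X$ has the finiteness property if for every shortest-length curve $\gamma$ in $X$ between two points of $X$ and every cell $e\in\mathcal{A}$, the set $\gamma\cap e$ is either empty or has finitely many connected components, each of which is either a singleton or a geodesic line segment. *)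

(* Defs.v *)
From HB Require Import structures.
From mathcomp Require Import all_boot all_order all_algebra.
From mathcomp Require Import all_classical all_reals all_analysis.
Set Implicit Arguments. Unset Strict Implicit. Unset Printing Implicit Defensive.
Import Order.TTheory GRing.Theory Num.Theory numFieldNormedType.Exports.
Local Open Scope classical_set_scope.
Local Open Scope ring_scope.

Section Defs.
Variable R : realType.
Notation pt := (R * R)%type.

(* A polynomial f in R[x,y] is represented as an element of R[x][y]
   = {poly {poly R}}; its value at (x,y). *)
Definition peval2 (f : {poly {poly R}}) (p : pt) : R :=
  (map_poly (fun c : {poly R} => c.[p.1]) f).[p.2].

Definition semialgebraic (X : set pt) : Prop :=
  exists (I J : nat) (f g : 'I_I -> 'I_J -> {poly {poly R}}),
    X = [set p | exists i : 'I_I, forall j : 'I_J,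
                   peval2 (f i j) p = 0 /\ 0 < peval2 (g i j) p].

Definition homeomorphic {T U : topologicalType} (A : set T) (B : set U) : Prop :=
  exists (phi : T -> U) (psi : U -> T),
    [/\ (forall a, A a -> B (phi a)), (forall b, B b -> A (psi b)),
        (forall a, A a -> psi (phi a) = a), (forall b, B b -> phi (psi b) = b) &
        {within A, continuous phi} /\ {within B, continuous psi}].

Definition open_unit_disk : set pt := [set p | p.1 ^+ 2 + p.2 ^+ 2 < 1].

Definition is_0cell (e : set pt) : Prop := exists P : pt, e = [set P].
Definition is_1cell (e : set pt) : Prop := homeomorphic (`]0, 1[%classic : set R) e.
Definition is_2cell (e : set pt) : Prop := homeomorphic open_unit_disk e.

Definition cell_decomposition (X : set pt) (C : set (set pt)) : Prop :=
  [/\ countable C,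
      (forall e, C e -> semialgebraic e /\ (is_0cell e \/ is_1cell e \/ is_2cell e)),
      (forall e e', C e -> C e' -> e `&` e' !=set0 -> e = e') &
      bigcup C id = X].

Definition C2 (h : R -> R) : Prop :=
  (forall t, derivable h t 1) /\ (forall t, derivable (derive1 h) t 1) /\
  continuous (derive1 (derive1 h)).

Definition piecewise_C2 (gam : R -> pt) : Prop :=
  exists (n : nat) (t : nat -> R),
    [/\ t 0%N = 0, t n = 1, (forall k, (k < n)%N -> t k < t k.+1) &
        forall k, (k < n)%N -> exists h1 h2 : R -> R,
          [/\ C2 h1, C2 h2 &
              forall s, t k <= s <= t k.+1 -> gam s = (h1 s, h2 s)]].

Definition curve_in (X : set pt) (A B : pt) (gam : R -> pt) : Prop :=
  [/\ piecewise_C2 gam, gam 0 = A, gam 1 = B &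
      forall s, 0 <= s <= 1 -> X (gam s)].

Definition curve_length (gam : R -> pt) : \bar R :=
  (\int[lebesgue_measure]_(s in (`[0%R, 1%R]%classic : set R))
     (Num.sqrt ((derive1 (fun u => (gam u).1) s) ^+ 2 +
                (derive1 (fun u => (gam u).2) s) ^+ 2))%:E)%E.

Definition shortest_curve (X : set pt) (A B : pt) (gam : R -> pt) : Prop :=
  curve_in X A B gam /\
  forall del, curve_in X A B del -> (curve_length gam <= curve_length del)%E.

Definition curve_image (gam : R -> pt) : set pt := gam @` `[0, 1]%classic.

(* straight line segment PQ with P <> Q, open, closed or half-open *)
Definition straight_segment (S : set pt) : Prop :=
  exists P Q : pt, P <> Q /\
    [set P + s *: (Q - P) | s in `]0, 1[%classic] `<=` S /\
    S `<=` [set P + s *: (Q - P) | s in `[0, 1]%classic].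

Definition geodesic_segment (C : set (set pt)) (S : set pt) : Prop :=
  straight_segment S \/
  [/\ connected S, (exists P Q, S P /\ S Q /\ P <> Q) &
      exists e, C e /\ is_1cell e /\ S `<=` e].

Definition finiteness_property (X : set pt) (C : set (set pt)) : Prop :=
  forall (A B : pt) (gam : R -> pt), shortest_curve X A B gam ->
  forall e, C e ->
    let S := curve_image gam `&` e in
    S = set0 \/
    (finite_set [set connected_component S x | x in S] /\
     forall x, S x ->
       (exists P, connected_component S x = [set P]) \/
       geodesic_segment C (connected_component S x)).

End Defs.

(* Main.v *)
(* Only segments contained in X are ever needed: if [gam s, gam t] lies in X, then a shortest
   curve follows this segment between the times s and t.  Hence it meets a convex cell in
   a convex set, which is empty, a point or a segment.

   Let P be the product of the nonzero polynomials defining X.  The set X \ {P = 0} is open, and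
   the maximal dyadic cells it contains are convex.  On X /\ {P = 0}, outside finitely
   many points, the zero set is locally either a vertical or horizontal segment or a strictly
   monotone arc p = 0 such that X contains all or nothing of each side and such that
   {p >= 0}, up to the sign of p, is convex: the curvature numerator of p is either of
   constant sign or a multiple of p near the point.  A small dyadic square cuts such an
   arc in a 1-cell.  A shortest curve that stays near the arc either has all
   the chords of {p >= 0} at its disposal, or can leave the arc only into {p < 0}, where it is
   straight; the latter is impossible because chords of the arc lie in {p >= 0}.  So each
   stretch of the curve near the arc contributes finitely many components, and uniform
   continuity bounds the number of stretches. *)
Require Import Defs.
From HB Require Import structures.
From mathcomp Require Import all_boot all_order all_algebra.
From mathcomp Require Import all_classical all_reals all_analysis.
From mathcomp Require Import measurable_realfun.
From mathcomp Require polyrcf.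
From mathcomp Require Import ring lra.
Set Implicit Arguments. Unset Strict Implicit. Unset Printing Implicit Defensive.
Import Order.TTheory GRing.Theory Num.Theory numFieldNormedType.Exports.
Local Open Scope classical_set_scope.
Local Open Scope ring_scope.

(** * Shortest curves are straight where a segment is available *)

Section ArcLength.
Variable R : realType.
Notation pt := (R * R)%type.
Implicit Types (gam : R -> pt) (h : R -> R).

(** Points are treated one at a time: each point of X outside a finite set gets some dyadic square
    whose part on, or off, the zero set is a good cell, and passing to the coarsest such square
    replaces a global cylindrical construction. The decomposition may thus be infinite, while
    finiteness is claimed for each cell separately.

    Nothing is proved about the regularity of shortest curves: apart from a Lipschitz bound they
    enter through the chord property of [taut]. In a 1-cell every connected set with two points
    counts as a geodesic segment, so for a curved arc only the number of components matters.

    The exceptional points come in two stages. P may have repeated factors, so p is its quotient by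
    gcd(P, P_y), whose zeros are simple in y. The gcd arguments are valid where some nonzero
    polynomial in x does not vanish, which leaves finitely many vertical lines. On such a line x =
    x0, division by a power of x - x0 leaves finitely many points, and these become 0-cells.
    Isolated inflection points and singular points of the curve fall on these lines. *)

Definition hyp (u v : R) : R := Num.sqrt (u ^+ 2 + v ^+ 2).

Lemma hyp_ge0 u v : 0 <= hyp u v.
Proof. exact: sqrtr_ge0. Qed.

Lemma hyp_sq u v : hyp u v ^+ 2 = u ^+ 2 + v ^+ 2.
Proof. by rewrite sqr_sqrtr// addr_ge0 ?sqr_ge0. Qed.

Lemma hyp_eq0 u v : hyp u v <= 0 -> u = 0 /\ v = 0.
Proof.
move=> h; have /eqP : hyp u v = 0 by apply/le_anti; rewrite h hyp_ge0.
rewrite sqrtr_eq0 => h'; split; apply/eqP; rewrite -sqrf_eq0; apply/eqP;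
  have := sqr_ge0 u; have := sqr_ge0 v; lra.
Qed.

(** Cauchy-Schwarz from Lagrange's identity: the squares of the two sides differ by
    [(a * v - b * u) ^+ 2]. *)
Lemma dot_le_hyp u v a b : a * u + b * v <= hyp a b * hyp u v.
Proof.
have h0 : 0 <= hyp a b * hyp u v by rewrite mulr_ge0 ?hyp_ge0.
have h2 : (hyp a b * hyp u v) ^+ 2 = (a ^+ 2 + b ^+ 2) * (u ^+ 2 + v ^+ 2).
  by rewrite exprMn !hyp_sq.
rewrite leNgt; apply/negP => H.
have := sqr_ge0 (a * v - b * u).
have : 0 < (a * u + b * v - hyp a b * hyp u v) * (a * u + b * v + hyp a b * hyp u v).
  by apply: mulr_gt0; lra.
have -> : (a * u + b * v - hyp a b * hyp u v) * (a * u + b * v + hyp a b * hyp u v) =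
  (a * u + b * v) ^+ 2 - (hyp a b * hyp u v) ^+ 2 by ring.
rewrite h2; lra.
Qed.

Definition speed gam (s : R) : R :=
  hyp (derive1 (fun u => (gam u).1) s) (derive1 (fun u => (gam u).2) s).

(** Same integrand as [curve_length], so that [arclen gam 0 1] is convertible to it; free endpoints
    allow cutting the curve. *)
Definition arclen gam (a b : R) : \bar R :=
  (\int[lebesgue_measure]_(s in (`[a, b]%classic : set R)) (speed gam s)%:E)%E.

Lemma C2_continuous h : C2 h -> continuous h.
Proof. by move=> [dh _] t; apply/differentiable_continuous/derivable1_diffP. Qed.

Lemma C2_derive1_continuous h : C2 h -> continuous (derive1 h).
Proof. by move=> [_ [dh _]] t; apply/differentiable_continuous/derivable1_diffP. Qed.

Lemma hyp_continuous h1 h2 : continuous h1 -> continuous h2 ->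
  continuous (fun s => hyp (h1 s) (h2 s)).
Proof.
move=> c1 c2 s; rewrite /hyp.
apply: (@continuous_comp _ _ _ (fun s => h1 s ^+ 2 + h2 s ^+ 2) (@Num.sqrt R));
  last exact: sqrt_continuous.
by apply: continuousD; apply: (@continuous_comp _ _ _ _ (fun x : R => x ^+ 2));
  [exact: c1 | exact: exprn_continuous | exact: c2 | exact: exprn_continuous].
Qed.

Lemma near_derive1 (f g : R -> R) (a b s : R) : (forall u, a <= u <= b -> f u = g u) ->
  a < s < b -> derive1 f s = derive1 g s.
Proof.
move=> fg sab; rewrite !derive1E; apply: near_eq_derive.
near=> u; apply: fg; apply/andP; split; apply: ltW; near: u.
- by apply: lt_nbhsr; case/andP: sab.
- by apply: lt_nbhsl; case/andP: sab.
Unshelve. all: by end_near. Qed.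


Lemma piece_speed gam h1 h2 a b s : (forall u, a <= u <= b -> gam u = (h1 u, h2 u)) ->
  a < s < b -> speed gam s = hyp (derive1 h1 s) (derive1 h2 s).
Proof.
move=> gh sab; rewrite /speed; congr hyp.
- by apply: (@near_derive1 (fun u => (gam u).1) h1 a b s) => // u /gh ->.
- by apply: (@near_derive1 (fun u => (gam u).2) h2 a b s) => // u /gh ->.
Qed.

(** The component of the curve along the chord has derivative at most the speed, by Cauchy-Schwarz,
    and its total increment is the length of the chord. *)
Lemma hyp_le_integral h1 h2 a b : a < b -> C2 h1 -> C2 h2 ->
  ((hyp (h1 b - h1 a) (h2 b - h2 a))%:E <= \int[lebesgue_measure]_(s in (`[a, b]%classic : set R))
     (hyp (derive1 h1 s) (derive1 h2 s))%:E)%E.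
Proof.
move=> ab C1 C2'.
have c1 := C2_derive1_continuous C1; have c2 := C2_derive1_continuous C2'.
set u := h1 b - h1 a; set v := h2 b - h2 a.
have [h0|h0] := leP (hyp u v) 0.
  apply: (@le_trans _ _ 0%E); first by rewrite lee_fin.
  by apply: integral_ge0 => s _; rewrite lee_fin hyp_ge0.
pose F (s : R) : R := u / hyp u v * h1 s + v / hyp u v * h2 s.
pose f (s : R) : R := u / hyp u v * derive1 h1 s + v / hyp u v * derive1 h2 s.
have cf : continuous f.
  by move=> s; apply: cvgD; apply: cvgM; [exact: cvg_cst|exact: c1|exact: cvg_cst|exact: c2].
have cF : continuous F.
  by move=> s; apply: cvgD; apply: cvgM;
   [exact: cvg_cst|exact: (C2_continuous C1)|exact: cvg_cst|exact: (C2_continuous C2')].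
have dF s : is_derive s (1:R) F (f s).
  have d1 : is_derive s (1:R) h1 (derive1 h1 s).
    by rewrite derive1E; apply: DeriveDef => //; exact: C1.1.
  have d2 : is_derive s (1:R) h2 (derive1 h2 s).
    by rewrite derive1E; apply: DeriveDef => //; exact: C2'.1.
  by apply: is_deriveD; apply: is_deriveZ.
have := @continuous_FTC2 R f F a b ab; rewrite -EFinB.
have -> : F b - F a = hyp u v.
  rewrite /F [LHS](_ : _ = (u ^+ 2 + v ^+ 2) / hyp u v); last by rewrite /u /v; ring.
  by rewrite -hyp_sq expr2 mulfK// gt_eqF.
move=> <-//; last 3 first.
- exact: continuous_subspaceT.
- split; first by move=> s _; exact: (@ex_derive _ _ _ _ _ _ _ (dF s)).
  + by apply: cvg_at_right_filter; exact: cF.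
  + by apply: cvg_at_left_filter; exact: cF.
- by move=> s _; rewrite derive1E; exact: derive_val.
have cg : continuous (fun s => hyp (derive1 h1 s) (derive1 h2 s)) by exact: hyp_continuous.
apply: le_integral.
- exact: measurable_itv.
- by apply: continuous_compact_integrable; [exact: segment_compact|exact: continuous_subspaceT].
- by apply: continuous_compact_integrable; [exact: segment_compact|exact: continuous_subspaceT].
move=> s _; rewrite lee_fin /f -!mulrA ![_^-1 * _]mulrC !mulrA -mulrDl.
by rewrite ler_pdivrMr// [leRHS]mulrC dot_le_hyp.

Qed.

(** At [a] and [b] the derivative of [gam] may differ from those of [h1] and [h2], since [gam] is
    unconstrained outside the interval; the integrals agree because the speeds do on the open
    interval. *)
Lemma piece_arclen gam h1 h2 a b : a < b -> C2 h1 -> C2 h2 ->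
  (forall s, a <= s <= b -> gam s = (h1 s, h2 s)) ->
  [/\ measurable_fun `[a, b] (speed gam),
      (arclen gam a b < +oo)%E &
      ((hyp ((gam b).1 - (gam a).1) ((gam b).2 - (gam a).2))%:E <= arclen gam a b)%E].
Proof.
move=> ab C1 C2' gh.
have cg : continuous (fun s => hyp (derive1 h1 s) (derive1 h2 s)).
  by apply: hyp_continuous; exact: C2_derive1_continuous.
have mo : measurable_fun `]a, b[ (speed gam).
  apply: (@eq_measurable_fun _ _ _ _ _ (fun s => hyp (derive1 h1 s) (derive1 h2 s))).
    by move=> s; rewrite inE/= in_itv/= => sab; rewrite (piece_speed gh sab).
  by apply: subspace_continuous_measurable_fun => //; exact: continuous_subspaceT.
have e : arclen gam a b = (\int[lebesgue_measure]_(s in (`[a, b]%classic : set R))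
     (hyp (derive1 h1 s) (derive1 h2 s))%:E)%E.
  apply: eq_integral_itv_bounded => //.
    by apply: subspace_continuous_measurable_fun => //; exact: continuous_subspaceT.
  by move=> s; rewrite in_itv/= => sab; rewrite (piece_speed gh sab).
split.
- exact: measurable_fun_itv_cc mo.
- rewrite e; apply: integrable_lty; first exact: measurable_itv.
  by apply: continuous_compact_integrable; [exact: segment_compact|exact: continuous_subspaceT].
- have ga : gam a = (h1 a, h2 a) by apply: gh; rewrite lexx ltW.
  have gb : gam b = (h1 b, h2 b) by apply: gh; rewrite lexx ltW.
  by rewrite e ga gb; exact: hyp_le_integral.
Qed.

Lemma C2_lipschitz h a b : a <= b -> C2 h ->
  exists2 K, 0 <= K & forall s t, a <= s -> s <= t -> t <= b -> `|h t - h s| <= K * (t - s).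
Proof.
move=> ab Ch.
have cd : continuous (fun s => `|derive1 h s|).
  by move=> s; apply: continuous_comp; [exact: C2_derive1_continuous|exact: norm_continuous].
have [c _ cmax] := EVT_max ab (continuous_subspaceT cd).
exists `|derive1 h c| => // s t as_ st tb.
have dh x : x \in `]s, t[ -> is_derive x (1:R) h (derive1 h x).
  by move=> _; rewrite derive1E; apply: DeriveDef => //; exact: Ch.1.
have [x + ->] := MVT_segment st dh (continuous_subspaceT (C2_continuous Ch)).
rewrite in_itv/= => /andP[sx xt].
rewrite normrM (ger0_norm (x := t - s)) ?subr_ge0// ler_wpM2r ?subr_ge0//.
by apply: cmax; rewrite in_itv/=; apply/andP; split; lra.
Qed.


End ArcLength.

Section ArcLengthAdditivity.
Variable R : realType.
Notation pt := (R * R)%type.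
Implicit Types (gam : R -> pt) (h : R -> R).

Lemma arclenD gam (a b c : R) : a <= b -> b <= c ->
  measurable_fun (`[a, c]%classic : set R) (speed gam) ->
  (arclen gam a c = arclen gam a b + arclen gam b c)%E.
Proof.
move=> ab bc mf; rewrite /arclen.
have mE : measurable_fun (`[a, c]%classic : set R) (fun s => (speed gam s)%:E) by exact/measurable_EFinP.
have s1 : `[a, b[ `<=` `[a, c].
  by move=> x /=; rewrite !in_itv/= => /andP[ax xb]; apply/andP; split; lra.
rewrite (@itv_bndbnd_setU _ _ (BLeft a) (BLeft b) (BRight c))//.
rewrite ge0_integral_setU//=; last 3 first.
- by rewrite -itv_bndbnd_setU.
- by move=> x _; rewrite lee_fin hyp_ge0.
- apply/disj_setPS => x [/=]; rewrite !in_itv/= => /andP[_ xb] /andP[bx _].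
  by move: xb; rewrite ltNge bx.
congr (_ + _)%E; apply: integral_itv_bndo_bndc.
exact: measurable_funS s1 mE.
Qed.

End ArcLengthAdditivity.

(** * Piecewise C2 curves on arbitrary intervals *)

Section PiecewiseC2.
Variable R : realType.
Notation pt := (R * R)%type.
Implicit Types (gam : R -> pt) (h : R -> R).

(** A list of pieces with free endpoints, equivalent to [piecewise_C2] on [0, 1]: cutting, joining
    and estimating lengths become inductions. *)
Inductive pc2 gam : R -> R -> Prop :=
| pc2_nil a : pc2 gam a a
| pc2_cons a b c h1 h2 : a < b -> C2 h1 -> C2 h2 ->
    (forall s, a <= s <= b -> gam s = (h1 s, h2 s)) -> pc2 gam b c -> pc2 gam a c.

Lemma pc2_le gam a b : pc2 gam a b -> a <= b.
Proof. by elim=> // {}a {}b c h1 h2 ab _ _ _ _; apply/le_trans/ltW. Qed.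

Lemma pc2_cat gam a b c : pc2 gam a b -> pc2 gam b c -> pc2 gam a c.
Proof. by elim=> // {b}a b d h1 h2 ab C1 C2' gh _ IH /IH; exact: pc2_cons gh. Qed.

Lemma pc2_eq gam del a b : pc2 gam a b -> (forall s, a <= s <= b -> gam s = del s) ->
  pc2 del a b.
Proof.
elim=> [{}a _|{b}a b c h1 h2 ab C1 C2' gh /pc2_le bc IH gd]; first exact: pc2_nil.
apply: (pc2_cons ab C1 C2') => [s /andP[as_ sb]|].
  by rewrite -gd ?gh ?as_ ?sb//= (le_trans sb).
by apply: IH => s /andP[bs sc]; apply: gd; rewrite sc andbT; apply: le_trans bs; exact: ltW.
Qed.

Lemma pc2_left gam a b t : pc2 gam a b -> a <= t <= b -> pc2 gam a t.
Proof.
move=> H; elim: H t => [{}a t|{b}a b c h1 h2 ab C1 C2' gh _ IH t /andP[at_ tc]].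
  by move=> ?; have -> : t = a by [apply/le_anti; rewrite andbC]; exact: pc2_nil.
have [tb|bt] := leP t b; last first.
  by apply: (pc2_cons ab C1 C2' gh); apply: IH; rewrite tc ltW.
move: at_; rewrite le_eqVlt => /predU1P[<-|at_]; first exact: pc2_nil.
apply: (pc2_cons at_ C1 C2'); last exact: pc2_nil.
by move=> s /andP[as_ st]; apply: gh; rewrite as_ (le_trans st).
Qed.

Lemma pc2_right gam a b t : pc2 gam a b -> a <= t <= b -> pc2 gam t b.
Proof.
move=> H; elim: H t => [{}a t|{b}a b c h1 h2 ab C1 C2' gh Hc IH t /andP[at_ tc]].
  by move=> ?; have -> : t = a by [apply/le_anti; rewrite andbC]; exact: pc2_nil.
have [bt|tb] := leP b t; first by apply: IH; rewrite bt.
apply: (pc2_cons tb C1 C2') Hc => s /andP[ts sb]; apply: gh.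
by rewrite sb (le_trans at_).
Qed.

Lemma pc2_sub gam a b s t : pc2 gam a b -> a <= s -> s <= t -> t <= b -> pc2 gam s t.
Proof.
move=> H as_ st tb; apply: (pc2_right (pc2_left (t := t) H _)).
  by rewrite tb (le_trans as_).
by rewrite as_.
Qed.

Lemma piecewise_C2_pc2 gam : piecewise_C2 gam -> pc2 gam 0 1.
Proof.
move=> [n [t [<- <- tlt gh]]].
have : forall k, (k <= n)%N -> pc2 gam (t 0%N) (t k).
  elim=> [_|k IH kn]; first exact: pc2_nil.
  apply: pc2_cat (IH (ltnW kn)) _.
  have [h1 [h2 [C1 C2' gh']]] := gh _ kn.
  by apply: (pc2_cons (tlt _ kn) C1 C2' gh'); exact: pc2_nil.
exact.
Qed.

Lemma pc2_piecewise_C2 gam : pc2 gam 0 1 -> piecewise_C2 gam.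
Proof.
suff H a b : pc2 gam a b -> exists (n : nat) (t : nat -> R),
    [/\ t 0%N = a, t n = b, (forall k, (k < n)%N -> t k < t k.+1) &
        forall k, (k < n)%N -> exists h1 h2 : R -> R,
          [/\ C2 h1, C2 h2 &
              forall s, t k <= s <= t k.+1 -> gam s = (h1 s, h2 s)]] by exact: H.
elim=> [{}a|{b}a b c h1 h2 ab C1 C2' gh _ [n [t [t0 tn tlt tgh]]]].
  by exists 0%N, (fun _ => a).
exists n.+1, (fun k => if k is k'.+1 then t k' else a); split=> //.
- by case=> [_|k /tlt//]; rewrite t0.
- case=> [_|k /tgh//]; exists h1, h2; split=> // s; rewrite t0; exact: gh.
Qed.

Lemma hyp_triangle (a b c d : R) : hyp (a + c) (b + d) <= hyp a b + hyp c d.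
Proof.
have h1 := hyp_ge0 a b; have h2 := hyp_ge0 c d; have h3 := hyp_ge0 (a + c) (b + d).
have := dot_le_hyp c d a b; have := hyp_sq a b; have := hyp_sq c d.
have := hyp_sq (a + c) (b + d); nra.
Qed.

Lemma pc2_arclen gam a b : pc2 gam a b ->
  [/\ measurable_fun (`[a, b]%classic : set R) (speed gam), (arclen gam a b < +oo)%E &
     ((hyp ((gam b).1 - (gam a).1) ((gam b).2 - (gam a).2))%:E <= arclen gam a b)%E].
Proof.
elim=> [{}a|{b}a b c h1 h2 ab C1 C2' gh H [m L G]].
  rewrite /arclen set_itv1 integral_set1; split=> //.
    exact: measurable_fun_set1.
  by rewrite !subrr /hyp expr0n/= addr0 sqrtr0.
have [m' L' G'] := piece_arclen ab C1 C2' gh.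
have bc := pc2_le H.
have mU : measurable_fun (`[a, c]%classic : set R) (speed gam).
  rewrite (@itv_bndbnd_setU _ _ (BLeft a) (BLeft b) (BRight c))// ?bnd_simp ?(ltW ab)//.
  apply/measurable_funU => //; split => //.
  by apply: measurable_funS m' => //; apply: subset_itvl; rewrite bnd_simp.
split=> //; first by rewrite (arclenD (ltW ab) bc)// lte_add_pinfty.
rewrite (arclenD (ltW ab) bc)//; apply: le_trans (leeD G' G).
rewrite -EFinD lee_fin; apply: le_trans (hyp_triangle _ _ _ _).
by rewrite [X in X <= _](_ : _ = @hyp R ((gam b).1 - (gam a).1 + ((gam c).1 - (gam b).1)) ((gam b).2 - (gam a).2 + ((gam c).2 - (gam b).2)))//;
  congr hyp; ring.
Qed.

Lemma pc2_lipschitz gam a b : pc2 gam a b ->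
  exists2 K, 0 <= K & forall s t, a <= s -> s <= t -> t <= b ->
    `|(gam t).1 - (gam s).1| <= K * (t - s) /\ `|(gam t).2 - (gam s).2| <= K * (t - s).
Proof.
elim=> [{}a|{b}a b c h1 h2 ab C1 C2' gh H [K K0 HK]].
  exists 0 => // s t as_ st ta; have -> : s = t by lra.
  by rewrite !subrr !normr0 mul0r.
have [K1 K10 HK1] := C2_lipschitz (ltW ab) C1; have [K2 K20 HK2] := C2_lipschitz (ltW ab) C2'.
have bc := pc2_le H.
have P s t : a <= s -> s <= t -> t <= b ->
   `|(gam t).1 - (gam s).1| <= (K1 + K2 + K) * (t - s) /\
   `|(gam t).2 - (gam s).2| <= (K1 + K2 + K) * (t - s).
  move=> as_ st tb; rewrite !gh/=; try (by apply/andP; split; lra).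
  split; [apply: le_trans (HK1 _ _ as_ st tb) _|apply: le_trans (HK2 _ _ as_ st tb) _];
  by rewrite ler_wpM2r ?subr_ge0//; lra.
have Q s t : b <= s -> s <= t -> t <= c ->
   `|(gam t).1 - (gam s).1| <= (K1 + K2 + K) * (t - s) /\
   `|(gam t).2 - (gam s).2| <= (K1 + K2 + K) * (t - s).
  move=> bs st tc; have [q1 q2] := HK _ _ bs st tc.
  by split; [apply: le_trans q1 _|apply: le_trans q2 _];
    rewrite ler_wpM2r ?subr_ge0//; lra.
exists (K1 + K2 + K) => [|s t as_ st tc]; first lra.
have [tb|/ltW bt] := leP t b; first exact: P.
have [bs|/ltW sb] := leP b s; first exact: Q.
have [p1 p2] := P s b as_ sb (lexx _); have [q1 q2] := Q b t (lexx _) bt tc.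
have -> : (K1 + K2 + K) * (t - s) = (K1 + K2 + K) * (b - s) + (K1 + K2 + K) * (t - b) by ring.
have d1 := ler_distD (gam b).1 (gam t).1 (gam s).1.
have d2 := ler_distD (gam b).2 (gam t).2 (gam s).2.
split; lra.
Qed.

(** Equality case of the triangle inequality. Squaring the hypothesis gives
    [u * v <= a * c + b * d], hence |v (a, b) - u (c, d)|^2 = 2 u v (u v - a c - b d) <= 0; the two
    vectors are proportional and the weight is u / (u + v). *)
Lemma hyp_collinear (a b c d : R) : hyp a b + hyp c d <= hyp (a + c) (b + d) ->
  exists2 s : R, 0 <= s <= 1 & a = s * (a + c) /\ b = s * (b + d).
Proof.
set u := hyp a b; set v := hyp c d => H.
have u0 : 0 <= u := hyp_ge0 a b; have v0 : 0 <= v := hyp_ge0 c d.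
have us : u ^+ 2 = a ^+ 2 + b ^+ 2 := hyp_sq a b.
have vs : v ^+ 2 = c ^+ 2 + d ^+ 2 := hyp_sq c d.
have dot : u * v <= a * c + b * d.
  have h0 : 0 <= u + v by lra.
  have := hyp_sq (a + c) (b + d).
  have : (u + v) ^+ 2 <= hyp (a + c) (b + d) ^+ 2 by rewrite ler_sqr ?nnegrE ?hyp_ge0.
  by rewrite sqrrD us vs => h1 h2; rewrite h2 in h1; lra.
have key : (a * v - c * u) ^+ 2 + (b * v - d * u) ^+ 2 <= 0.
  have -> : (a * v - c * u) ^+ 2 + (b * v - d * u) ^+ 2 =
    (a ^+ 2 + b ^+ 2) * v ^+ 2 + (c ^+ 2 + d ^+ 2) * u ^+ 2 - 2 * (u * v) * (a * c + b * d) by ring.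
  rewrite -us -vs.
  have : 0 <= (u * v) * (a * c + b * d - u * v) by rewrite mulr_ge0 ?mulr_ge0 ?subr_ge0.
  lra.
have e1 : a * v = c * u.
  by apply/eqP; rewrite -subr_eq0 -sqrf_eq0; apply/eqP;
   have := sqr_ge0 (a * v - c * u); have := sqr_ge0 (b * v - d * u); lra.
have e2 : b * v = d * u.
  by apply/eqP; rewrite -subr_eq0 -sqrf_eq0; apply/eqP;
   have := sqr_ge0 (a * v - c * u); have := sqr_ge0 (b * v - d * u); lra.
have [uv0|uv0] := leP (u + v) 0.
  have [-> ->] := @hyp_eq0 R a b ltac:(rewrite -/u; lra).
  by exists 0; rewrite ?lexx ?ler01// !mul0r.
exists (u / (u + v)).
  by rewrite divr_ge0 ?(ltW uv0)//= ler_pdivrMr// mul1r; lra.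
have n0 : u + v != 0 by rewrite gt_eqF.
by split; apply: (mulIf n0); rewrite mulrAC divfK//; lra.
Qed.

Definition seg (P Q : pt) : set pt :=
  [set z | exists2 s : R, 0 <= s <= 1 & z = (P.1 + s * (Q.1 - P.1), P.2 + s * (Q.2 - P.2))].

Lemma C2_affine (p v s : R) : C2 (fun u : R => p + (u - s) * v).
Proof.
have d u : is_derive u (1:R) (fun u : R => p + (u - s) * v) v.
  by apply: is_derive_eq; rewrite scaler0 subr0 !add0r mul1r -[_ *: _]/(v * 1) mulr1.
have e : derive1 (fun u : R => p + (u - s) * v) = cst v.
  by apply/funext => u; rewrite derive1E; exact: derive_val.
have e' : derive1 (cst v : R -> R) = cst 0 by apply/funext => u; rewrite derive1_cst.
split; first by move=> u; exact: ex_derive.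
split; rewrite e; first by move=> t; exact: derivable_cst.
by rewrite e'; exact: cst_continuous.
Qed.

End PiecewiseC2.

(** * Replacing a stretch of a shortest curve by its chord *)

Section ShortestCurves.
Variable R : realType.
Notation pt := (R * R)%type.
Implicit Types (gam del : R -> pt) (X : set pt).

Lemma pc2_arclen_fin gam a b : pc2 gam a b -> exists2 r : R, arclen gam a b = r%:E &
  hyp ((gam b).1 - (gam a).1) ((gam b).2 - (gam a).2) <= r.
Proof.
move=> /pc2_arclen[_ L G].
have fn : arclen gam a b \is a fin_num.
  by rewrite ge0_fin_numE//; apply: le_trans G; rewrite lee_fin hyp_ge0.
by exists (fine (arclen gam a b)); rewrite ?fineK// -lee_fin fineK.
Qed.

Lemma eq_arclen gam del a b : pc2 gam a b -> (forall s, a <= s <= b -> gam s = del s) ->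
  arclen gam a b = arclen del a b.
Proof.
move=> H gd.
have [m _ _] := pc2_arclen H; have [m' _ _] := pc2_arclen (pc2_eq H gd).
have sub : (`]a, b[%classic : set R) `<=` (`[a, b]%classic : set R) by exact: subset_itv_oo_cc.
apply: eq_integral_itv_bounded.
- exact: measurable_funS sub m.
- exact: measurable_funS sub m'.
- move=> s; rewrite in_itv/= => sab; rewrite /speed; congr hyp.
  + by apply: (@near_derive1 _ (fun u => (gam u).1) (fun u => (del u).1) a b) => // u /gd ->.
  + by apply: (@near_derive1 _ (fun u => (gam u).2) (fun u => (del u).2) a b) => // u /gd ->.
Qed.

Lemma hypZ (k a b : R) : 0 <= k -> hyp (k * a) (k * b) = k * hyp a b.
Proof.
by move=> k0; rewrite /hyp !exprMn -mulrDr sqrtrM ?sqr_ge0// sqrtr_sqr ger0_norm.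
Qed.

Lemma arclen_affine del (s t : R) (P v : pt) : s < t ->
  (forall u, s <= u <= t -> del u = (P.1 + (u - s) * v.1, P.2 + (u - s) * v.2)) ->
  pc2 del s t /\ arclen del s t = (hyp ((t - s) * v.1) ((t - s) * v.2))%:E.
Proof.
move=> st du.
have C1 := C2_affine P.1 v.1 s; have C2' := C2_affine P.2 v.2 s.
have pd : pc2 del s t by apply: (pc2_cons st C1 C2' du); exact: pc2_nil.
split=> //; have [m _ _] := pc2_arclen pd.
have dd (p w u : R) : derive1 (fun u : R => p + (u - s) * w) u = w.
  rewrite derive1E; apply: derive_val.
  by apply: is_derive_eq; rewrite scaler0 subr0 !add0r mul1r -[_ *: _]/(w * 1) mulr1.
transitivity (\int[lebesgue_measure]_(u in (`[s, t]%classic : set R)) (hyp v.1 v.2)%:E)%E.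
  have sub : (`]s, t[%classic : set R) `<=` (`[s, t]%classic : set R) by exact: subset_itv_oo_cc.
  apply: eq_integral_itv_bounded => //.
    exact: measurable_funS sub m.
  by move=> u; rewrite in_itv/= => ust; rewrite (piece_speed du ust)// !dd.
rewrite integral_cst//= lebesgue_measure_itv/= lte_fin st -EFinD -EFinM.
by rewrite hypZ ?subr_ge0 1?ltW// mulrC.
Qed.

(** Substituting the chord for the stretch from [s] to [t] gives a competitor in [X]. Minimality
    bounds the length of the stretch by that of the chord, so the triangle inequality through
    [gam u] is an equality. *)
Lemma shortest_seg X A B gam s t u : shortest_curve X A B gam ->
  0 <= s -> s <= u -> u <= t -> t <= 1 -> seg (gam s) (gam t) `<=` X ->
  seg (gam s) (gam t) (gam u).
Proof.
move=> [[pg gA gB gX] gmin] s0 su ut t1 segX.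
have [ts|st] := leP t s.
  have -> : u = s by apply/le_anti; rewrite su (le_trans ut ts).
  by exists 0; rewrite ?lexx ?ler01// !mul0r !addr0; case: (gam s).
have g01 := piecewise_C2_pc2 pg.
have g0s := pc2_sub g01 (lexx _) s0 (le_trans (ltW st) t1).
have gst := pc2_sub g01 s0 (ltW st) t1.
have gt1 := pc2_sub g01 (le_trans s0 (ltW st)) t1 (lexx _).
have gsu := pc2_sub gst (lexx _) su ut; have gut := pc2_sub gst su ut (lexx _).
pose v : pt := (((gam t).1 - (gam s).1) / (t - s), ((gam t).2 - (gam s).2) / (t - s)).
pose del w := if s <= w <= t then ((gam s).1 + (w - s) * v.1, (gam s).2 + (w - s) * v.2) else gam w.
have ts0 : t - s != 0 by rewrite subr_eq0 gt_eqF.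
have d1 w : 0 <= w <= s -> gam w = del w.
  move=> /andP[w0 ws]; rewrite /del; have [/andP[sw _]|//] := boolP (s <= w <= t).
  have -> : w = s by apply/le_anti; rewrite ws sw.
  by rewrite subrr !mul0r !addr0; case: (gam s).
have d3 w : t <= w <= 1 -> gam w = del w.
  move=> /andP[tw w1]; rewrite /del; have [/andP[_ wt]|//] := boolP (s <= w <= t).
  have -> : w = t by apply/le_anti; rewrite tw wt.
  rewrite /v/= ![(t - s) * _]mulrC !divfK// ![_ + (_ - _)]addrC !subrK.
  by case: (gam t).
have [d2 e2] : pc2 del s t /\ arclen del s t = (hyp ((t - s) * v.1) ((t - s) * v.2))%:E.
  by apply: (@arclen_affine _ _ _ (gam s)) => // w wst; rewrite /del wst.
have p0s := pc2_eq g0s d1; have pt1 := pc2_eq gt1 d3.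
have pd := pc2_cat p0s (pc2_cat d2 pt1).
have cd : curve_in X A B del.
  split.
  - exact: pc2_piecewise_C2.
  - by rewrite -d1 ?lexx.
  - by rewrite -d3 ?lexx ?andbT.
  - move=> w w01; rewrite /del; have [/andP[sw wt]|_] := boolP (s <= w <= t); last exact: gX.
    apply: segX; exists ((w - s) / (t - s)).
      by rewrite divr_ge0 ?subr_ge0 ?(ltW st)//= ler_pdivrMr ?subr_gt0// mul1r lerD2r.
    by rewrite /v/=; congr (_, _); ring.
have [m1 _ _] := pc2_arclen g01; have [m2 _ _] := pc2_arclen pd.
have := gmin _ cd; rewrite -[curve_length gam]/(arclen gam 0 1) -[curve_length del]/(arclen del 0 1).
have sub : (`[s, 1]%classic : set R) `<=` (`[0, 1]%classic : set R).
  by move=> w /=; rewrite !in_itv/= => /andP[sw ->]; rewrite (le_trans s0).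
have st1 : s <= 1 := le_trans (ltW st) t1.
rewrite (arclenD s0 st1)// (arclenD s0 st1 m2).
rewrite (arclenD (ltW st) t1 (measurable_funS (@measurable_itv R `[0%R, 1%R]) sub m1))// (arclenD (ltW st) t1 (measurable_funS (@measurable_itv R `[0%R, 1%R]) sub m2))//.
rewrite -(eq_arclen g0s d1) -(eq_arclen gt1 d3) e2.
have sub2 : (`[s, t]%classic : set R) `<=` (`[0, 1]%classic : set R).
  by move=> w /=; rewrite !in_itv/= => /andP[sw wt]; apply/andP; split; lra.
rewrite (arclenD su ut (measurable_funS (@measurable_itv R `[0%R, 1%R]) sub2 m1))//.
have [r1 -> _] := pc2_arclen_fin g0s; have [r3 -> _] := pc2_arclen_fin gt1.
have [q1 -> h1] := pc2_arclen_fin gsu; have [q2 -> h2] := pc2_arclen_fin gut.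
rewrite -!EFinD lee_fin => H.
rewrite /v/= ![(t - s) * _]mulrC !divfK// in H.
have H' : hyp ((gam u).1 - (gam s).1) ((gam u).2 - (gam s).2) +
     hyp ((gam t).1 - (gam u).1) ((gam t).2 - (gam u).2) <=
     hyp ((gam u).1 - (gam s).1 + ((gam t).1 - (gam u).1))
         ((gam u).2 - (gam s).2 + ((gam t).2 - (gam u).2)).
  rewrite (_ : (gam u).1 - (gam s).1 + ((gam t).1 - (gam u).1) = (gam t).1 - (gam s).1); last by ring.
  rewrite (_ : (gam u).2 - (gam s).2 + ((gam t).2 - (gam u).2) = (gam t).2 - (gam s).2); last by ring.
  lra.
have [k k01 [e1' e2']] := hyp_collinear H'.
exists k => //; rewrite [LHS]surjective_pairing; congr (_, _).
- by rewrite -[LHS](subrK (gam s).1) e1'; ring.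
- by rewrite -[LHS](subrK (gam s).2) e2'; ring.
Qed.

Definition clamp (s : R) : R := Num.max 0 (Num.min s 1).

Lemma clamp01 s : 0 <= clamp s <= 1.
Proof. by rewrite /clamp le_max lexx/= ge_max ler01 ge_min lexx orbT. Qed.

Lemma clamp_id s : 0 <= s <= 1 -> clamp s = s.
Proof. by move=> /andP[s0 s1]; rewrite /clamp (min_idPl s1) (max_idPr s0). Qed.

Lemma clamp_le s t : s <= t -> clamp s <= clamp t /\ clamp t - clamp s <= t - s.
Proof.
move=> st; rewrite /clamp.
by case: (leP s 1) => ?; case: (leP t 1) => ?; try case: (leP 0 s) => ?;
  try case: (leP 0 t) => ?; try case: (leP 0 1) => ?; split; lra.
Qed.

(* The features of a shortest curve used below; the curve is made constant outside
   [0, 1], so that all its conditions are global. *)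
Definition taut X gam : Prop :=
  [/\ exists2 K, 0 < K & forall s t, `|(gam t).1 - (gam s).1| <= K * `|t - s| /\
                                      `|(gam t).2 - (gam s).2| <= K * `|t - s|,
     (forall s, X (gam s)),
     (forall s u t, s <= u -> u <= t -> seg (gam s) (gam t) `<=` X -> seg (gam s) (gam t) (gam u)) &
     forall s, gam (clamp s) = gam s].

Lemma shortest_taut X A B gam : shortest_curve X A B gam ->
  taut X (gam \o clamp) /\ curve_image gam = range (gam \o clamp).
Proof.
move=> sg; have [[pg _ _ gX] _] := sg; split; last first.
  apply/seteqP; split=> z [s].
  - by rewrite /= in_itv/= => s01 <-; exists s => //=; rewrite clamp_id.
  - by move=> _ <-; exists (clamp s) => //=; rewrite in_itv/= clamp01.
split.
- have [K K0 HK] := pc2_lipschitz (piecewise_C2_pc2 pg).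
  (* [taut] asks for a positive constant, while K may be 0. *)
  have K1 : 0 < K + 1 by lra.
  have HK' s t : `|(gam (clamp t)).1 - (gam (clamp s)).1| <= (K + 1) * `|t - s| /\
                 `|(gam (clamp t)).2 - (gam (clamp s)).2| <= (K + 1) * `|t - s|.
    wlog st : s t / s <= t.
      move=> W; have [/W//|/ltW/W] := leP s t.
      by rewrite (distrC t s) (distrC (gam (clamp s)).1) (distrC (gam (clamp s)).2).
    have [c1 c2] := clamp_le st.
    have [/andP[a0 _] /andP[_ b1]] := (clamp01 s, clamp01 t).
    have [p1 p2] := HK _ _ a0 c1 b1.
    rewrite (ger0_norm (x := t - s)) ?subr_ge0//.
    have : K * (clamp t - clamp s) <= (K + 1) * (t - s).
      by rewrite ler_pM ?subr_ge0//; lra.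
    by move=> h; split; lra.
  by exists (K + 1).
- by move=> s; apply: gX; exact: clamp01.
- move=> s u t su ut; apply: (shortest_seg sg).
  + by have /andP[] := clamp01 s.
  + by have [] := clamp_le su.
  + by have [] := clamp_le ut.
  + by have /andP[] := clamp01 t.
- by move=> s /=; rewrite (clamp_id (clamp01 s)).
Qed.

Lemma lipschitz_continuous (K : R) (f : R -> R) : 0 < K ->
  (forall s t, `|f t - f s| <= K * `|t - s|) -> continuous f.
Proof.
move=> K0 Hf s; apply/cvgrPdist_lt => e e0.
near=> t; rewrite distrC; apply: le_lt_trans (Hf _ _) _.
rewrite mulrC -ltr_pdivlMr//; near: t.
by apply: (@cvgr_distC_lt _ _ _ _ _ id s); [exact: cvg_id|exact: divr_gt0].
Unshelve. all: by end_near. Qed.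

Lemma continuous_pair (f g : R -> R) : continuous f -> continuous g ->
  continuous (fun t => (f t, g t)).
Proof.
by move=> cf cg s; apply: (@cvg_pair _ _ _ (nbhs s) (nbhs (f s)) (nbhs (g s))); [exact: cf|exact: cg].
Qed.

Lemma taut_continuous X gam : taut X gam ->
  [/\ continuous (fun s => (gam s).1), continuous (fun s => (gam s).2) & continuous gam].
Proof.
move=> [[K K0 HK] _ _ _].
have c1 : continuous (fun s => (gam s).1) by apply: (lipschitz_continuous K0) => s t; have [] := HK s t.
have c2 : continuous (fun s => (gam s).2) by apply: (lipschitz_continuous K0) => s t; have [] := HK s t.
split=> //; have -> : gam = fun t => ((gam t).1, (gam t).2).
  by apply/funext => t; rewrite -surjective_pairing.
exact: continuous_pair.
Qed.

End ShortestCurves.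

(** * Shortest curves meet convex sets and convex arcs finitely often *)

Section FiniteComponents.
Variable T : topologicalType.
Implicit Types (S F : set T).

Lemma finite_comps_connected S F : F `<=` S -> connected F ->
  finite_set [set connected_component S x | x in F].
Proof.
move=> FS cF; have [->|/set0P[x0 Fx0]] := eqVneq F set0; first by rewrite image_set0.
apply: (@sub_finite_set _ _ [set connected_component S x0]); last exact: finite_set1.
move=> _ [x Fx <-]; apply/esym/same_connected_component.
exact: (connected_component_max Fx0 FS cF).
Qed.

Lemma finite_comps_pair S F A B : (forall z, F z -> z = A \/ z = B) ->
  finite_set [set connected_component S x | x in F].
Proof.
move=> FAB; apply: (@sub_finite_set _ _ [set connected_component S x | x in [set A; B]]).
  by move=> _ [x /FAB[]-> <-]; [exists A => //; left|exists B => //; right].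
by apply: finite_image; exact: finite_set2.
Qed.

Lemma finite_comps_bigcup S (n : nat) (F : nat -> set T) : S = \bigcup_(i in `I_n) F i ->
  (forall i, (i < n)%N -> finite_set [set connected_component S x | x in F i]) ->
  finite_set [set connected_component S x | x in S].
Proof.
move=> SF H.
apply: (@sub_finite_set _ _ (\bigcup_(i in `I_n) [set connected_component S x | x in F i])).
  move=> _ [x Sx <-]; have : (\bigcup_(i in `I_n) F i) x by rewrite -SF.
  by move=> [i i_n Fx]; exists i => //; exists x.
by apply: bigcup_finite => // i i_n; apply: H.
Qed.

End FiniteComponents.

Section TautConvex.
Variable R : realType.
Notation pt := (R * R)%type.
Implicit Types (gam : R -> pt) (X e S : set pt) (P Q M : pt).

Definition cvx e := forall P Q, e P -> e Q -> seg P Q `<=` e.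

Lemma seg_l P Q : seg P Q P.
Proof. by exists 0; rewrite ?lexx ?ler01// !mul0r !addr0; case: P. Qed.

Lemma seg_r P Q : seg P Q Q.
Proof.
exists 1; rewrite ?lexx ?ler01// !mul1r ![_ + (_ - _)]addrC !subrK.
by case: Q.
Qed.

Lemma segC P Q : seg P Q `<=` seg Q P.
Proof.
move=> _ [s /andP[s0 s1] ->]; exists (1 - s) => /=; first by apply/andP; split; lra.
by congr (_, _); ring.
Qed.

Lemma seg_cvx P Q : cvx (seg P Q).
Proof.
move=> _ _ [s /andP[s0 s1] ->] [t /andP[t0 t1] ->] _ [k /andP[k0 k1] ->] /=.
exists (s + k * (t - s)); last by congr (_, _); ring.
by apply/andP; split; nra.
Qed.

(** The projection of the curve onto the direction of the chord takes all intermediate values, and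
    the curve stays on the chord, where the projection determines the point. *)
Lemma taut_seg_onto X gam s t M : taut X gam -> s <= t -> seg (gam s) (gam t) `<=` X ->
  seg (gam s) (gam t) M -> exists2 u, s <= u <= t & gam u = M.
Proof.
move=> tg st segX [k /andP[k0 k1] eM]; have [c1 c2 _] := taut_continuous tg.
set v1 := (gam t).1 - (gam s).1; set v2 := (gam t).2 - (gam s).2.
pose f u := ((gam u).1 - (gam s).1) * v1 + ((gam u).2 - (gam s).2) * v2.
have cf : continuous f.
  move=> u; apply: cvgD; apply: cvgM; try exact: cvg_cst; apply: cvgD; try exact: cvg_cst.
  - exact: c1.
  - exact: c2.
have w0 : 0 <= v1 ^+ 2 + v2 ^+ 2 by rewrite addr_ge0 ?sqr_ge0.
have fs : f s = 0 by rewrite /f !subrr !mul0r addr0.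
have ft : f t = v1 ^+ 2 + v2 ^+ 2 by rewrite /f -/v1 -/v2; ring.
have [] := @IVT _ f s t (k * (v1 ^+ 2 + v2 ^+ 2)) st (continuous_subspaceT cf).
  rewrite fs ft (min_idPl w0) (max_idPr w0); apply/andP; split; nra.
move=> u; rewrite in_itv/= => /andP[su ut] fu; exists u; first by rewrite su.
have [_ _ tg3 _] := tg.
have [k' _ eu] := tg3 _ _ _ su ut segX.
have {}fu : (k' - k) * (v1 ^+ 2 + v2 ^+ 2) = 0.
  have : f u = k' * (v1 ^+ 2 + v2 ^+ 2) by rewrite /f eu /= -/v1 -/v2; ring.
  by rewrite fu => h; lra.
rewrite eu eM; move/eqP: fu; rewrite mulf_eq0 => /orP[|/eqP w].
  by rewrite subr_eq0 => /eqP ->.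
have z1 : v1 = 0.
  by apply/eqP; rewrite -sqrf_eq0; apply/eqP; have := sqr_ge0 v1; have := sqr_ge0 v2; lra.
have z2 : v2 = 0.
  by apply/eqP; rewrite -sqrf_eq0; apply/eqP; have := sqr_ge0 v1; have := sqr_ge0 v2; lra.
by rewrite -/v1 -/v2 z1 z2 !mulr0.
Qed.

Lemma taut_cvx_cvx X gam e : taut X gam -> e `<=` X -> cvx e -> cvx (range gam `&` e).
Proof.
move=> tg eX ce P Q [[s _ sP] eP] [[t _ tQ] eQ] M PQM; split; last exact: (ce P Q).
wlog st : s t P Q sP tQ eP eQ PQM / s <= t.
  move=> W; have [/(W _ _ P Q)|/ltW/(W _ _ Q P)] := leP s t; apply=> //.
  exact: segC.
have [u _ <-] : exists2 u, s <= u <= t & gam u = M; last by exists u.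
apply: (taut_seg_onto tg st); rewrite sP tQ//.
by apply: subset_trans eX; exact: ce.
Qed.

(** Of three times, the middle one is sent into the segment spanned by the images of the other
    two. *)
Lemma taut_cvx_collinear X gam e P Q M : taut X gam -> e `<=` X -> cvx e ->
  let S := range gam `&` e in
  S P -> S Q -> S M -> [\/ seg P Q M, seg P M Q | seg M Q P].
Proof.
move=> tg eX ce S SP SQ SM.
have main s u t : e (gam s) -> e (gam t) -> s <= u -> u <= t -> seg (gam s) (gam t) (gam u).
  move=> es et su ut; have [_ _ tg3 _] := tg; apply: tg3 => //.
  by apply: subset_trans eX; exact: ce.
move: SP SQ SM => [[s _ <-] eP] [[t _ <-] eQ] [[u _ <-] eM].
have [su|/ltW us] := leP s u; have [ut|/ltW tu] := leP u t;
  have [st|/ltW ts] := leP s t.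
- by apply: Or31; exact: main.
- by apply: Or31; exact: main => //; apply: (le_trans su).
- by apply: Or32; exact: main.
- by apply: Or33; apply: segC; exact: main.
- by apply: Or33; exact: main.
- by apply: Or32; apply: segC; exact: main.
- by apply: Or31; apply: segC; apply: main => //; apply: (le_trans tu).
- by apply: Or31; apply: segC; exact: main.
Qed.

Definition lpt A B k : pt := (A.1 + k * (B.1 - A.1), A.2 + k * (B.2 - A.2)).

Lemma lpt_continuous A B : continuous (lpt A B).
Proof.
apply: continuous_pair => s; apply: cvgD; try exact: cvg_cst;
  by apply: cvgM; [exact: cvg_id|exact: cvg_cst].
Qed.

Lemma cvx_connected e : cvx e -> connected e.
Proof.
move=> ce; have [->|/set0P[A eA]] := eqVneq e set0; first exact: connected0.
rewrite [e](_ : _ = \bigcup_(Q in e) seg A Q); last first.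
  apply/seteqP; split=> [Q eQ|M [Q eQ]]; first by exists Q => //; exact: seg_r.
  exact: ce.
apply: bigcup_connected; first by exists A => Q _; exact: seg_l.
move=> Q _; rewrite [seg A Q](_ : _ = lpt A Q @` `[0, 1]%classic); last first.
  by apply/seteqP; split=> [M [k k01 ->]|_ [k + <-]]; rewrite /= ?in_itv/=;
    [exists k => //=; rewrite in_itv|move=> ?; exists k].
apply: connected_continuous_connected; first exact: segment_connected.
by apply: continuous_subspaceT; exact: lpt_continuous.
Qed.

(** S is convex and lies on the line through any two of its points, so it is the image of an
    interval [I] of parameters. The bound on [e] makes [I] bounded, and its infimum and supremum
    give the ends of the segment. *)
Lemma taut_cvx X gam e (b : R) : taut X gam -> e `<=` X -> cvx e ->
  (forall z, e z -> `|z.1| <= b /\ `|z.2| <= b) ->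
  let S := range gam `&` e in
  finite_set [set connected_component S x | x in S] /\
     forall x, S x -> (exists P, connected_component S x = [set P]) \/
       straight_segment (connected_component S x).
Proof.
move=> tg eX ce eb S.
have cS : cvx S by exact: taut_cvx_cvx tg eX ce.
have conS := cvx_connected cS.
split; first exact: finite_comps_connected.
move=> A SA; rewrite (connected_component_id SA conS).
have [[B [SB AB]]|nB] := pselect (exists B, S B /\ B <> A); last first.
  left; exists A; apply/seteqP; split=> [z Sz|_ ->//] /=.
  by apply: contrapT => zA; apply: nB; exists z.
right.
have SL M : S M -> exists k, M = lpt A B k.
  move=> SM; have [] := taut_cvx_collinear tg eX ce SA SB SM.
  - by move=> [k _ ->]; exists k.
  - move=> [k _ eB]; have k0 : k != 0.
      apply/eqP => k0; apply: AB; rewrite eB k0 !mul0r !addr0; by case: (A).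
    exists k^-1; rewrite [LHS]surjective_pairing /lpt eB/=; congr (_, _); field; exact: k0.
  - move=> [k _ eA]; have k1 : 1 - k != 0.
      rewrite subr_eq0; apply/eqP => k1; apply: AB; rewrite eA -k1 !mul1r.
      by rewrite ![_ + (_ - _)]addrC !subrK; case: (B).
    exists (- k / (1 - k)).
    by rewrite [LHS]surjective_pairing /lpt eA/=; congr (_, _); field; exact: k1.
pose I : set R := [set k | S (lpt A B k)].
have lpt0 : lpt A B 0 = A by rewrite /lpt !mul0r !addr0; case: (A).
have lpt1 : lpt A B 1 = B by rewrite /lpt !mul1r ![_ + (_ - _)]addrC !subrK; case: (B).
have I0 : I 0 by rewrite /I/= lpt0.
have I1 : I 1 by rewrite /I/= lpt1.
have Ic k1 k2 k : I k1 -> I k2 -> k1 <= k -> k <= k2 -> I k.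
  move=> i1 i2 l1 l2; apply: (cS _ _ i1 i2).
  have [kk|kk] := eqVneq k1 k2.
    have -> : k = k1 by apply/le_anti; rewrite l1 kk l2.
    exact: seg_l.
  have d0 : 0 < k2 - k1 by rewrite subr_gt0 lt_neqAle kk (le_trans l1).
  exists ((k - k1) / (k2 - k1)).
    by rewrite divr_ge0 ?subr_ge0// ?(le_trans l1)//= ler_pdivrMr// mul1r; lra.
  have dn : k2 - k1 != 0 by rewrite gt_eqF.
  by rewrite /lpt/=; congr (_, _); field.
(* Some coordinate of B - A is nonzero; along it the size of [e] controls the parameter. *)
have [d [d0 Id]] : exists d : R, 0 < d /\ forall k, I k -> `|k| * d <= b + b.
  have [e1|e1] := eqVneq B.1 A.1.
    have e2 : B.2 - A.2 != 0.
      rewrite subr_eq0; apply/eqP => e2; apply: AB.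
      by rewrite [B]surjective_pairing e1 e2 -surjective_pairing.
    exists `|B.2 - A.2|; split; first by rewrite normr_gt0.
    move=> k [_ /eb[_ h]]; have [_ h'] := eb _ SA.2.
    rewrite -normrM; apply: le_trans (lerD h h').
    by rewrite (_ : k * _ = (lpt A B k).2 - A.2) ?ler_normB//= addrAC subrr add0r.
  exists `|B.1 - A.1|; split; first by rewrite normr_gt0 subr_eq0.
  move=> k [_ /eb[h _]]; have [h' _] := eb _ SA.2.
  rewrite -normrM; apply: le_trans (lerD h h').
  by rewrite (_ : k * _ = (lpt A B k).1 - A.1) ?ler_normB//= addrAC subrr add0r.
have Ib k : I k -> `|k| <= (b + b) / d by move/Id; rewrite ler_pdivlMr.
have hs : has_sup I.
  split; first by exists 0.
  by exists ((b + b) / d) => k /Ib; apply: le_trans; exact: ler_norm.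
have hi : has_inf I.
  split; first by exists 0.
  by exists (- ((b + b) / d)) => k /Ib; rewrite ler_norml => /andP[].
have i0 : inf I <= 0 by apply: ge_inf => //; exact: hi.2.
have s1 : 1 <= sup I by apply: ub_le_sup => //; exact: hs.2.
have ePQ (s : R) : lpt A B (inf I) + s *: (lpt A B (sup I) - lpt A B (inf I)) =
    lpt A B (inf I + s * (sup I - inf I)).
  rewrite [LHS]surjective_pairing /lpt/= -![_ *: _]/(_ * _).
  by congr (_, _); ring.
exists (lpt A B (inf I)), (lpt A B (sup I)); split; [|split].
- rewrite /lpt => -[h1 h2]; apply: AB; rewrite [B]surjective_pairing [RHS]surjective_pairing.
  have g1 : (sup I - inf I) * (B.1 - A.1) = 0 by lra.
  have g2 : (sup I - inf I) * (B.2 - A.2) = 0 by lra.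
  have n0 : sup I - inf I != 0 by rewrite gt_eqF//; lra.
  move/eqP: g1; move/eqP: g2; rewrite !mulf_eq0 (negbTE n0)/= !subr_eq0.
  by move=> /eqP -> /eqP ->.
- move=> _ [s + <-]; rewrite /= in_itv/= ePQ => /andP[s0 s1'].
  have dd : 0 < sup I - inf I by lra.
  have a1 : 0 < s * (sup I - inf I) by rewrite mulr_gt0.
  have a2 : 0 < (1 - s) * (sup I - inf I) by rewrite mulr_gt0// subr_gt0.
  have [k1 Ik1 lk1] := inf_adherent a1 hi; have [k2 Ik2 lk2] := sup_adherent a2 hs.
  by apply: (Ic k1 k2) => //; lra.
- move=> M SM; have [k eM] := SL _ SM.
  have Ik : I k by rewrite /I/= -eM.
  have l1 : inf I <= k by apply: ge_inf => //; exact: hi.2.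
  have l2 : k <= sup I by apply: ub_le_sup => //; exact: hs.2.
  have dd : 0 < sup I - inf I by lra.
  exists ((k - inf I) / (sup I - inf I)).
    rewrite /= in_itv/= divr_ge0 ?subr_ge0//= ?ler_pdivrMr ?mul1r ?lerD2r//.
    by lra.
  by rewrite ePQ eM divfK ?gt_eqF// addrC subrK.
Qed.

End TautConvex.

(** * Curves running through the interior of X *)

Section Excursions.
Variable R : realType.
Notation pt := (R * R)%type.
Implicit Types (gam : R -> pt) (X e S U D : set pt) (P Q M : pt).

Lemma first_zero (f : R -> R) (a b : R) : continuous f -> a <= b -> f a < 0 -> 0 <= f b ->
  exists c, [/\ a < c, c <= b, f c = 0 & forall x, a <= x -> x < c -> f x < 0].
Proof.
move=> cf ab fa fb.
(* Asking for negativity on all of [a, x], and not only at x, makes the supremum the first zero. *)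
pose E : set R := [set x | a <= x <= b /\ forall y, a <= y <= x -> f y < 0].
have Ea : E a.
  by split; [rewrite lexx|move=> y ya; have -> : y = a by apply/le_anti; rewrite andbC].
have hE : has_sup E by split; [exists a|exists b => x [/andP[]]].
set c := sup E.
have ac : a <= c by apply: ub_le_sup => //; exact: hE.2.
have cb : c <= b by apply: ge_sup; [exists a|move=> x [/andP[]]].
have neg x : a <= x -> x < c -> f x < 0.
  move=> ax xc; have d0 : 0 < c - x by lra.
  have [y [_ Ey] yx] := sup_adherent d0 hE.
  by apply: Ey; rewrite ax/=; rewrite -/c in yx; lra.
have near_neg y : f y < 0 -> exists2 d, 0 < d & forall x, `|x - y| < d -> f x < 0.
  move=> fy; have : \forall x \near y, f x < 0 by exact: (cvgr_lt (f y) (cf y) 0 fy).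
  by move=> /nbhs_ballP[d d0 Hd]; exists d => // x xd; apply: Hd; rewrite /ball/= distrC.
have near_pos y : 0 < f y -> exists2 d, 0 < d & forall x, `|x - y| < d -> 0 < f x.
  move=> fy; have : \forall x \near y, 0 < f x by exact: (cvgr_gt (f y) (cf y) 0 fy).
  by move=> /nbhs_ballP[d d0 Hd]; exists d => // x xd; apply: Hd; rewrite /ball/= distrC.
have fc : f c = 0.
  have [fc|fc|//] := ltgtP (f c) 0.
    have cb' : c < b.
      by rewrite lt_neqAle cb andbT; apply/eqP => cb'; rewrite -cb' in fb; lra.
    have [d d0 Hd] := near_neg _ fc.
    pose x := Num.min b (c + d / 2).
    have xc : c < x by rewrite /x lt_min cb'/=; lra.
    have xb : x <= b by rewrite /x ge_min lexx.
    have xd : x <= c + d / 2 by rewrite /x ge_min lexx orbT.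
    have : x <= c.
      apply: ub_le_sup; first exact: hE.2.
      split; first by rewrite xb andbT (le_trans ac)// ltW.
      move=> y /andP[ay yx]; have [yc|cy] := ltP y c; first exact: neg.
      by apply: Hd; rewrite ger0_norm ?subr_ge0//; lra.
    by rewrite leNgt xc.
  have ac' : a < c by rewrite lt_neqAle ac andbT; apply/eqP => ac'; rewrite ac' in fa; lra.
  have [d d0 Hd] := near_pos _ fc.
  pose x := Num.max a (c - d / 2).
  have xc : x < c by rewrite /x gt_max ac'/=; lra.
  have ax : a <= x by rewrite /x le_max lexx.
  have xd : c - d / 2 <= x by rewrite /x le_max lexx orbT.
  have := neg x ax xc; have := Hd x.
  rewrite ltr_norml => h1 h2; have : 0 < f x by apply: h1; apply/andP; split; lra.
  lra.
exists c; split=> //; rewrite lt_neqAle ac andbT; apply/eqP => ac'.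
by rewrite ac' in fa; lra.
Qed.

Lemma last_zero (f : R -> R) (a b : R) : continuous f -> a <= b -> 0 <= f a -> f b < 0 ->
  exists c, [/\ a <= c, c < b, f c = 0 & forall x, c < x -> x <= b -> f x < 0].
Proof.
move=> cf ab fa fb.
have cg : continuous (fun x => f (- x)).
  by move=> x; apply: continuous_comp; [exact: opp_continuous|exact: cf].
have [|||c [bc ca fc H]] := @first_zero (fun x => f (- x)) (- b) (- a) cg.
- by rewrite lerN2.
- by rewrite opprK.
- by rewrite opprK.
exists (- c); split=> //; [lra|lra|].
by move=> x cx xb; have := H (- x); rewrite opprK; apply; lra.
Qed.

Definition box (z : pt) (r : R) : set pt := [set w | `|w.1 - z.1| < r /\ `|w.2 - z.2| < r].

Lemma box_center z (r : R) : 0 < r -> box z r z.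
Proof. by move=> r0; split; rewrite subrr normr0. Qed.

Lemma convex_comb_gt0 (a b s : R) : 0 < a -> 0 < b -> 0 <= s <= 1 -> 0 < a + s * (b - a).
Proof. by move=> a0 b0 /andP[s0 s1]; case: (leP a b) => ab; nra. Qed.

Lemma box_cvx z (r : R) : cvx (box z r).
Proof.
move=> P Q [p1 p2] [q1 q2] _ [s s01 ->]; split=> /=; move: p1 p2 q1 q2;
  rewrite !ltr_norml => /andP[p1 p1'] /andP[p2 p2'] /andP[q1 q1'] /andP[q2 q2'].
- have h : 0 < r - (P.1 - z.1) by lra.
  have h' : 0 < r - (Q.1 - z.1) by lra.
  have k : 0 < r + (P.1 - z.1) by lra.
  have k' : 0 < r + (Q.1 - z.1) by lra.
  have := convex_comb_gt0 h h' s01; have := convex_comb_gt0 k k' s01 => ? ?.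
  by apply/andP; split; lra.
- have h : 0 < r - (P.2 - z.2) by lra.
  have h' : 0 < r - (Q.2 - z.2) by lra.
  have k : 0 < r + (P.2 - z.2) by lra.
  have k' : 0 < r + (Q.2 - z.2) by lra.
  have := convex_comb_gt0 h h' s01; have := convex_comb_gt0 k k' s01 => ? ?.
  by apply/andP; split; lra.
Qed.

Lemma taut_near X gam (s d : R) : taut X gam -> 0 < d ->
  exists2 eta, 0 < eta & forall t, `|t - s| < eta -> box (gam s) d (gam t).
Proof.
move=> [[K K0 HK] _ _ _] d0; exists (d / K); first exact: divr_gt0.
move=> t; rewrite ltr_pdivlMr// mulrC => h; have [h1 h2] := HK s t.
by split; [apply: le_lt_trans h1 h|apply: le_lt_trans h2 h].
Qed.

(** Testing with both normals of PQ forces M onto the line, testing with both directions along PQ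
    puts its parameter in [0, 1]; for P = Q the functional M - P itself forces M = P. *)
Lemma seg_separation P Q M :
  (forall a b : R, a * M.1 + b * M.2 <= Num.max (a * P.1 + b * P.2) (a * Q.1 + b * Q.2)) ->
  seg P Q M.
Proof.
move=> H; set d1 := Q.1 - P.1; set d2 := Q.2 - P.2.
set m1 := M.1 - P.1; set m2 := M.2 - P.2.
have H' a b : a * m1 + b * m2 <= Num.max 0 (a * d1 + b * d2).
  have := H a b; rewrite !le_max => /orP[h|h]; apply/orP; [left|right];
  by rewrite /m1 /m2 /d1 /d2; lra.
have cr0 : d1 * m2 = d2 * m1.
  have := H' (- d2) d1; have := H' d2 (- d1).
  rewrite (_ : - d2 * d1 + d1 * d2 = 0); last by ring.
  rewrite (_ : d2 * d1 + - d1 * d2 = 0); last by ring.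
  rewrite maxxx; lra.
set w := d1 ^+ 2 + d2 ^+ 2.
have w0 : 0 <= w by rewrite addr_ge0 ?sqr_ge0.
have l0 : 0 <= m1 * d1 + m2 * d2.
  have := H' (- d1) (- d2); rewrite (_ : - d1 * d1 + - d2 * d2 = - w); last by rewrite /w; ring.
  by rewrite (max_idPl _) ?oppr_le0//; lra.
have l1 : m1 * d1 + m2 * d2 <= w.
  have := H' d1 d2; rewrite (_ : d1 * d1 + d2 * d2 = w); last by rewrite /w; ring.
  by rewrite (max_idPr w0); lra.
have [w00|wn0] := eqVneq w 0.
  have z1 : d1 = 0.
    by apply/eqP; rewrite -sqrf_eq0; apply/eqP; have := sqr_ge0 d1; have := sqr_ge0 d2; rewrite /w in w00; lra.
  have z2 : d2 = 0.
    by apply/eqP; rewrite -sqrf_eq0; apply/eqP; have := sqr_ge0 d1; have := sqr_ge0 d2; rewrite /w in w00; lra.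
  have := H' m1 m2; rewrite z1 z2 !mulr0 addr0 maxxx => h.
  have y1 : m1 = 0.
    by apply/eqP; rewrite -sqrf_eq0; apply/eqP; have := sqr_ge0 m1; have := sqr_ge0 m2; lra.
  have y2 : m2 = 0.
    by apply/eqP; rewrite -sqrf_eq0; apply/eqP; have := sqr_ge0 m1; have := sqr_ge0 m2; lra.
  exists 0; first by rewrite lexx ler01.
  rewrite !mul0r !addr0 [M]surjective_pairing; congr (_, _).
    by apply/eqP; rewrite -subr_eq0 -/m1 y1.
  by apply/eqP; rewrite -subr_eq0 -/m2 y2.
have w1 : 0 < w by rewrite lt_neqAle eq_sym wn0.
exists ((m1 * d1 + m2 * d2) / w).
  by rewrite divr_ge0//= ler_pdivrMr// mul1r.
rewrite -/d1 -/d2 [M]surjective_pairing; congr (_, _); apply: (mulIf wn0).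
- rewrite mulrDl mulrAC divfK//.
  by have : m1 * w = (m1 * d1 + m2 * d2) * d1; [rewrite /w; have /= := congr1 (fun x => x * d2) cr0; lra|rewrite /m1; lra].
- rewrite mulrDl mulrAC divfK//.
  by have : m2 * w = (m1 * d1 + m2 * d2) * d2; [rewrite /w; have /= := congr1 (fun x => x * d1) cr0; lra|rewrite /m2; lra].
Qed.

(* A taut curve running through the interior of X is straight: otherwise look
   at the first time where a linear functional is maximal. *)
Lemma taut_interior_straight X gam (u w v : R) : taut X gam -> u < w -> w < v ->
  (forall t, u < t -> t < v -> exists2 r : R, 0 < r & box (gam t) r `<=` X) ->
  seg (gam u) (gam v) (gam w).
Proof.
move=> tg uw wv inX; apply: seg_separation => a b; rewrite leNgt; apply/negP => H.
have [c1 c2 _] := taut_continuous tg.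
pose l z : R := a * z.1 + b * z.2.
have cl : continuous (fun t => l (gam t)).
  by move=> t; apply: cvgD; apply: cvgM; [exact: cvg_cst|exact: c1|exact: cvg_cst|exact: c2].
have uv : u <= v by lra.
have [c + cmax] := EVT_max uv (continuous_subspaceT cl).
rewrite in_itv/= => /andP[uc cv].
have mw : l (gam w) <= l (gam c) by apply: cmax; rewrite in_itv/=; apply/andP; split; lra.
move: H; rewrite gt_max -/(l (gam u)) -/(l (gam v)) -/(l (gam w)) => /andP[Hu Hv].
have cf : continuous (fun t => l (gam t) - l (gam c)).
  by move=> t; apply: cvgB; [exact: cl|exact: cvg_cst].
have fu : l (gam u) - l (gam c) < 0 by lra.
have fc : 0 <= l (gam c) - l (gam c) by rewrite subrr.
have [w0 [uw0 w0c lw0 before]] := first_zero cf uc fu fc.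
have {}lw0 : l (gam w0) = l (gam c) by lra.
have w0v : w0 < v.
  rewrite lt_neqAle (le_trans w0c cv) andbT; apply/eqP => e; rewrite e in lw0; lra.
(* Minus the squared distance to [gam w0]. Its last zero w1 is the last time at which the curve is
   at this point; the curve may rest there or come back to it before. *)
pose k t : R := - (((gam t).1 - (gam w0).1) ^+ 2 + ((gam t).2 - (gam w0).2) ^+ 2).
have kle t : k t <= 0 by rewrite oppr_le0 addr_ge0 ?sqr_ge0.
have k_eq t : k t = 0 -> gam t = gam w0.
  move=> /eqP; rewrite oppr_eq0 paddr_eq0 ?sqr_ge0// !sqrf_eq0 !subr_eq0 => /andP[/eqP e1 /eqP e2].
  by rewrite [LHS]surjective_pairing e1 e2 -surjective_pairing.
have ck : continuous k.
  have -> : k = fun t => - (((gam t).1 - (gam w0).1) * ((gam t).1 - (gam w0).1) +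
                            ((gam t).2 - (gam w0).2) * ((gam t).2 - (gam w0).2)) by [].
  by move=> t; apply: cvgN; apply: cvgD; apply: cvgM; apply: cvgB; try exact: cvg_cst;
    [exact: c1|exact: c1|exact: c2|exact: c2].
have kw0 : 0 <= k w0 by rewrite /k !subrr expr0n/= addr0 oppr0.
have kv : k v < 0.
  rewrite lt_neqAle kle andbT; apply/eqP => /k_eq e; rewrite e in Hv; lra.
have [w1 [w01 w1v /k_eq gw1 after]] := last_zero ck (ltW w0v) kw0 kv.
have [r r0 rX] := inX w0 uw0 w0v.
have [eta1 eta10 near1] := taut_near w0 tg r0; have [eta2 eta20 near2] := taut_near w1 tg r0.
pose s := Num.max u (w0 - eta1 / 2); pose t := Num.min v (w1 + eta2 / 2).
have su : u <= s by rewrite le_max lexx.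
have sw : s < w0 by rewrite gt_max uw0/=; lra.
have se : w0 - eta1 / 2 <= s by rewrite le_max lexx orbT.
have tv : t <= v by rewrite ge_min lexx.
have wt : w1 < t by rewrite lt_min w1v/=; lra.
have te : t <= w1 + eta2 / 2 by rewrite ge_min lexx orbT.
have bs : box (gam w0) r (gam s) by apply: near1; rewrite ltr_norml; apply/andP; split; lra.
have bt : box (gam w0) r (gam t).
  by rewrite -gw1; apply: near2; rewrite ltr_norml; apply/andP; split; lra.
have [_ _ tg3 _] := tg.
have [q /andP[q0 q1] eM] := tg3 s w0 t (ltW sw) (ltW (le_lt_trans w01 wt))
   (subset_trans (box_cvx bs bt) rX).
have ls : l (gam s) < l (gam c) by have := before s su sw; lra.
have lt : l (gam t) <= l (gam c) by apply: cmax; rewrite in_itv/=; apply/andP; split; lra.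
have : l (gam c) = (1 - q) * l (gam s) + q * l (gam t).
  by rewrite -lw0 eM /l/=; ring.
(* A maximum of l inside the chord, with l smaller at [gam s], can only be at the end [gam t]; so
   the curve is back at [gam w0] after w1. *)
move=> e; have q1' : q = 1 by nra.
have : k t < 0 by apply: after => //.
rewrite /k [gam w0]eM q1' /= !mul1r; set A := gam s; set B := gam t.
by rewrite !(addrC A.1) !(addrC A.2) !subrK !subrr expr0n/= addr0 oppr0 ltxx.
Qed.

End Excursions.

(** * Curves near an arc that bounds a convex set *)

Section Arcs.
Variable R : realType.
Notation pt := (R * R)%type.
Implicit Types (gam : R -> pt) (X e S U D : set pt) (P Q M w z : pt).

Lemma continuous_pos_box (p : pt -> R) w : continuous p -> 0 < p w ->
  exists2 r : R, 0 < r & forall w', box w r w' -> 0 < p w'.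
Proof.
move=> cp pw; have : \forall x \near w, 0 < p x by exact: (cvgr_gt (p w) (cp w) 0 pw).
move=> /nbhs_ballP[r r0 H]; exists r => // w' [h1 h2]; apply: H.
by split; rewrite /ball/= distrC.
Qed.

Lemma continuous_neg_box (p : pt -> R) w : continuous p -> p w < 0 ->
  exists2 r : R, 0 < r & forall w', box w r w' -> p w' < 0.
Proof.
move=> cp pw; have cN : continuous (fun w => - p w) by move=> t; apply: cvgN; exact: cp.
have [|r r0 H] := @continuous_pos_box _ w cN; first lra.
by exists r => // w' /H; lra.
Qed.

Variables (p : pt -> R) (U : set pt).
Hypothesis cp : continuous p.
Hypothesis U_open : forall w, U w -> exists2 r : R, 0 < r & box w r `<=` U.
Hypothesis E_cvx : cvx (U `&` [set w | 0 <= p w]).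
Hypothesis zero_not_interior : forall w, U w -> p w = 0 ->
  forall r : R, 0 < r -> exists2 w', box w r w' & p w' < 0.

(** A point w' near the zero with p w' < 0 is the image of a point M' near M under the homothety of
    centre Q and ratio 1 - k. As p M' > 0, convexity of {p >= 0} gives p w' >= 0, a
    contradiction. *)
Lemma zero_not_between M Q (k : R) : U M -> U Q -> 0 < p M -> 0 <= p Q -> 0 <= k -> k < 1 ->
  p (lpt M Q k) <> 0.
Proof.
move=> UM UQ pM pQ k0 k1 pY.
have UY : U (lpt M Q k).
  have [//] : (U `&` [set w | 0 <= p w]) (lpt M Q k).
  by apply: (E_cvx (P := M) (Q := Q)); [split=> //; exact: ltW|split|exists k; rewrite ?k0 ?ltW].
have [r1 r10 b1] := continuous_pos_box cp pM; have [r2 r20 b2] := U_open UM.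
pose r := Num.min r1 r2.
have r0 : 0 < r by rewrite lt_min r10.
have rr : 0 < (1 - k) * r by rewrite mulr_gt0 ?subr_gt0.
have [w' [h1 h2] pw'] := zero_not_interior UY pY rr.
have kn : 1 - k != 0 by rewrite subr_eq0 gt_eqF.
have kp : 0 < 1 - k by rewrite subr_gt0.
pose M' : pt := (M.1 + (w'.1 - (lpt M Q k).1) / (1 - k), M.2 + (w'.2 - (lpt M Q k).2) / (1 - k)).
have bM : box M r M'.
  by split; rewrite /= addrAC subrr add0r normrM normfV (gtr0_norm kp) ltr_pdivrMr// [ltRHS]mulrC.
have bM1 : box M r1 M' by case: bM => ? ?; split; apply: lt_le_trans (_ : r <= _) => //; rewrite ge_min lexx.
have bM2 : box M r2 M' by case: bM => ? ?; split; apply: lt_le_trans (_ : r <= _) => //; rewrite ge_min lexx orbT.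
have : (U `&` [set w | 0 <= p w]) w'.
  apply: (E_cvx (P := M') (Q := Q)).
  - by split; [exact: b2|exact/ltW/b1].
  - by split.
  - exists k; first by rewrite k0 ltW.
    by rewrite [w']surjective_pairing /M' /lpt/=; congr (_, _); field.
by move=> [_] /=; rewrite leNgt pw'.
Qed.

(** If p were positive somewhere on the chord, the interior zero would lie between that point and
    one end, which [zero_not_between] forbids. *)
Lemma flat_between P Q (k : R) : U P -> U Q -> 0 <= p P -> 0 <= p Q -> 0 < k -> k < 1 ->
  p (lpt P Q k) = 0 -> forall M, seg P Q M -> U M /\ p M = 0.
Proof.
move=> UP UQ pP pQ k0 k1 pY M PQM.
have [UM pM] : (U `&` [set w | 0 <= p w]) M by apply: (E_cvx (P := P) (Q := Q)).
split=> //; apply/eqP; rewrite eq_le pM andbT leNgt; apply/negP => {}pM.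
case: PQM => m /andP[m0 m1] eM.
have [mk|km|mk] := ltgtP m k.
- have mn : 1 - m != 0 by rewrite gt_eqF//; lra.
  apply: (@zero_not_between M Q ((k - m) / (1 - m))) => //.
  + by rewrite divr_ge0//; lra.
  + by rewrite ltr_pdivrMr; lra.
  + by rewrite -pY; congr p; rewrite eM /lpt/=; congr (_, _); field.
- have mn : m != 0 by rewrite gt_eqF//; lra.
  apply: (@zero_not_between M P (1 - k / m)) => //.
  + by rewrite subr_ge0 ler_pdivrMr; lra.
  + by rewrite ltrBlDr ltrDl divr_gt0//; lra.
  + by rewrite -pY; congr p; rewrite eM /lpt/=; congr (_, _); field.
- by move: pM; rewrite eM mk -/(lpt P Q k) pY ltxx.
Qed.

Variables (X D : set pt) (d : R).
Hypothesis d0 : 0 < d.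
Hypothesis D_cvx : cvx D.
Hypothesis D_box : forall w, D w -> box w d `<=` U.
Hypothesis x_inj : forall w w', U w -> U w' -> p w = 0 -> p w' = 0 -> w.1 = w'.1 -> w = w'.
Hypothesis arc_connected : forall F, F `<=` D `&` [set w | p w = 0] ->
  (forall P Q M, F P -> F Q -> D M -> p M = 0 -> P.1 <= M.1 -> M.1 <= Q.1 -> F M) ->
  connected F.
Hypothesis arcX : forall w, U w -> p w = 0 -> X w.
Hypothesis posX : (forall w, U w -> 0 < p w -> X w) \/ (forall w, U w -> 0 < p w -> ~ X w).
Hypothesis negX : (forall w, U w -> p w < 0 -> X w) \/ (forall w, U w -> p w < 0 -> ~ X w).

Let e : set pt := D `&` [set w | p w = 0].

Variable gam : R -> pt.
Hypothesis tg : taut X gam.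

(** Chords between arc points lie in {p >= 0}, hence in X. If F has three points, the one visited at
    the middle time lies strictly inside the chord of the other two, so [flat_between] puts this
    whole chord on the arc and the curve runs through it. This makes F convex. *)
Lemma piece_finite_above (a b : R) F : (forall w, U w -> 0 < p w -> X w) ->
  F = [set z | e z /\ exists2 s, a <= s <= b & gam s = z] -> F `<=` range gam `&` e ->
  finite_set [set connected_component (range gam `&` e) x | x in F].
Proof.
move=> pX eF FS.
have [[A [B AB]]|nAB] := pselect (exists A B, forall z, F z -> z = A \/ z = B).
  exact: finite_comps_pair AB.
apply: finite_comps_connected => //; apply: cvx_connected.
have DU w : D w -> U w by move=> Dw; apply: (D_box Dw); exact: box_center.
have EX P Q : D P -> D Q -> p P = 0 -> p Q = 0 -> seg P Q `<=` X.
  move=> DP DQ pP pQ M PQM.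
  have [UM pM] : (U `&` [set w | 0 <= p w]) M.
    apply: (E_cvx (P := P) (Q := Q)) => //; split=> /=; rewrite ?pP ?pQ //; exact: DU.
  move: pM; rewrite /= le_eqVlt => /predU1P[pM|]; last exact: pX.
  by apply: arcX.
have main s u t : D (gam s) -> D (gam t) -> p (gam s) = 0 -> p (gam t) = 0 -> D (gam u) ->
    p (gam u) = 0 -> a <= s -> s <= u -> u <= t -> t <= b -> gam u <> gam s -> gam u <> gam t ->
    seg (gam s) (gam t) `<=` F.
  move=> Ds Dt ps pt' Du pu as_ su ut tb us ut'.
  have sX := EX _ _ Ds Dt ps pt'.
  have [_ _ tg3 _] := tg.
  have [k /andP[k0 k1] eu] := tg3 s u t su ut sX.
  have k0' : 0 < k.
    rewrite lt_neqAle k0 andbT; apply/eqP => k00; apply: us; rewrite eu -k00 !mul0r !addr0.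
    by case: (gam s).
  have k1' : k < 1.
    rewrite lt_neqAle k1 andbT; apply/eqP => k11; apply: ut'; rewrite eu k11 !mul1r.
    by rewrite ![_ + (_ - _)]addrC !subrK; case: (gam t).
  have fl : forall M, seg (gam s) (gam t) M -> U M /\ p M = 0.
    apply: (@flat_between _ _ k) => //; rewrite ?ps ?pt' //; try exact: DU.
    by rewrite /lpt -eu.
  move=> M sM; rewrite eF; split; first by split; [exact: (D_cvx Ds Dt)|have [] := fl M sM].
  have [v /andP[sv vt] gv] := taut_seg_onto tg (le_trans su ut) sX sM.
  by exists v => //; rewrite (le_trans as_ sv) (le_trans vt tb).
move=> P Q FP FQ.
have [C [FC CP CQ]] : exists C, [/\ F C, C <> P & C <> Q].
  apply: contrapT => nC; apply: nAB; exists P, Q => z Fz.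
  have [->|zP] := pselect (z = P); first by left.
  by have [->|zQ] := pselect (z = Q); [right|exfalso; apply: nC; exists z].
(* P, Q and C are visited at three times; A and B are the points at the extreme two, so that the
   segment AB contains P and Q whatever the order. *)
suff [A [B [AP [BQ ABF]]]] : exists A B, seg A B P /\ seg A B Q /\ seg A B `<=` F.
  by move=> M PQM; apply: ABF; apply: (seg_cvx AP BQ).
move: (FP) (FQ) (FC); rewrite eF => -[[DP pP] [s /andP[as_ sb] gs]] [[DQ pQ] [t /andP[at_ tb] gt]] [[DC pC] [c /andP[ac cb] gc]].
rewrite -gs -gt -gc in DP pP DQ pQ DC pC CP CQ *.
have [PQ|PQ] := pselect (gam s = gam t).
  exists (gam s), (gam s); rewrite -PQ; split; [exact: seg_l|split; first exact: seg_l].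
  move=> M [k _ ->]; rewrite !subrr !mulr0 !addr0 -surjective_pairing gs.
  by rewrite -eF.
have [_ _ tg3 _] := tg.
have [sc|/ltW cs] := leP s c; have [ct|/ltW tc] := leP c t;
  have [st|/ltW ts] := leP s t.
- by exists (gam s), (gam t); split; [exact: seg_l|split; [exact: seg_r|rewrite -eF; exact: (main s c t)]].
- by exists (gam s), (gam t); split; [exact: seg_l|split; [exact: seg_r|rewrite -eF; apply: (main s c t)]].
- exists (gam s), (gam c); split; [exact: seg_l|split].
    by apply: tg3 => //; exact: EX.
  by rewrite -eF; apply: (main s t c) => //; apply/nesym.
- exists (gam t), (gam c); split; [|split; [exact: seg_l|]].
    by apply: tg3 => //; exact: EX.
  by rewrite -eF; apply: (main t s c) => //; apply/nesym.
- exists (gam c), (gam t); split; [|split; [exact: seg_r|]].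
    by apply: tg3 => //; exact: EX.
  by rewrite -eF; apply: (main c s t) => //; apply/nesym.
- exists (gam c), (gam s); split; [exact: seg_r|split].
    by apply: tg3 => //; exact: EX.
  by rewrite -eF; apply: (main c t s) => //; apply/nesym.
- exists (gam t), (gam s); split; [exact: seg_r|split; [exact: seg_l|]].
  by rewrite -eF; apply: (main t c s) => //; lra.
- exists (gam t), (gam s); split; [exact: seg_r|split; [exact: seg_l|]].
  by rewrite -eF; apply: (main t c s).
Qed.

(** A nonzero value of p on the curve is negative, because the positive side is outside X. The
    excursion around [w], between the last zero before it and the first zero after it, runs in the
    interior of X and is straight; as a chord of the arc it would lie in {p >= 0}. *)
Lemma stays_on_arc (s w t : R) : (forall w, U w -> 0 < p w -> ~ X w) ->
  s <= w -> w <= t -> (forall u, s <= u -> u <= t -> U (gam u)) ->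
  p (gam s) = 0 -> p (gam t) = 0 -> p (gam w) = 0.
Proof.
move=> pX sw wt inU ps pt'; apply: contrapT => pw.
have [_ gX _ _] := tg; have [_ _ cg] := taut_continuous tg.
have pneg u : s <= u -> u <= t -> p (gam u) <> 0 -> p (gam u) < 0.
  move=> su ut pu; have [//|pu'|//] := ltgtP (p (gam u)) 0.
  by exfalso; apply: (pX (gam u)) => //; exact: inU.
have pw0 := pneg w sw wt pw.
have nX : forall w, U w -> p w < 0 -> X w.
  by case: negX => // H; exfalso; apply: (H (gam w)) => //; exact: inU.
have cpg : continuous (p \o gam) by move=> u; apply: continuous_comp; [exact: cg|exact: cp].
have ps0 : 0 <= (p \o gam) s by rewrite /= ps.
have pt0 : 0 <= (p \o gam) t by rewrite /= pt'.
have [u [su uw pu Hu]] := last_zero cpg sw ps0 pw0.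
have [v [wv vt pv Hv]] := first_zero cpg wt pw0 pt0.
have : seg (gam u) (gam v) (gam w).
  apply: (taut_interior_straight tg) => // q uq qv.
  have sq : s <= q by apply: (le_trans su); exact: ltW.
  have qt : q <= t by apply: le_trans vt; exact: ltW.
  have pq : p (gam q) < 0.
    have [qw|/ltW wq] := leP q w; first exact: Hu.
    exact: Hv.
  have [r1 r10 b1] := continuous_neg_box cp pq.
  have [r2 r20 b2] := U_open (inU q sq qt).
  exists (Num.min r1 r2); first by rewrite lt_min r10.
  move=> z [z1 z2]; apply: nX.
  - by apply: b2; split; [apply: lt_le_trans z1 _|apply: lt_le_trans z2 _]; rewrite ge_min lexx orbT.
  - by apply: b1; split; [apply: lt_le_trans z1 _|apply: lt_le_trans z2 _]; rewrite ge_min lexx.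
move=> sg; have [_] : (U `&` [set w | 0 <= p w]) (gam w).
  apply: (E_cvx (P := gam u) (Q := gam v)) => //; split=> /=.
  - by apply: inU => //; lra.
  - by rewrite -[p _]/((p \o gam) u) pu.
  - by apply: inU => //; lra.
  - by rewrite -[p _]/((p \o gam) v) pv.
by rewrite /= leNgt pw0.
Qed.

(** The small oscillation keeps the curve in U once it has met the arc. Between two visits it never
    leaves the arc, so its first coordinate takes all values in between and F is an interval of the
    arc. *)
Lemma piece_finite_below (a b : R) F : (forall w, U w -> 0 < p w -> ~ X w) ->
  (forall s t, a <= s <= b -> a <= t <= b -> box (gam s) d (gam t)) ->
  F = [set z | e z /\ exists2 s, a <= s <= b & gam s = z] -> F `<=` range gam `&` e ->
  finite_set [set connected_component (range gam `&` e) x | x in F].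
Proof.
move=> pX osc eF FS; apply: finite_comps_connected => //.
apply: arc_connected => [z /FS[]//|P Q M]; rewrite eF.
move=> [[DP pP] [s sab gs]] [[DQ pQ] [t tab gt]] DM pM PM MQ; split=> //.
rewrite -gs in DP pP PM *; rewrite -gt in DQ pQ MQ *.
have [c1 _ cg] := taut_continuous tg.
have DU w : D w -> U w by move=> Dw; apply: (D_box Dw); exact: box_center.
have inU u : a <= u <= b -> U (gam u) by move=> uab; apply: (D_box DP); exact: osc.
have sub (s' t' : R) : a <= s' -> t' <= b -> s' <= t' -> p (gam s') = 0 -> p (gam t') = 0 ->
   Num.min (gam s').1 (gam t').1 <= M.1 <= Num.max (gam s').1 (gam t').1 ->
   exists2 u, a <= u <= b & gam u = M.
  move=> as' tb' st ps' pt' Mb.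
  have [u] := IVT st (continuous_subspaceT c1) Mb.
  rewrite in_itv/= => /andP[su ut] eu.
  have uab : a <= u <= b by rewrite (le_trans as' su) (le_trans ut tb').
  exists u => //; apply: x_inj => //; [exact: inU|exact: DU|].
  apply: (@stays_on_arc s' u t') => // q sq qt; apply: inU.
  by rewrite (le_trans as' sq) (le_trans qt tb').
move: sab tab => /andP[as_ sb] /andP[at_ tb].
have Mb : Num.min (gam s).1 (gam t).1 <= M.1 <= Num.max (gam s).1 (gam t).1.
  by rewrite ge_min le_max PM MQ orbT.
have [st|/ltW ts] := leP s t; first exact: (sub s t).
by apply: (sub t s) => //; rewrite minC maxC.
Qed.

Lemma arc_finite_comps :
  finite_set [set connected_component (range gam `&` e) x | x in range gam `&` e].
Proof.
have [[K K0 HK] _ _ gclamp] := tg.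
(* During a time 1/N each coordinate of the curve moves by less than d. *)
pose N : nat := (Num.truncn (K / d)).+1.
have N0 : 0 < N%:R :> R by rewrite ltr0n.
have KN : K / N%:R < d.
  rewrite ltr_pdivrMr// -ltr_pdivrMl// mulrC; apply: truncnS_gt.
pose F i : set pt := [set z | e z /\ exists2 s, i%:R / N%:R <= s <= i.+1%:R / N%:R & gam s = z].
have FS i : F i `<=` range gam `&` e by move=> z [ez [s _ gs]]; split=> //; exists s.
have osc i (s t : R) : i%:R / N%:R <= s <= i.+1%:R / N%:R -> i%:R / N%:R <= t <= i.+1%:R / N%:R ->
    box (gam s) d (gam t).
  move=> /andP[s1 s2] /andP[t1 t2]; have [h1 h2] := HK s t.
  have st : K * `|t - s| < d.
    apply: le_lt_trans KN; rewrite ler_wpM2l ?(ltW K0)// ler_norml.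
    have e1 : i.+1%:R / N%:R = i%:R / N%:R + N%:R^-1 :> R by rewrite -natr1 mulrDl mul1r.
    by rewrite e1 in s2 t2; apply/andP; split; lra.
  by split; [apply: le_lt_trans h1 st|apply: le_lt_trans h2 st].
(* There are N + 1 pieces because the time 1 is assigned the index N. *)
apply: (@finite_comps_bigcup _ _ N.+1 F).
  apply/seteqP; split=> [z [[s _ gs] ez]|z [i _ /FS//]].
  have /andP[s0 s1] := clamp01 s.
  have sN0 : 0 <= clamp s * N%:R by rewrite mulr_ge0//; exact: ltW.
  have /andP[l1 l2] := truncn_itv sN0.
  exists (Num.truncn (clamp s * N%:R)).
    rewrite /= ltnS -(ler_nat R); apply: le_trans l1 _.
    by rewrite ler_piMl//; exact: ltW.
  split=> //; exists (clamp s); last by rewrite gclamp.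
  by rewrite ler_pdivrMr// ler_pdivlMr// l1; exact: ltW.
move=> i _; case: posX => pX.
- exact: (piece_finite_above (a := i%:R / N%:R) (b := i.+1%:R / N%:R)).
- by apply: (piece_finite_below (a := i%:R / N%:R) (b := i.+1%:R / N%:R)) => //; exact: osc.
Qed.

End Arcs.

(** * Plane algebraic curves near generic points *)

Section BivariatePoly.
Variable R : realType.
Notation pt := (R * R)%type.
Notation poly2 := {poly {poly R}}.
Implicit Types (p q : poly2) (z w A v : pt) (c : {poly R}).

Local Notation spec x := (map_poly (horner_eval (x : R))).

Lemma peval2E p z : peval2 p z = (spec z.1 p).[z.2].
Proof. by []. Qed.

Lemma peval2MXaddC p c z : peval2 (p * 'X + c%:P) z = peval2 p z * z.2 + c.[z.1].
Proof.
by rewrite !peval2E rmorphD rmorphM /= map_polyX map_polyC/= hornerD hornerMX hornerC.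
Qed.

Lemma peval2_0 z : peval2 0 z = 0.
Proof. by rewrite peval2E rmorph0 horner0. Qed.

Lemma peval2_1 z : peval2 1 z = 1.
Proof. by rewrite peval2E rmorph1 hornerC. Qed.

Lemma peval2D p q z : peval2 (p + q) z = peval2 p z + peval2 q z.
Proof. by rewrite !peval2E rmorphD hornerD. Qed.

Lemma peval2N p z : peval2 (- p) z = - peval2 p z.
Proof. by rewrite !peval2E rmorphN hornerN. Qed.

Lemma peval2B p q z : peval2 (p - q) z = peval2 p z - peval2 q z.
Proof. by rewrite peval2D peval2N. Qed.

Lemma peval2M p q z : peval2 (p * q) z = peval2 p z * peval2 q z.
Proof. by rewrite !peval2E rmorphM hornerM. Qed.

Lemma peval2X p n z : peval2 (p ^+ n) z = peval2 p z ^+ n.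
Proof. by rewrite !peval2E rmorphXn/= horner_exp. Qed.

Lemma peval2_mulrn p n z : peval2 (p *+ n) z = peval2 p z *+ n.
Proof. by rewrite !peval2E rmorphMn hornerMn. Qed.

Lemma peval2C c z : peval2 c%:P z = c.[z.1].
Proof. by rewrite -[c%:P]add0r -[0](mul0r 'X) peval2MXaddC peval2_0 mul0r add0r. Qed.

Lemma peval2Z c p z : peval2 (c *: p) z = c.[z.1] * peval2 p z.
Proof. by rewrite -mul_polyC peval2M peval2C. Qed.

Lemma peval2_prod (I : Type) (s : seq I) (F : I -> poly2) z :
  peval2 (\prod_(i <- s) F i) z = \prod_(i <- s) peval2 (F i) z.
Proof. by elim/big_rec2: _ => [|i a b _ <-]; rewrite ?peval2_1 ?peval2M. Qed.

Lemma horner_continuous c : continuous (fun x : R => c.[x]).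
Proof.
elim/poly_ind: c => [|c a IH] x.
  by rewrite (_ : (fun _ => _) = cst 0); [exact: cvg_cst|apply/funext => y; rewrite horner0].
rewrite (_ : (fun _ => _) = fun y => c.[y] * y + a); last by apply/funext => y; rewrite hornerMXaddC.
by apply: cvgD; [apply: cvgM; [exact: IH|exact: cvg_id]|exact: cvg_cst].
Qed.

Lemma peval2_continuous p : continuous (peval2 p).
Proof.
elim/poly_ind: p => [|p c IH] z.
  by rewrite (_ : peval2 _ = cst 0); [exact: cvg_cst|apply/funext => y; rewrite peval2_0].
rewrite (_ : peval2 _ = fun w => peval2 p w * w.2 + c.[w.1]); last first.
  by apply/funext => y; rewrite peval2MXaddC.
apply: cvgD; first by apply: cvgM; [exact: IH|exact: cvg_snd].
by apply: (@continuous_comp _ _ _ (fst : pt -> R) (fun x => c.[x])); [exact: cvg_fst|exact: horner_continuous].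
Qed.

(** Deriving the coefficients is differentiation in x; the derivative of a polynomial over
    [{poly R}] is differentiation in y. *)
Definition dx p : poly2 := map_poly (@deriv R) p.

Lemma dx0 : dx 0 = 0. Proof. exact: map_poly0. Qed.

Lemma dxMXaddC p c : dx (p * 'X + c%:P) = dx p * 'X + (c^`())%:P.
Proof.
apply/polyP => i; rewrite coef_map_id0 ?deriv0// !coefD !coefMX !coefC.
by case: i => [|i]; rewrite /= ?add0r ?addr0 ?coef_map_id0 ?deriv0.
Qed.

Lemma dyMXaddC p c : (p * 'X + c%:P)^`() = p^`() * 'X + p.
Proof. by rewrite derivD derivC addr0 derivM derivX mulr1. Qed.

(** The restriction to a parametrized line is a polynomial in the parameter, so univariate mean and
    intermediate value theorems apply; [deriv_line] is the chain rule. *)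
Definition line A v p : {poly R} :=
  (map_poly (fun c => c \Po (A.1%:P + v.1 *: 'X)) p).[A.2%:P + v.2 *: 'X].

Lemma line0 A v : line A v 0 = 0.
Proof. by rewrite /line map_poly0 horner0. Qed.

Lemma lineMXaddC A v p c :
  line A v (p * 'X + c%:P) = line A v p * (A.2%:P + v.2 *: 'X) + (c \Po (A.1%:P + v.1 *: 'X)).
Proof.
rewrite /line; set l1 := A.1%:P + _; set l2 := A.2%:P + _.
have -> : map_poly (fun c => c \Po l1) (p * 'X + c%:P) =
    map_poly (fun c => c \Po l1) p * 'X + (c \Po l1)%:P.
  have h0 : (fun c : {poly R} => c \Po l1) 0 = 0 by rewrite /= comp_poly0.
  apply/polyP => i; rewrite coef_map_id0 ?h0// !coefD !coefMX !coefC.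
  by case: i => [|i]; rewrite /= ?add0r ?addr0 ?coef_map_id0 ?h0.
by rewrite hornerMXaddC.
Qed.

Lemma horner_line A v p t : (line A v p).[t] = peval2 p (A.1 + t * v.1, A.2 + t * v.2).
Proof.
elim/poly_ind: p => [|p c IH]; first by rewrite line0 peval2_0 horner0.
rewrite lineMXaddC peval2MXaddC hornerD hornerM IH horner_comp.
by rewrite !hornerD !hornerC !hornerZ !hornerX/= ![t * _]mulrC.
Qed.

Lemma deriv_line A v p : (line A v p)^`() = v.1 *: line A v (dx p) + v.2 *: line A v p^`().
Proof.
elim/poly_ind: p => [|p c IH]; first by rewrite dx0 deriv0 !line0 deriv0 !scaler0 addr0.
rewrite dxMXaddC dyMXaddC (lineMXaddC A v p c) (lineMXaddC A v (dx p)) derivD derivM IH deriv_comp.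
have addL q r : line A v (q + r) = line A v q + line A v r.
  elim/poly_ind: q r => [r|q d IHq r]; first by rewrite line0 !add0r.
  elim/poly_ind: r => [|r d' _]; first by rewrite line0 !addr0.
  rewrite addrACA -mulrDl -polyCD !lineMXaddC IHq comp_polyD; ring.
have -> : line A v (p^`() * 'X + p) = line A v p^`() * (A.2%:P + v.2 *: 'X) + line A v p.
  rewrite addL; congr (_ + _).
  by rewrite -[_ * 'X]addr0 -[0]/((0 : {poly R})%:P) lineMXaddC comp_poly0 addr0.
rewrite !derivD !derivC !derivZ !derivX !add0r !alg_polyC.
rewrite -!mul_polyC; ring.
Qed.

End BivariatePoly.

(** * Short bumps and the second derivative along level curves *)

Section ShortBumps.
Variable R : realType.
Notation pt := (R * R)%type.
Notation poly2 := {poly {poly R}}.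
Implicit Types (p q : poly2) (z w A v : pt) (h : {poly R}).

Lemma horner_mvt h (a b : R) : a < b ->
  exists c, [/\ a < c, c < b & h.[b] - h.[a] = h^`().[c] * (b - a)].
Proof.
move=> ab; have [c + e] := polyrcf.poly_mvt h ab.
by rewrite in_itv/= => /andP[ac cb]; exists c.
Qed.

Lemma horner_near_neg h (x : R) : h.[x] < 0 ->
  exists2 d, 0 < d & forall y, `|y - x| < d -> h.[y] < 0.
Proof.
move=> hx; have : \forall y \near x, h.[y] < 0.
  exact: (cvgr_lt h.[x] (@horner_continuous _ h x) 0 hx).
by move=> /nbhs_ballP[d d0 Hd]; exists d => // y yd; apply: Hd; rewrite /ball/= distrC.
Qed.

(* With m := min h', one has h <= -m on [0,1]; at the last zero r of h' before the
   minimum s, the mean value theorem bounds |m| by 2 kap |m|. *)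
Lemma no_short_bump h (kap : R) : 0 <= kap -> kap < 2^-1 -> h.[0] = 0 -> h.[1] = 0 ->
  (forall t, 0 < t -> t < 1 -> 0 < h.[t]) ->
  ~ (forall t, 0 <= t -> t <= 1 -> - (kap * (h.[t] + `|h^`().[t]|)) <= h^`()^`().[t]).
Proof.
move=> k0 k1 h0 h1 hpos H.
have [s + smin] := EVT_min ler01 (continuous_subspaceT (@horner_continuous _ h^`())).
rewrite in_itv/= => /andP[s0 s1].
have {}smin t : 0 <= t -> t <= 1 -> h^`().[s] <= h^`().[t].
  by move=> t0 t1; apply: smin; rewrite in_itv/= t0.
set m := h^`().[s] in smin.
have m0 : m < 0.
  have h2 : (2^-1 : R) < 1 by lra.
  have [c [c1 c2 e]] := horner_mvt h h2.
  have := hpos 2^-1; have := smin c; rewrite h1 in e => q1 q2.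
  have q3 : m <= h^`().[c] by apply: q1; lra.
  have q4 : 0 < h.[2^-1] by apply: q2; lra.
  nra.
have hle t : 0 <= t -> t <= 1 -> h.[t] <= - m.
  move=> t0; rewrite le_eqVlt => /predU1P[->|t1]; first by rewrite h1; lra.
  have [c [c1 c2]] := horner_mvt h t1; rewrite h1 => e.
  have q : m <= h^`().[c] by apply: smin; lra.
  nra.
(* The minimum of h' is not at 0, for h would then fall below 0 just after 0; so the mean value
   theorem applies on [0, s], where h(s) >= 0 = h(0). *)
have [x [x0 xs hx]] : exists x, [/\ 0 <= x, x <= s & 0 <= h^`().[x]].
  move: s0; rewrite le_eqVlt => /predU1P[s00|s0].
    exfalso; have [d d0 Hd] := @horner_near_neg h^`() s m0.
    pose t := Num.min (d / 2) 2^-1.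
    have t0 : 0 < t by rewrite lt_min divr_gt0//=; lra.
    have t1 : t <= 2^-1 by rewrite ge_min lexx orbT.
    have td : t <= d / 2 by rewrite ge_min lexx.
    have [c [c0 ct]] := horner_mvt h t0; rewrite h0 subr0 => e.
    have q : h^`().[c] < 0 by apply: Hd; rewrite -s00 ltr_norml; apply/andP; split; lra.
    have := hpos t; have : h.[t] < 0 by rewrite e subr0; nra.
    by move=> q1 q2; have : 0 < h.[t] by [apply: q2; lra]; lra.
  have [c [c0 cs]] := horner_mvt h s0; rewrite h0 !subr0 => e.
  exists c; split; [exact: ltW|exact: ltW|].
  have : 0 <= h.[s].
    move: s1; rewrite le_eqVlt => /predU1P[->|s1]; first by rewrite h1.
    by apply/ltW/hpos.
  by rewrite e pmulr_lge0.
have [r [xr rs hr after]] := last_zero (@horner_continuous _ h^`()) xs hx m0.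
have [c [rc cs]] := horner_mvt h^`() rs; rewrite hr subr0 -/m => e.
have c01 : 0 <= c /\ c <= 1 by split; lra.
have q1 := H c c01.1 c01.2; have q2 := smin c c01.1 c01.2; have q3 := hle c c01.1 c01.2.
have q4 : h^`().[c] < 0 by apply: after; lra.
rewrite ltr0_norm// in q1.
(* Past r, h' lies between m and 0, so h and |h'| are both at most -m at c. With s - r <= 1 this
   leads to m >= 2 kap m, although m < 0 and 2 kap < 1. *)
have q5 : 2 * kap * m <= h^`()^`().[c].
  have q8 : 0 <= kap * (- m - h.[c]) by apply: mulr_ge0 => //; lra.
  have q9 : 0 <= kap * (h^`().[c] - m) by apply: mulr_ge0 => //; lra.
  lra.
have q6 : 2 * kap * m * (s - r) <= m by rewrite [leRHS]e; apply: ler_wpM2r => //; lra.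
have q7 : 2 * kap * m <= 2 * kap * m * (s - r).
  have q8 : 0 <= kap * (- m) by apply: mulr_ge0 => //; lra.
  have q9 : 0 <= kap * (- m) * (1 - (s - r)) by apply: mulr_ge0 => //; lra.
  lra.
have q10 : 0 < (1 - 2 * kap) * (- m) by apply: mulr_gt0; lra.
lra.
Qed.

(* The second derivative of p along its level curves, scaled by the squared gradient. *)
Definition curv p : poly2 :=
  dx (dx p) * p^`() ^+ 2 - (dx p)^`() * dx p * p^`() *+ 2 + p^`()^`() * dx p ^+ 2.

Lemma peval2_curv p w : peval2 (curv p) w =
  peval2 (dx (dx p)) w * peval2 p^`() w ^+ 2
  - peval2 (dx p)^`() w * peval2 (dx p) w * peval2 p^`() w *+ 2
  + peval2 p^`()^`() w * peval2 (dx p) w ^+ 2.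
Proof. by rewrite /curv peval2D peval2B peval2_mulrn !(peval2M, peval2X). Qed.

Lemma dxdy p : dx p^`() = (dx p)^`().
Proof.
elim/poly_ind: p => [|p c IH]; first by rewrite deriv0 dx0 deriv0.
rewrite dyMXaddC dxMXaddC dyMXaddC -IH.
elim/poly_ind: p {IH} => [|p d _]; first by rewrite deriv0 mul0r !add0r dx0 mul0r !addr0.
have dxD q r : dx (q + r) = dx q + dx r.
  by apply/polyP => i; rewrite coefD !coef_map_id0 ?deriv0// coefD derivD.
rewrite dxD; congr (_ + _).
by rewrite -[_ * 'X in LHS]addr0 -[0]/((0 : {poly R})%:P) dxMXaddC deriv0 addr0.
Qed.

Lemma deriv2_line A v p : (line A v p)^`()^`() =
  v.1 ^+ 2 *: line A v (dx (dx p)) + (v.1 * v.2 *+ 2) *: line A v (dx p)^`()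
  + v.2 ^+ 2 *: line A v p^`()^`().
Proof.
rewrite deriv_line derivD !derivZ !deriv_line dxdy -!mul_polyC !polyCMn !polyCM.
ring.
Qed.

Lemma peval2_bounded q z : exists2 r : R, 0 < r &
  forall w, box z r w -> `|peval2 q w| <= `|peval2 q z| + 1.
Proof.
have cq : continuous (fun w => `|peval2 q z| + 1 - `|peval2 q w|).
  move=> w; apply: cvgB; first exact: cvg_cst.
  by apply: (@cvg_comp _ _ _ (peval2 q) (fun x : R => `|x|)); [exact: peval2_continuous|exact: norm_continuous].
have [|r r0 H] := @continuous_pos_box _ _ z cq; first by rewrite addrAC subrr add0r.
by exists r => // w /H; lra.
Qed.

Lemma box_le z (r r' : R) : r <= r' -> box z r `<=` box z r'.
Proof. by move=> rr w [h1 h2]; split; [apply: lt_le_trans h1 rr|apply: lt_le_trans h2 rr]. Qed.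

(* Writing n for the gradient, tau = (p_y, -p_x), w = |n|^2 and w v = a tau + b n, one has
   w^2 D^2p(v,v) = a^2 curv + b (2 a D^2p(tau,n) + b D^2p(n,n)). *)
Lemma hessian_bound (xx xy yy x y v1 v2 B C N P m r : R) :
  `|xx| <= B -> `|xy| <= B -> `|yy| <= B -> `|x| <= B -> `|y| <= B -> 0 <= P -> 0 <= C -> 0 <= r -> r <= 1 ->
  `|v1| <= 2 * r -> `|v2| <= 2 * r -> 0 < m -> m <= (x ^+ 2 + y ^+ 2) ^+ 2 ->
  N = xx * y ^+ 2 - xy * x * y *+ 2 + yy * x ^+ 2 -> N <= C * P ->
  v1 ^+ 2 * xx + (v1 * v2 *+ 2) * xy + v2 ^+ 2 * yy <=
    (16 * B ^+ 2 * C + 48 * B ^+ 4) / m * r * (P + `|v1 * x + v2 * y|).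
Proof.
move=> hxx hxy hyy hx hy P0 C0 r0 r1 hv1 hv2 m0 hm eN hN.
have B0 : 0 <= B := le_trans (normr_ge0 _) hx.
set D := _ + v2 ^+ 2 * yy.
set a := v1 * y - v2 * x; set b := v1 * x + v2 * y.
pose T := xx * y * x + xy * (y ^+ 2 - x ^+ 2) - yy * x * y.
pose S := xx * x ^+ 2 + xy * x * y *+ 2 + yy * y ^+ 2.
have e : (x ^+ 2 + y ^+ 2) ^+ 2 * D = a ^+ 2 * N + b * (2 * a * T + b * S).
  by rewrite /D /a /b /T /S eN; ring.
have nM u1 u2 U1 U2 : `|u1| <= U1 -> `|u2| <= U2 -> `|u1 * u2| <= U1 * U2 :> R.
  by move=> h1 h2; rewrite normrM ler_pM.
have nD u1 u2 U1 U2 : `|u1| <= U1 -> `|u2| <= U2 -> `|u1 + u2| <= U1 + U2 :> R.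
  by move=> h1 h2; apply: le_trans (ler_normD _ _) _; exact: lerD.
have nB u1 u2 U1 U2 : `|u1| <= U1 -> `|u2| <= U2 -> `|u1 - u2| <= U1 + U2 :> R.
  by move=> h1 h2; apply: le_trans (ler_normB _ _) _; exact: lerD.
have hx2 : `|x ^+ 2| <= B * B by rewrite expr2; apply: nM.
have hy2 : `|y ^+ 2| <= B * B by rewrite expr2; apply: nM.
have ha : `|a| <= 4 * r * B.
  by rewrite (_ : 4 * r * B = 2 * r * B + 2 * r * B); [apply: nB; apply: nM|ring].
have hb : `|b| <= 4 * r * B.
  by rewrite (_ : 4 * r * B = 2 * r * B + 2 * r * B); [apply: nD; apply: nM|ring].
have hT : `|T| <= 4 * B ^+ 3.
  rewrite (_ : 4 * B ^+ 3 = B * B * B + B * (B * B + B * B) + B * B * B); last by ring.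
  by apply: (nB); [apply: (nD); [do 2 apply: (nM) => //|apply: (nM) => //; apply: (nB)]|do 2 apply: (nM) => //].
have hS : `|S| <= 4 * B ^+ 3.
  rewrite (_ : 4 * B ^+ 3 = B * (B * B) + (B * B * B + B * B * B) + B * (B * B)); last by ring.
  apply: (nD); [apply: (nD); [exact: nM|]|exact: nM].
  by rewrite mulr2n; apply: (nD); do 2 apply: (nM) => //.
(* |a| <= 4 r B gives 16 r^2 B^2, and r <= 1 trades r^2 for r. The 48 of the next bound is 2 * 4 * 4
   + 4 * 4. *)
have h1 : a ^+ 2 * N <= 16 * B ^+ 2 * C * r * P.
  apply: (@le_trans _ _ (a ^+ 2 * (C * P))); first by rewrite ler_wpM2l ?sqr_ge0.
  rewrite (_ : 16 * B ^+ 2 * C * r * P = 16 * B ^+ 2 * r * (C * P)); last by ring.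
  rewrite ler_wpM2r ?mulr_ge0//.
  have : `|a| ^+ 2 <= (4 * r * B) ^+ 2 by rewrite lerXn2r ?nnegrE ?mulr_ge0.
  rewrite real_normK ?num_real// => h; apply: le_trans h _.
  have : 0 <= 16 * B ^+ 2 * (r * (1 - r)) by rewrite !mulr_ge0 ?exprn_ge0// subr_ge0.
  lra.
have h2 : b * (2 * a * T + b * S) <= 48 * B ^+ 4 * r * `|b|.
  apply: le_trans (ler_norm _) _; rewrite normrM mulrC ler_wpM2r//.
  rewrite (_ : 48 * B ^+ 4 * r = 2 * (4 * r * B) * (4 * B ^+ 3) + 4 * r * B * (4 * B ^+ 3)); last by ring.
  apply: (nD); apply: (nM) => //.
  by apply: (nM) => //; rewrite ger0_norm.
have K0 : 0 <= 16 * B ^+ 2 * C + 48 * B ^+ 4.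
  by rewrite addr_ge0// ?mulr_ge0 ?exprn_ge0.
have [D0|D0] := leP D 0.
  by apply: le_trans D0 _; apply: mulr_ge0; [apply: mulr_ge0 => //; apply: mulr_ge0 => //; rewrite invr_ge0; exact: ltW|exact: addr_ge0].
rewrite [leRHS](_ : _ = m^-1 * ((16 * B ^+ 2 * C + 48 * B ^+ 4) * r * (P + `|b|))); last by ring.
rewrite ler_pdivlMl//.
apply: (@le_trans _ _ ((x ^+ 2 + y ^+ 2) ^+ 2 * D)); first by rewrite ler_wpM2r// (ltW D0).
rewrite e.
have g1 : 0 <= 48 * B ^+ 4 * r * P by rewrite !mulr_ge0 ?exprn_ge0.
have g2 : 0 <= 16 * B ^+ 2 * C * r * `|b| by rewrite !mulr_ge0 ?exprn_ge0.
lra.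
Qed.

End ShortBumps.

(** * Local convexity and monotonicity of a polynomial *)

Section LocalConvexity.
Variable R : realType.
Notation pt := (R * R)%type.
Notation poly2 := {poly {poly R}}.
Implicit Types (p q : poly2) (z w A v : pt) (h : {poly R}).

(** Neighbourhoods with an explicit radius, to be compared with dyadic squares by [dsq_box]. *)
Definition bnear z (Q : pt -> Prop) : Prop := exists2 r : R, 0 < r & forall w, box z r w -> Q w.

Lemma bnearI z (Q1 Q2 : pt -> Prop) : bnear z Q1 -> bnear z Q2 -> bnear z (fun w => Q1 w /\ Q2 w).
Proof.
move=> [r1 r10 H1] [r2 r20 H2]; exists (Num.min r1 r2); first by rewrite lt_min r10.
move=> w bw; split; [apply: H1|apply: H2]; apply: box_le bw; rewrite ge_min lexx ?orbT//.
Qed.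

Lemma bnear_imp z (Q1 Q2 : pt -> Prop) : (forall w, Q1 w -> Q2 w) -> bnear z Q1 -> bnear z Q2.
Proof. by move=> H [r r0 H1]; exists r => // w /H1 /H. Qed.

Lemma bnear_gt0 p z : 0 < peval2 p z -> bnear z (fun w => 0 < peval2 p w).
Proof. exact/continuous_pos_box/peval2_continuous. Qed.

Lemma bnear_lt0 p z : peval2 p z < 0 -> bnear z (fun w => peval2 p w < 0).
Proof. exact/continuous_neg_box/peval2_continuous. Qed.

Lemma bnear_neq0 p z : peval2 p z != 0 -> bnear z (fun w => Num.sg (peval2 p w) = Num.sg (peval2 p z)).
Proof.
move=> pz; have [pz0|pz0|pz0] := ltgtP (peval2 p z) 0; last by rewrite pz0 eqxx in pz.
- by apply: bnear_imp (bnear_lt0 pz0) => w pw; rewrite !ltr0_sg.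
- by apply: bnear_imp (bnear_gt0 pz0) => w pw; rewrite !gtr0_sg.
Qed.

Lemma lpt_line p A B t : peval2 p (lpt A B t) = (line A (B.1 - A.1, B.2 - A.2) p).[t].
Proof. by rewrite horner_line. Qed.

Lemma lpt_between (s1 s2 s : R) : s1 < s2 -> 0 < s -> s < 1 ->
  s1 < s1 + s * (s2 - s1) /\ s1 + s * (s2 - s1) < s2.
Proof.
move=> s12 s0 s1'; split; first by rewrite ltrDl mulr_gt0// subr_gt0.
rewrite addrC -ltrBrDr; have : 0 < (1 - s) * (s2 - s1) by rewrite mulr_gt0// subr_gt0.
lra.
Qed.

Lemma box_diff z (r : R) A B : box z r A -> box z r B ->
  `|B.1 - A.1| <= 2 * r /\ `|B.2 - A.2| <= 2 * r.
Proof.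
move=> [+ +] [+ +]; rewrite !ltr_norml !ler_norml.
by move=> /andP[? ?] /andP[? ?] /andP[? ?] /andP[? ?]; split; apply/andP; split; lra.
Qed.

(* On a chord of {p >= 0} leaving this set, -p would be a short bump. *)
Lemma local_cvx p z (C : R) : 0 <= C -> peval2 p^`() z != 0 ->
  bnear z (fun w => peval2 (curv p) w <= C * `|peval2 p w|) ->
  exists2 r1 : R, 0 < r1 & forall r, r <= r1 -> cvx (box z r `&` [set w | 0 <= peval2 p w]).
Proof.
move=> C0 py hcurv.
pose xx := dx (dx p); pose xy := (dx p)^`(); pose yy := p^`()^`().
pose B := (`|peval2 xx z| + 1) + (`|peval2 xy z| + 1) + (`|peval2 yy z| + 1) +
  (`|peval2 (dx p) z| + 1) + (`|peval2 p^`() z| + 1).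
have Bnear q : `|peval2 q z| + 1 <= B -> bnear z (fun w => `|peval2 q w| <= B).
  by move=> qB; have [r r0 H] := peval2_bounded q z; exists r => // w /H h; apply: le_trans h qB.
have b1 := normr_ge0 (peval2 xx z); have b2 := normr_ge0 (peval2 xy z).
have b3 := normr_ge0 (peval2 yy z); have b4 := normr_ge0 (peval2 (dx p) z).
have b5 := normr_ge0 (peval2 p^`() z).
have n1 := @Bnear xx ltac:(rewrite /B; lra).
have n2 := @Bnear xy ltac:(rewrite /B; lra).
have n3 := @Bnear yy ltac:(rewrite /B; lra).
have n4 := @Bnear (dx p) ltac:(rewrite /B; lra).
have n5 := @Bnear p^`() ltac:(rewrite /B; lra).
pose G : poly2 := dx p ^+ 2 + p^`() ^+ 2.
have Ge w : peval2 G w = peval2 (dx p) w ^+ 2 + peval2 p^`() w ^+ 2.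
  by rewrite /G peval2D !peval2X.
have G0 : 0 < peval2 G z.
  by rewrite Ge ltr_wpDl ?sqr_ge0// lt_neqAle sqr_ge0 eq_sym sqrf_eq0 py.
set g := peval2 G z / 2; have g0 : 0 < g by rewrite divr_gt0.
have nG : bnear z (fun w => g <= peval2 G w).
  have : bnear z (fun w => 0 < peval2 (G - (g%:P)%:P) w).
    by apply: bnear_gt0; rewrite peval2B peval2C hornerC /g; lra.
  by apply: bnear_imp => w; rewrite peval2B peval2C hornerC subr_gt0; exact: ltW.
have [r0 r00 H] := bnearI (bnearI (bnearI n1 n2) (bnearI n3 n4)) (bnearI (bnearI n5 nG) hcurv).
have m0 : 0 < g ^+ 2 by rewrite exprn_gt0.
set K := (16 * B ^+ 2 * C + 48 * B ^+ 4) / g ^+ 2.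
have B0 : 0 <= B by rewrite /B; lra.
have K0 : 0 <= K.
  by apply: divr_ge0; [apply: addr_ge0; rewrite !mulr_ge0 ?exprn_ge0|exact: ltW].
have K1 : 0 < 4 * K + 1 by lra.
(* The last bound makes K r < 1/2, as [no_short_bump] requires; [hessian_bound] uses r <= 1. *)
exists (Num.min r0 (Num.min 1 (4 * K + 1)^-1)); first by rewrite !lt_min r00 ltr01 invr_gt0.
move=> r; rewrite !le_min => /andP[rr0 /andP[r1 rK]].
have [rle0|rpos] := leP r 0.
  by move=> P Q [[h _] _]; have := le_lt_trans (normr_ge0 _) h; rewrite ltNge rle0.
have Kr : K * r < 2^-1.
  have : (4 * K + 1) * r <= 1 by rewrite -ler_pdivlMl// mulr1.
  have : 0 <= K * r by rewrite mulr_ge0// ltW.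
  lra.
move=> P Q [bP pP] [bQ pQ] M PQM; split; first exact: (box_cvx bP bQ).
rewrite /= leNgt; apply/negP => pM.
case: PQM => t /andP[t0 t1] eM; rewrite -/(lpt P Q t) in eM.
set k := line P (Q.1 - P.1, Q.2 - P.2) p.
have kE s : peval2 p (lpt P Q s) = k.[s] by rewrite lpt_line.
have lpt0 : lpt P Q 0 = P by rewrite /lpt !mul0r !addr0; case: (P).
have lpt1 : lpt P Q 1 = Q by rewrite /lpt !mul1r ![_ + (_ - _)]addrC !subrK; case: (Q).
have k0 : 0 <= k.[0] by rewrite -kE lpt0.
have k1 : 0 <= k.[1] by rewrite -kE lpt1.
have kt : k.[t] < 0 by rewrite -kE -eM.
(* The chord is cut down to the stretch around t on which p < 0. There -p is a bump vanishing at
   both ends, and the direction vector still has coordinates at most 2 r. *)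
have [s1 [s10 s1t ks1 kneg1]] := last_zero (@horner_continuous _ k) t0 k0 kt.
have [s2 [ts2 s21 ks2 kneg2]] := first_zero (@horner_continuous _ k) t1 kt k1.
have bl s : 0 <= s -> s <= 1 -> box z r (lpt P Q s).
  by move=> h1 h2; apply: (box_cvx bP bQ); exists s; rewrite ?h1.
set A := lpt P Q s1; set A' := lpt P Q s2; set v : pt := (A'.1 - A.1, A'.2 - A.2).
have bA : box z r A by apply: bl => //; lra.
have bA' : box z r A' by apply: bl => //; lra.
have AA' s : lpt A A' s = lpt P Q (s1 + s * (s2 - s1)) by rewrite /lpt/=; congr (_, _); ring.
pose h := - line A v p.
have hE s : h.[s] = - k.[s1 + s * (s2 - s1)] by rewrite /h hornerN -lpt_line AA' kE.
apply: (@no_short_bump _ h (K * r)) => //.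
- by rewrite mulr_ge0// ltW.
- by rewrite hE mul0r addr0 ks1 oppr0.
- by rewrite hE mul1r addrC subrK ks2 oppr0.
- move=> s sp s1'; rewrite hE oppr_gt0; set u := s1 + _.
  have [u1 u2] := lpt_between (lt_trans s1t ts2) sp s1'.
  by have [ut|/ltW tu] := leP u t; [exact: kneg1|exact: kneg2].
- move=> s sp s1'.
  have bs : box z r (lpt A A' s) by apply: (box_cvx bA bA'); exists s; rewrite ?sp.
  have [[[h1 h2] [h3 h4]] [[h5 h6] h7]] := H _ (box_le rr0 bs).
  rewrite /h !derivN !hornerN normrN lerN2 deriv2_line deriv_line.
  rewrite !hornerD !hornerZ !horner_line.
  have -> : (A.1 + s * v.1, A.2 + s * v.2) = lpt A A' s by [].
  have hp : - peval2 p (lpt A A' s) = `|peval2 p (lpt A A' s)|.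
    rewrite ler0_norm// AA' kE -oppr_ge0 -hE.
    move: sp s1'; rewrite le_eqVlt => /predU1P[<-|sp]; first by rewrite hE mul0r addr0 ks1 oppr0.
    rewrite le_eqVlt => /predU1P[->|s1']; first by rewrite hE mul1r addrC subrK ks2 oppr0.
    rewrite hE oppr_ge0 ltW//; set u := s1 + _.
    have [u1 u2] := lpt_between (lt_trans s1t ts2) sp s1'.
    by have [ut|/ltW tu] := leP u t; [exact: kneg1|exact: kneg2].
  rewrite hp; apply: (hessian_bound (N := peval2 (curv p) (lpt A A' s))) => //.
  + exact: ltW.
  + by have [] := box_diff bA bA'.
  + by have [] := box_diff bA bA'.
  + by rewrite -Ge lerXn2r// ?nnegrE ?(ltW g0)// (le_trans _ h6)// ltW.
  + by rewrite peval2_curv.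
Qed.

(** The factor s, later the sign of the partial derivative at z, treats increasing and decreasing p
    at once. *)
Lemma box_monotone_y p z (r s : R) w (y : R) : (forall w, box z r w -> 0 < s * peval2 p^`() w) ->
  box z r w -> box z r (w.1, y) -> w.2 < y -> s * peval2 p w < s * peval2 p (w.1, y).
Proof.
move=> H bw by_ wy.
have [c [c1 c2]] := horner_mvt (line (w.1, 0) (0, 1) p) wy.
rewrite deriv_line hornerD !hornerZ !horner_line/= !mulr0 !mulr1 !add0r !addr0 mul0r add0r mul1r.
rewrite -surjective_pairing => e.
have bc : box z r (w.1, c).
  move: bw by_ => [w1 w2] [_ y2]; split=> //=; move: w2 y2; rewrite /= !ltr_norml.
  by move=> /andP[? ?] /andP[? ?]; apply/andP; split; lra.
have := H _ bc => hc.
have : 0 < s * peval2 p^`() (w.1, c) * (y - w.2) by rewrite mulr_gt0// subr_gt0.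
by rewrite -mulrA -e; lra.
Qed.

Lemma box_monotone_x p z (r s : R) w (x : R) : (forall w, box z r w -> 0 < s * peval2 (dx p) w) ->
  box z r w -> box z r (x, w.2) -> w.1 < x -> s * peval2 p w < s * peval2 p (x, w.2).
Proof.
move=> H bw bx wx.
have [c [c1 c2]] := horner_mvt (line (0, w.2) (1, 0) p) wx.
rewrite deriv_line hornerD !hornerZ !horner_line/= !mulr0 !mulr1 !add0r !addr0 mul0r addr0 mul1r.
rewrite -surjective_pairing => e.
have bc : box z r (c, w.2).
  move: bw bx => [w1 w2] [x1 _]; split=> //=; move: w1 x1; rewrite /= !ltr_norml.
  by move=> /andP[? ?] /andP[? ?]; apply/andP; split; lra.
have := H _ bc => hc.
have : 0 < s * peval2 (dx p) (c, w.2) * (x - w.1) by rewrite mulr_gt0// subr_gt0.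
by rewrite -mulrA -e; lra.
Qed.

Lemma zero_uniq_y p z (r s : R) w w' : (forall w, box z r w -> 0 < s * peval2 p^`() w) ->
  box z r w -> box z r w' -> peval2 p w = 0 -> peval2 p w' = 0 -> w.1 = w'.1 -> w = w'.
Proof.
move=> Hy bw bw' pw pw' e1; rewrite [w]surjective_pairing [w']surjective_pairing e1; congr (_, _).
have [l|l|//] := ltgtP w.2 w'.2.
- have := box_monotone_y (y := w'.2) Hy bw; rewrite e1 -surjective_pairing pw pw' => /(_ bw' l).
  by rewrite ltxx.
- have := box_monotone_y (y := w.2) Hy bw'; rewrite -e1 -surjective_pairing pw pw' => /(_ bw l).
  by rewrite ltxx.
Qed.

Lemma zero_uniq_x p z (r s : R) w w' : (forall w, box z r w -> 0 < s * peval2 (dx p) w) ->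
  box z r w -> box z r w' -> peval2 p w = 0 -> peval2 p w' = 0 -> w.2 = w'.2 -> w = w'.
Proof.
move=> Hx bw bw' pw pw' e2; rewrite [w]surjective_pairing [w']surjective_pairing e2; congr (_, _).
have [l|l|//] := ltgtP w.1 w'.1.
- have := box_monotone_x (x := w'.1) Hx bw; rewrite e2 -surjective_pairing pw pw' => /(_ bw' l).
  by rewrite ltxx.
- have := box_monotone_x (x := w.1) Hx bw'; rewrite -e2 -surjective_pairing pw pw' => /(_ bw l).
  by rewrite ltxx.
Qed.

Lemma bnear_sg q z : peval2 q z != 0 -> bnear z (fun w => 0 < Num.sg (peval2 q z) * peval2 q w).
Proof.
move=> qz; apply: bnear_imp (bnear_neq0 qz) => w h.
by rewrite -h -normrEsg normr_gt0 -sgr_eq0 h sgr_eq0.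
Qed.

Lemma dxN p : dx (- p) = - dx p.
Proof. by apply/polyP => i; rewrite coefN !coef_map_id0 ?deriv0// coefN derivN. Qed.

Lemma curvN p : curv (- p) = - curv p.
Proof. by rewrite /curv !dxN !derivN; ring. Qed.

End LocalConvexity.

(** * Divisibility arguments outside finitely many vertical lines *)

Section GenericFibers.
Variable R : realType.
Notation pt := (R * R)%type.
Notation poly2 := {poly {poly R}}.
Implicit Types (p q : poly2) (z w : pt).
Local Notation spec x := (map_poly (horner_eval (x : R))).

(** R[x] is not a field, so divisibility by the gcd and Bezout's identity hold up to nonzero factors
    in R[x]; their roots are vertical lines to be left out. *)
Lemma gcd_data (a b : poly2) : exists G H K u v : poly2, exists c1 c2 d : {poly R},
  [/\ c1 != 0, c2 != 0 & d != 0] /\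
  [/\ c1 *: a = H * G, c2 *: b = K * G & u * a + v * b = d *: G].
Proof.
have [[c1 H] /= c10 e1] := Pdiv.Idomain.dvdpP _ _ (Pdiv.Idomain.dvdp_gcdl a b).
have [[c2 K] /= c20 e2] := Pdiv.Idomain.dvdpP _ _ (Pdiv.Idomain.dvdp_gcdr a b).
have [[u v] /= /Pdiv.Idomain.eqpP[[d1 d2] /= /andP[d10 d20] e]] := Pdiv.Idomain.Bezoutp a b.
exists (gcdp a b), H, K, (d1 *: u), (d1 *: v), c1, c2, d2; split; split=> //.
by rewrite -!scalerAl -scalerDr.
Qed.

Lemma specZ (x : R) (c : {poly R}) p : spec x (c *: p) = c.[x] *: spec x p.
Proof. by rewrite -(mul_polyC c p) rmorphM/= map_polyC/= mul_polyC. Qed.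

(* p is the quotient of P by gcd(P, P_y). *)
Lemma simple_roots (P : poly2) : P != 0 -> exists (p : poly2) (D : {poly R}), D != 0 /\
  forall z, D.[z.1] != 0 -> (peval2 P z = 0 <-> peval2 p z = 0) /\
    (peval2 p z = 0 -> peval2 p^`() z != 0).
Proof.
move=> P0; have [G [H [K [u [v [c1 [c2 [d [[c10 c20 d0] [e1 e2 e3]]]]]]]]]] := gcd_data P P^`().
(* The leading coefficient is included so that P does not vanish identically on the line x = x0. *)
exists H, (c1 * c2 * d * lead_coef P); split; first by rewrite !mulf_neq0// lead_coef_eq0.
move=> [x0 y0] /=; rewrite !hornerM !mulf_eq0 !negb_or => /andP[/andP[/andP[c1x c2x] dx] lx].
rewrite !peval2E/=; set a := spec x0 P.
have a0 : a != 0.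
  by apply/eqP => /(congr1 (fun p : {poly R} => p`_(size P).-1)); rewrite coef_map/= coef0 => /eqP; apply/negP.
set h := spec x0 H; set g := spec x0 G; set k := spec x0 K.
have E1 : c1.[x0] *: a = h * g by rewrite -specZ e1 rmorphM.
have E2 : c2.[x0] *: a^`() = k * g by rewrite /a deriv_map -specZ e2 rmorphM.
have E3 : spec x0 u * a + spec x0 v * a^`() = d.[x0] *: g.
  by rewrite /a deriv_map -!rmorphM -rmorphD e3; exact: specZ.
rewrite -deriv_map -/h.
have ha : h.[y0] = 0 -> a.[y0] = 0.
  move=> hy; have := congr1 (horner^~ y0) E1; rewrite /= hornerZ hornerM hy mul0r => /eqP.
  by rewrite mulf_eq0 (negbTE c1x) => /eqP.
suff main : a.[y0] = 0 -> h.[y0] = 0 /\ h^`().[y0] != 0.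
  by split; [split=> [/main[]|/ha]|move=> /ha/main[]].
(* With n + 1 the multiplicity of y0 in a, both a and a' are multiples of X^n, and Bezout's identity
   makes g one too. As a' has no further factor X, the cofactor g1 of g is nonzero at y0, and the
   remaining simple factor of a goes to h. *)
move=> ay; have [m [b]] := multiplicity_XsubC a y0; rewrite a0/= => by0 eb.
case: m eb => [|n] eb; first by move: by0; rewrite eb expr0 mulr1 in ay; rewrite /root ay eqxx.
set X := 'X - y0%:P in eb.
have X0 : X != 0 by rewrite polyXsubC_eq0.
have Xn0 : X ^+ n != 0 by rewrite expf_neq0.
have Xy : X.[y0] = 0 by rewrite hornerXsubC subrr.
pose b1 := b^`() * X + b *+ n.+1.
have ea' : a^`() = b1 * X ^+ n.
  by rewrite eb derivM deriv_exp derivXsubC mul1r /b1 exprS /=; rewrite -mulr_natr -[b *+ _]mulr_natr; ring.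
pose g1 := (d.[x0])^-1 *: (spec x0 u * b * X + spec x0 v * b1).
have eg : g = g1 * X ^+ n.
  apply: (scalerI dx); rewrite -E3 /g1 -scalerAl scalerA mulfV// scale1r ea' eb exprS.
  by ring.
have eb1 : c2.[x0] *: b1 = k * g1.
  by apply: (mulIf Xn0); rewrite -scalerAl -ea' E2 eg mulrA.
have ebh : c1.[x0] *: (b * X) = h * g1.
  by apply: (mulIf Xn0); rewrite -scalerAl -mulrA -exprS -eb E1 eg mulrA.
have g1y : g1.[y0] != 0.
  apply/eqP => g1y; have := congr1 (horner^~ y0) eb1.
  rewrite /= hornerZ hornerM g1y mulr0 /b1 hornerD hornerM Xy mulr0 add0r hornerMn => /eqP.
  by rewrite mulf_eq0 (negbTE c2x)/= mulrn_eq0/=; apply/negP.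
have hy : h.[y0] = 0.
  have := congr1 (horner^~ y0) ebh; rewrite /= hornerZ !hornerM Xy !mulr0 => /esym/eqP.
  by rewrite mulf_eq0 (negbTE g1y) orbF => /eqP.
split=> //; apply/eqP => h'y.
(* Differentiating [ebh] at y0 leaves a nonzero multiple of b(y0) on the left, and only multiples of
   h(y0) and h'(y0) on the right. *)
have := congr1 (fun p : {poly R} => p^`().[y0]) ebh.
rewrite /= derivZ !derivM derivXsubC mulr1 hornerZ !hornerD !hornerM Xy hy h'y mulr0 add0r mul0r mul0r addr0.
by move=> /eqP; rewrite mulf_eq0 (negbTE c1x)/=; apply/negP.
Qed.

(* With G := gcd(p, q) and p = H G up to a scalar, a simple zero of p at which q
   vanishes is a zero of G, hence not of H, so q is locally a multiple of p. *)
Lemma vanish_along p q : exists2 D : {poly R}, D != 0 &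
  forall z, D.[z.1] != 0 -> peval2 p z = 0 -> peval2 p^`() z != 0 -> peval2 q z = 0 ->
  exists2 C : R, 0 <= C & bnear z (fun w => `|peval2 q w| <= C * `|peval2 p w|).
Proof.
have [G [H [K [u [v [c1 [c2 [d [[c10 c20 d0] [e1 e2 e3]]]]]]]]]] := gcd_data p q.
exists (c1 * c2 * d); first by rewrite !mulf_neq0.
move=> z; rewrite !hornerM !mulf_eq0 !negb_or => /andP[/andP[c1x c2x] dx] pz pyz qz.
have Gz : peval2 G z = 0.
  have := congr1 (fun p : poly2 => peval2 p z) e3.
  rewrite /= peval2D !peval2M peval2Z pz qz !mulr0 addr0 => /esym/eqP.
  by rewrite mulf_eq0 (negbTE dx) => /eqP.
have Hz : peval2 H z != 0.
  apply/eqP => Hz; have := congr1 (fun p : poly2 => peval2 p^`() z) e1.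
  rewrite /= derivZ derivM peval2Z peval2D !peval2M Hz Gz mulr0 mul0r addr0 => /eqP.
  by rewrite mulf_eq0 (negbTE c1x) (negbTE pyz).
(* Cross-multiplication eliminates G: E q = F p with E nonzero at z, so |q| is at most |F| / |E|
   times |p| nearby. *)
pose E : poly2 := c2 *: H; pose F : poly2 := c1 *: K.
have EF w : peval2 E w * peval2 q w = peval2 F w * peval2 p w.
  have h1 := congr1 (fun p : poly2 => peval2 p w) e1; have h2 := congr1 (fun p : poly2 => peval2 p w) e2.
  rewrite /= !peval2Z !peval2M in h1 h2; rewrite /E /F !peval2Z.
  transitivity (peval2 H w * (c2.[w.1] * peval2 q w)); first by ring.
  rewrite h2; transitivity (peval2 K w * (peval2 H w * peval2 G w)); first by ring.
  by rewrite -h1; ring.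
have Ez : peval2 E z != 0 by rewrite peval2Z mulf_neq0.
set m := `|peval2 E z| / 2; have m0 : 0 < m by rewrite divr_gt0// normr_gt0.
have nE : bnear z (fun w => m <= `|peval2 E w|).
  have : bnear z (fun w => 0 < peval2 (E ^+ 2 - ((m ^+ 2)%:P)%:P) w).
    apply: bnear_gt0; rewrite peval2B peval2X peval2C hornerC.
    have -> : peval2 E z ^+ 2 = (2 * m) ^+ 2 by rewrite /m mulrCA mulfV// mulr1 real_normK ?num_real.
    have : 0 < m ^+ 2 by rewrite exprn_gt0.
    lra.
  apply: bnear_imp => w; rewrite peval2B peval2X peval2C hornerC subr_gt0 => h.
  rewrite -ler_sqr ?nnegrE ?(ltW m0)// real_normK ?num_real//; exact: ltW.
set B := `|peval2 F z| + 1; have B0 : 0 <= B by rewrite addr_ge0.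
have [r r0 HF] := peval2_bounded F z.
have nF : bnear z (fun w => `|peval2 F w| <= B) by exists r.
exists (B / m); first by rewrite divr_ge0// ltW.
apply: bnear_imp (bnearI nE nF) => w [hE hF].
rewrite mulrAC ler_pdivlMr// mulrC.
apply: (@le_trans _ _ (`|peval2 E w| * `|peval2 q w|)); first by rewrite ler_wpM2r.
by rewrite -normrM EF normrM ler_wpM2r.
Qed.

(** Each division by x - x0 lowers the degree of the leading coefficient in R[x], so the process
    stops. The zero set is then the line x = x0, if k > 0, together with the zeros of [f1], of which
    finitely many lie on that line. *)
Lemma factor_fiber (f : poly2) (x0 : R) : f != 0 ->
  exists (k : nat) (f1 : poly2), f = (('X - x0%:P) ^+ k)%:P * f1 /\ spec x0 f1 != 0.
Proof.
move=> f0; have [n] := ubnP (size (lead_coef f)); elim: n f f0 => // n IH f f0 fn.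
have [s0|s0] := eqVneq (spec x0 f) 0; last by exists 0%N, f; rewrite expr0 mul1r.
pose X := 'X - x0%:P.
have dv i : X %| f`_i.
  have := congr1 (fun p : {poly R} => p`_i) s0; rewrite coef_map/= coef0 => h.
  by rewrite dvdp_XsubCl; apply/eqP.
pose g : poly2 := \poly_(i < size f) (f`_i %/ X).
have eg : f = X%:P * g.
  apply/polyP => i; rewrite coefCM coef_poly; case: ltnP => si.
    by rewrite mulrC divpK.
  by rewrite mulr0 nth_default.
have g0 : g != 0 by apply/eqP => g0; move: f0; rewrite eg g0 mulr0 eqxx.
have [|k [f1 [e1 e2]]] := IH g g0.
  have lg : lead_coef f = lead_coef g * X by rewrite eg lead_coefM lead_coefC mulrC.
  have l0 : lead_coef g != 0 by rewrite lead_coef_eq0.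
  by move: fn; rewrite lg size_Mmonic ?monicXsubC// size_XsubC addn2 /= ltnS.
by exists k.+1, f1; rewrite eg {1}e1 exprS polyCM mulrA.
Qed.

End GenericFibers.

(** * Dyadic cells *)

Section Dyadic.
Variable R : realType.
Notation pt := (R * R)%type.
Implicit Types (x y : R) (z w : pt) (D : set pt) (n m : nat) (k : int).

(* The cell of x in the partition of the line by the points k / 2^n. *)
Definition dcell n x : set R := [set y | forall k,
  (k%:~R <= x * 2 ^+ n) = (k%:~R <= y * 2 ^+ n) /\ (x * 2 ^+ n <= k%:~R) = (y * 2 ^+ n <= k%:~R)].

Lemma dcell_refl n x : dcell n x x. Proof. by []. Qed.

Lemma dcell_eq n x y : dcell n x y -> dcell n x = dcell n y.
Proof.
move=> H; apply/seteqP; split=> z Hz k; have [h1 h2] := H k; have [g1 g2] := Hz k.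
- by rewrite -h1 -h2.
- by rewrite h1 h2.
Qed.

Lemma dcell_sub n m x : (m <= n)%N -> dcell n x `<=` dcell m x.
Proof.
move=> mn y H k; have [] := H (k * 2 ^+ (n - m)).
have p0 : (0 : R) < 2 ^+ (n - m) by rewrite exprn_gt0.
have e u : u * 2 ^+ n = u * 2 ^+ m * 2 ^+ (n - m) :> R by rewrite -mulrA -exprD subnKC.
by rewrite rmorphM rmorphXn/= !e !ler_pM2r.
Qed.

(** Codes for the two shapes of cells, a dyadic point or an open dyadic interval; they serve both
    for countability and for the topology of the cells. *)
Definition dcode (n : nat) (k : int) (b : bool) : set R :=
  if b then [set k%:~R / 2 ^+ n] else `]k%:~R / 2 ^+ n, (k + 1)%:~R / 2 ^+ n[%classic.

Lemma dcell_code n x : exists k b, dcell n x = dcode n k b.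
Proof.
have p0 : (0 : R) < 2 ^+ n by rewrite exprn_gt0.
pose k := Num.floor (x * 2 ^+ n).
have kx : k%:~R <= x * 2 ^+ n by rewrite ge_floor.
have xk : x * 2 ^+ n < (k + 1)%:~R by rewrite floorD1_gt.
have [e|ne] := eqVneq (x * 2 ^+ n) k%:~R.
- exists k, true; apply/seteqP; split=> y.
  + move=> /(_ k); rewrite e lexx => -[h1 h2].
    have : y * 2 ^+ n = k%:~R by apply/le_anti; rewrite -h1 -h2.
    by rewrite /dcode/= => <-; rewrite mulfK// gt_eqF.
  + by rewrite /dcode/= => -> j; rewrite divfK ?gt_eqF// e.
- have kx' : k%:~R < x * 2 ^+ n by rewrite lt_neqAle eq_sym ne.
  exists k, false; apply/seteqP; split=> y; rewrite /dcode/= in_itv/= ltr_pdivrMr// ltr_pdivlMr//.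
  + move=> H; have [_ h1] := H k; have [h2 _] := H (k + 1).
    by rewrite !ltNge -h1 -h2 -!ltNge kx' xk.
  + move=> /andP[ky yk] j.
    have [jk|kj] := leP j k.
      have jR : (j%:~R : R) <= k%:~R by rewrite ler_int.
      rewrite !(le_trans jR) ?(ltW ky)//; split=> //.
      by rewrite !leNgt (le_lt_trans jR kx') (le_lt_trans jR ky).
    have jR : ((k + 1)%:~R : R) <= j%:~R by rewrite ler_int lezD1.
    rewrite !leNgt (lt_le_trans xk jR) (lt_le_trans yk jR)/=; split=> //.
    by rewrite !ltNge (ltW (lt_le_trans xk jR)) (ltW (lt_le_trans yk jR)).
Qed.

Lemma dcell_small n x y : dcell n x y -> `|y - x| < (2 ^+ n)^-1.
Proof.
move=> xy; have := dcell_refl n x; move: xy; have [k [b ->]] := dcell_code n x.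
have p0 : (0 : R) < (2 ^+ n)^-1 by rewrite invr_gt0 exprn_gt0.
case: b => /=; first by move=> -> ->; rewrite subrr normr0.
rewrite !in_itv/= intrD mulrDl mul1r => /andP[h1 h2] /andP[h3 h4].
by rewrite ltr_norml; apply/andP; split; lra.
Qed.

Definition dsq n z : set pt := [set w | dcell n z.1 w.1 /\ dcell n z.2 w.2].

Lemma dsq_refl n z : dsq n z z. Proof. by []. Qed.

Lemma dsq_eq n z w : dsq n z w -> dsq n z = dsq n w.
Proof. by move=> [h1 h2]; rewrite /dsq (dcell_eq h1) (dcell_eq h2). Qed.

Lemma dsq_sub n m z : (m <= n)%N -> dsq n z `<=` dsq m z.
Proof. by move=> mn w [h1 h2]; split; apply: dcell_sub mn _ _. Qed.

Lemma dsq_box z (r : R) : 0 < r -> exists n, forall w, dsq n z w -> `|w.1 - z.1| < r /\ `|w.2 - z.2| < r.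
Proof.
move=> r0; have [n Hn] : exists n, (2 ^+ n)^-1 < r.
  exists (Num.truncn r^-1).+1; rewrite invf_plt ?posrE ?exprn_gt0//.
  apply: lt_le_trans (truncnS_gt _) _.
  by rewrite -natrX ler_nat ltnW// ltn_expl.
by exists n => w [/dcell_small h1 /dcell_small h2]; split; [apply: lt_trans h1 Hn|apply: lt_trans h2 Hn].
Qed.

Lemma countable_dsq : countable [set D | exists n z, D = dsq n z].
Proof.
pose F (c : nat * (int * bool) * (int * bool)) : set pt :=
  [set w | dcode c.1.1 c.1.2.1 c.1.2.2 w.1 /\ dcode c.1.1 c.2.1 c.2.2 w.2].
apply: (@sub_countable _ _ _ (range F)); last first.
  by apply: (sub_countable (card_image_le F setT)); exact: countableP.
apply/subset_card_le => _ [n [z ->]].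
have [k1 [b1 e1]] := dcell_code n z.1; have [k2 [b2 e2]] := dcell_code n z.2.
by exists (n, (k1, b1), (k2, b2)) => //; rewrite /dsq e1 e2.
Qed.

Variable good : set pt -> Prop.

(** Dyadic squares are nested or disjoint, so two coarsest good squares that meet have the same
    level and are equal. *)
Definition maximal_good : set (set pt) := [set D | exists n z,
  [/\ D = dsq n z, good D & forall m, (m < n)%N -> ~ good (dsq m z)]].

Lemma maximal_good_disjoint D D' : maximal_good D -> maximal_good D' ->
  D `&` D' !=set0 -> D = D'.
Proof.
move=> [n [z [-> g1 m1]]] [n' [z' [-> g2 m2]]] [w [h1 h2]].
rewrite (dsq_eq h1) (dsq_eq h2) in g1 g2 *.
have [nn|nn|->//] := ltngtP n n'.
- by case: (m2 n nn); rewrite (dsq_eq (dsq_sub (ltnW nn) h2)).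
- by case: (m1 n' nn); rewrite (dsq_eq (dsq_sub (ltnW nn) h1)).
Qed.

Lemma maximal_good_cover n z : good (dsq n z) -> exists2 D, maximal_good D & D z.
Proof.
move=> gn; have ex : exists n, `[< good (dsq n z) >] by exists n; apply/asboolP.
exists (dsq (ex_minn ex) z) => //; case: ex_minnP => m /asboolP gm mm.
exists m, z; split=> // j jm gj; have := mm j; rewrite leqNgt jm => /(_ _).
by move=> h; have := h (asboolT gj).
Qed.

Lemma maximal_good_good D : maximal_good D -> good D.
Proof. by move=> [n [z []]]. Qed.

Lemma maximal_good_dsq D : maximal_good D -> exists n z, D = dsq n z.
Proof. by move=> [n [z [-> _ _]]]; exists n, z. Qed.

Lemma countable_maximal_good : countable maximal_good.
Proof.
apply: sub_countable countable_dsq; apply/subset_card_le => D.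
exact: maximal_good_dsq.
Qed.

End Dyadic.

(** * Points, intervals and rectangles as semi-algebraic cells *)

Section ProductCells.
Variable R : realType.
Notation pt := (R * R)%type.
Notation poly2 := {poly {poly R}}.
Implicit Types (x y : R) (z w : pt) (e A B : set R).

Definition cell1 A : Prop := (exists a, A = [set a]) \/ exists a b : R, a < b /\ A = `]a, b[%classic.

Lemma dcell_cell1 n x : cell1 (dcell n x).
Proof.
have [k [[] ->]] := dcell_code n x; first by left; exists (k%:~R / 2 ^+ n).
right; exists (k%:~R / 2 ^+ n), ((k + 1)%:~R / 2 ^+ n); split=> //.
by rewrite ltr_pM2r ?invr_gt0 ?exprn_gt0// ltr_int ltzD1.
Qed.

Lemma cell1_poly A : cell1 A -> exists f g : {poly R}, forall x, A x <-> f.[x] = 0 /\ 0 < g.[x].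
Proof.
case=> [[a ->]|[a [b [ab ->]]]].
- exists ('X - a%:P), 1 => x /=; rewrite hornerXsubC hornerC ltr01; split=> [->|[/eqP]].
    by rewrite subrr.
  by rewrite subr_eq0 => /eqP.
- exists 0, (('X - a%:P) * (b%:P - 'X)) => x; rewrite /= in_itv/= horner0 hornerM hornerXsubC.
  rewrite hornerD hornerN hornerX hornerC; split=> [/andP[ax xb]|[_]].
    by split=> //; rewrite mulr_gt0// subr_gt0.
  by move=> h; apply/andP; split; nra.
Qed.

Lemma peval2_polyC_y (f : {poly R}) w : peval2 (f ^:P) w = f.[w.2].
Proof.
elim/poly_ind: f => [|f c IH]; first by rewrite rmorph0 peval2_0 horner0.
by rewrite rmorphD rmorphM/= map_polyX map_polyC/= peval2MXaddC IH hornerMXaddC hornerC.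
Qed.

Definition prod_cell A B : set pt := [set w | A w.1 /\ B w.2].

Lemma semialgebraic_prod A B (q : poly2) : cell1 A -> cell1 B ->
  semialgebraic (prod_cell A B `&` [set w | peval2 q w = 0]).
Proof.
move=> /cell1_poly[f1 [g1 H1]] /cell1_poly[f2 [g2 H2]].
(* The conditions on x, those on y, and q = 0 paired with 1 > 0; the zero polynomial q gives the
   full product. *)
exists 1%N, 3%N, (fun _ j => nth 0 [:: f1%:P; f2 ^:P; q] j), (fun _ j => nth 0 [:: g1%:P; g2 ^:P; 1] j).
apply/seteqP; split=> w.
- move=> [[/H1[a1 b1] /H2[a2 b2]] qw]; exists ord0 => -[[|[|[|//]]] ?] /=.
  + by rewrite !peval2C.
  + by rewrite !peval2_polyC_y.
  + by rewrite peval2_1 ltr01.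
- move=> [_ H].
  have := H (Ordinal (isT : (0 < 3)%N)); have := H (Ordinal (isT : (1 < 3)%N)).
  have := H (Ordinal (isT : (2 < 3)%N)) => /=; rewrite !peval2C !peval2_polyC_y => -[h _] h2 h1.
  by split=> //; split; [exact/H1|exact/H2].
Qed.

Lemma cell1_cvx A x y t : cell1 A -> A x -> A y -> 0 <= t <= 1 -> A (x + t * (y - x)).
Proof.
case=> [[a ->]|[a [b [ab ->]]]] /=; first by move=> -> -> _; rewrite subrr mulr0 addr0.
rewrite !in_itv/= => /andP[a1 a2] /andP[b1 b2] t01.
have h1 : 0 < x - a by lra.
have h2 : 0 < y - a by lra.
have h3 : 0 < b - x by lra.
have h4 : 0 < b - y by lra.
have := convex_comb_gt0 h1 h2 t01; have := convex_comb_gt0 h3 h4 t01 => ? ?.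
by apply/andP; split; lra.
Qed.

Lemma prod_cell_cvx A B : cell1 A -> cell1 B -> cvx (prod_cell A B).
Proof.
by move=> cA cB P Q [p1 p2] [q1 q2] _ [t t01 ->]; split; apply: cell1_cvx.
Qed.

Lemma cell1_bounded A : cell1 A -> exists b : R, forall x, A x -> `|x| <= b.
Proof.
case=> [[a ->]|[a [b [ab ->]]]]; first by exists `|a| => x ->.
exists (`|a| + `|b|) => x; rewrite /= in_itv/= => /andP[ax xb].
have := ler_norm a; have := ler_norm b; have := ler_norm (- a); have := ler_norm (- b).
rewrite !normrN => ? ? ? ?; have := normr_ge0 a; have := normr_ge0 b => ? ?.
by rewrite ler_norml; apply/andP; split; lra.
Qed.

Lemma prod_cell_bounded A B : cell1 A -> cell1 B ->
  exists b : R, forall z, prod_cell A B z -> `|z.1| <= b /\ `|z.2| <= b.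
Proof.
move=> /cell1_bounded[b1 H1] /cell1_bounded[b2 H2]; exists (Num.max b1 b2) => z [/H1 h1 /H2 h2].
by rewrite !le_max h1 h2 orbT.
Qed.

Lemma within_pair (T : topologicalType) (D : set T) (f g : T -> R) :
  (forall t, D t -> {for t, continuous f}) -> (forall t, D t -> {for t, continuous g}) ->
  {within D, continuous (fun t => (f t, g t))}.
Proof.
move=> cf cg; apply: continuous_in_subspaceT => t /set_mem Dt.
by apply: (@cvg_pair _ _ _ (nbhs t) (nbhs (f t)) (nbhs (g t))); [exact: cf|exact: cg].
Qed.

Lemma is_1cell_horizontal (a b c : R) : a < b -> is_1cell (prod_cell `]a, b[%classic [set c]).
Proof.
move=> ab; have ba0 : 0 < b - a by rewrite subr_gt0.
have n0 : b - a != 0 by rewrite gt_eqF.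
exists (fun t => (a + (b - a) * t, c)), (fun z => (z.1 - a) / (b - a)); split.
- move=> t; rewrite /prod_cell/= !in_itv/= => /andP[t0 t1]; split=> //.
  by rewrite ltrDl mulr_gt0//= -ltrBrDl gtr_pMr.
- move=> z; rewrite /prod_cell/= !in_itv/= => -[/andP[az zb] _].
  by rewrite divr_gt0 ?subr_gt0//= ltr_pdivrMr// mul1r ltrD2r.
- by move=> t _; rewrite /= addrAC subrr add0r mulrC mulKf.
- move=> z [_ zc] /=; rewrite mulrC divfK// addrC subrK.
  by rewrite [RHS]surjective_pairing zc.
split.
- apply: within_pair => t _; last exact: cst_continuous.
  by apply: cvgD; [exact: cvg_cst|apply: cvgM; [exact: cvg_cst|exact: cvg_id]].
- apply: continuous_subspaceT => z; apply: cvgM; last exact: cvg_cst.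
  by apply: cvgB; [exact: cvg_fst|exact: cvg_cst].
Qed.

Lemma is_1cell_vertical (a b c : R) : a < b -> is_1cell (prod_cell [set c] `]a, b[%classic).
Proof.
move=> ab; have ba0 : 0 < b - a by rewrite subr_gt0.
have n0 : b - a != 0 by rewrite gt_eqF.
exists (fun t => (c, a + (b - a) * t)), (fun z => (z.2 - a) / (b - a)); split.
- move=> t; rewrite /prod_cell/= !in_itv/= => /andP[t0 t1]; split=> //.
  by rewrite ltrDl mulr_gt0//= -ltrBrDl gtr_pMr.
- move=> z; rewrite /prod_cell/= !in_itv/= => -[_ /andP[az zb]].
  by rewrite divr_gt0 ?subr_gt0//= ltr_pdivrMr// mul1r ltrD2r.
- by move=> t _; rewrite /= addrAC subrr add0r mulrC mulKf.
- move=> z [zc _] /=; rewrite [(_ - _) * _]mulrC divfK// addrC subrK.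
  by rewrite [RHS]surjective_pairing zc.
split.
- apply: within_pair => t _; first exact: cst_continuous.
  by apply: cvgD; [exact: cvg_cst|apply: cvgM; [exact: cvg_cst|exact: cvg_id]].
- apply: continuous_subspaceT => z; apply: cvgM; last exact: cvg_cst.
  by apply: cvgB; [exact: cvg_snd|exact: cvg_cst].
Qed.

(** The slice of the disk at height v has half-width [rt v]; dividing by it turns the disk into the
    square ]-1, 1[ x ]-1, 1[, which is then mapped affinely. *)
Lemma is_2cell_rectangle (a b c d : R) : a < b -> c < d ->
  is_2cell (prod_cell `]a, b[%classic `]c, d[%classic).
Proof.
move=> ab cd.
have ba0 : 0 < b - a by rewrite subr_gt0.
have dc0 : 0 < d - c by rewrite subr_gt0.
have n0 : b - a != 0 by rewrite gt_eqF.
have n1 : d - c != 0 by rewrite gt_eqF.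
pose rt (v : R) : R := Num.sqrt (1 - v ^+ 2).
have rt_cont : continuous rt.
  move=> v; rewrite /rt; apply: (@continuous_comp _ _ _ (fun v : R => 1 - v ^+ 2) (@Num.sqrt R)); last exact: sqrt_continuous.
  by apply: cvgB; [exact: cvg_cst|exact: exprn_continuous].
have rt_pos (v : R) : -1 < v -> v < 1 -> 0 < rt v.
  move=> v0 v1; rewrite sqrtr_gt0.
  have : 0 < (1 - v) * (1 + v) by rewrite mulr_gt0//; lra.
  by rewrite (_ : (1 - v) * (1 + v) = 1 - v ^+ 2)//; ring.
have rt_sq (v : R) : -1 < v -> v < 1 -> rt v ^+ 2 = 1 - v ^+ 2.
  by move=> v0 v1; rewrite sqr_sqrtr// ltW// -sqrtr_gt0 rt_pos.
have disk_v (u v : R) : u ^+ 2 + v ^+ 2 < 1 -> -1 < v /\ v < 1.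
  by move=> h; have := sqr_ge0 u; split; nra.
pose phi (w : pt) : pt := (a + (b - a) * (1 + w.1 / rt w.2) / 2, c + (d - c) * (1 + w.2) / 2).
pose nv (z : pt) : R := 2 * (z.2 - c) / (d - c) - 1.
pose psi (z : pt) : pt := ((2 * (z.1 - a) / (b - a) - 1) * rt (nv z), nv z).
have nvb (z : pt) : c < z.2 -> z.2 < d -> -1 < nv z /\ nv z < 1.
  move=> h1 h2; rewrite /nv.
  have : 0 < 2 * (z.2 - c) / (d - c) by rewrite divr_gt0// mulr_gt0// subr_gt0.
  have : 2 * (z.2 - c) / (d - c) < 2 by rewrite ltr_pdivrMr//; lra.
  by split; lra.
exists phi, psi; split.
- move=> w; rewrite /open_unit_disk/= => hw; have [v0 v1] := disk_v _ _ hw.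
  have r0 := rt_pos _ v0 v1; have r2 := rt_sq _ v0 v1.
  have q : -1 < w.1 / rt w.2 < 1.
    rewrite ltr_pdivlMr// ltr_pdivrMr// mulN1r mul1r -ltr_norml -ltr_sqr ?nnegrE ?(ltW r0)//.
    by rewrite real_normK ?num_real// r2; lra.
  move: q => /andP[q1 q2]; rewrite /prod_cell/= !in_itv/=.
  have m1 : 0 < (b - a) * (1 + w.1 / rt w.2) by rewrite mulr_gt0//; lra.
  have m2 : 0 < (b - a) * (1 - w.1 / rt w.2) by rewrite mulr_gt0//; lra.
  have m3 : 0 < (d - c) * (1 + w.2) by rewrite mulr_gt0//; lra.
  have m4 : 0 < (d - c) * (1 - w.2) by rewrite mulr_gt0//; lra.
  by split; apply/andP; split; lra.
- move=> z; rewrite /prod_cell/= !in_itv/= => -[/andP[x1 x2] /andP[y1 y2]].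
  have [v0 v1] := nvb _ y1 y2; rewrite /open_unit_disk/psi/= exprMn rt_sq//.
  pose s := 2 * (z.1 - a) / (b - a) - 1; rewrite -/s.
  have s1 : s ^+ 2 < 1.
    have h1 : 0 < 2 * (z.1 - a) / (b - a) by rewrite divr_gt0// mulr_gt0// subr_gt0.
    have h2 : 2 * (z.1 - a) / (b - a) < 2 by rewrite ltr_pdivrMr//; lra.
    rewrite /s; nra.
  have : 0 < (1 - s ^+ 2) * (1 - nv z ^+ 2).
    by rewrite mulr_gt0//; [lra|rewrite -rt_sq// exprn_gt0// rt_pos].
  lra.
- move=> w; rewrite /open_unit_disk/= => hw; have [v0 v1] := disk_v _ _ hw.
  have r0 := rt_pos _ v0 v1; have rn : rt w.2 != 0 by rewrite gt_eqF.
  have e : nv (phi w) = w.2 by rewrite /nv /phi/=; field.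
  rewrite /psi e [RHS]surjective_pairing; congr (_, _); rewrite /phi/=.
  by field; rewrite n0 rn.
- move=> z; rewrite /prod_cell/= !in_itv/= => -[/andP[x1 x2] /andP[y1 y2]].
  have [v0 v1] := nvb _ y1 y2; have r0 := rt_pos _ v0 v1; have rn : rt (nv z) != 0 by rewrite gt_eqF.
  rewrite /phi /psi/= mulfK// [RHS]surjective_pairing; congr (_, _); first by field.
  by rewrite /nv; field.
have cnv : continuous nv.
  move=> z; apply: cvgB; last exact: cvg_cst.
  apply: cvgM; last exact: cvg_cst.
  by apply: cvgM; [exact: cvg_cst|apply: cvgB; [exact: cvg_snd|exact: cvg_cst]].
split.
- apply: within_pair => w hw.
    have [v0 v1] := disk_v _ _ hw; have r0 := rt_pos _ v0 v1.
    apply: cvgD; first exact: cvg_cst.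
    apply: cvgM; last exact: cvg_cst.
    apply: cvgM; first exact: cvg_cst.
    apply: cvgD; first exact: cvg_cst.
    apply: cvgM; first exact: cvg_fst.
    apply: cvgV; first by rewrite gt_eqF.
    by apply: (@continuous_comp _ _ _ (snd : pt -> R) rt); [exact: cvg_snd|exact: rt_cont].
  apply: cvgD; first exact: cvg_cst.
  apply: cvgM; last exact: cvg_cst.
  apply: cvgM; first exact: cvg_cst.
  by apply: cvgD; [exact: cvg_cst|exact: cvg_snd].
- apply: within_pair => z _; last exact: cnv.
  apply: cvgM.
    apply: cvgB; last exact: cvg_cst.
    apply: cvgM; last exact: cvg_cst.
    by apply: cvgM; [exact: cvg_cst|apply: cvgB; [exact: cvg_fst|exact: cvg_cst]].
  by apply: (@continuous_comp _ _ _ nv rt); [exact: cnv|exact: rt_cont].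
Qed.

Lemma prod_cell_cell A B : cell1 A -> cell1 B ->
  is_0cell (prod_cell A B) \/ is_1cell (prod_cell A B) \/ is_2cell (prod_cell A B).
Proof.
case=> [[a ->]|[a [b [ab ->]]]] [[c ->]|[c [d [cd ->]]]].
- left; exists (a, c); apply/seteqP; split=> [w [w1 w2]|w ->] //=.
  by rewrite [w]surjective_pairing w1 w2.
- by right; left; exact: is_1cell_vertical.
- by right; left; exact: is_1cell_horizontal.
- by right; right; exact: is_2cell_rectangle.
Qed.

End ProductCells.

(** * Strictly monotone arcs as graphs *)

Section MonotoneArcs.
Variable R : realType.
Notation pt := (R * R)%type.
Notation poly2 := {poly {poly R}}.
Implicit Types (x y : R) (z w : pt) (F : set pt).
Variables (p : poly2) (z0 : pt) (r sx sy a b c d : R).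
Hypothesis Hx : forall w, box z0 r w -> 0 < sx * peval2 (dx p) w.
Hypothesis Hy : forall w, box z0 r w -> 0 < sy * peval2 p^`() w.
Let D : set pt := prod_cell `]a, b[%classic `]c, d[%classic.
Hypothesis DU : D `<=` box z0 r.

Lemma arcD x y : D (x, y) <-> (a < x /\ x < b) /\ (c < y /\ y < d).
Proof.
rewrite /D /prod_cell/= !in_itv/=; split=> [[/andP[? ?] /andP[? ?]]//|[[? ?] [? ?]]].
by split; apply/andP.
Qed.

Lemma arc_lt_y x y1 y2 : D (x, y1) -> D (x, y2) -> y1 < y2 ->
  sy * peval2 p (x, y1) < sy * peval2 p (x, y2).
Proof. by move=> /DU D1 /DU D2 y12; exact: (box_monotone_y (w := (x, y1)) Hy). Qed.

Lemma arc_lt_x x1 x2 y : D (x1, y) -> D (x2, y) -> x1 < x2 ->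
  sx * peval2 p (x1, y) < sx * peval2 p (x2, y).
Proof. by move=> /DU D1 /DU D2 x12; exact: (box_monotone_x (w := (x1, y)) Hx). Qed.

Lemma arc_uniq x y1 y2 : D (x, y1) -> D (x, y2) -> peval2 p (x, y1) = 0 -> peval2 p (x, y2) = 0 ->
  y1 = y2.
Proof.
move=> D1 D2 p1 p2; have [y12|y12|//] := ltgtP y1 y2.
- by have := arc_lt_y D1 D2 y12; rewrite p1 p2 ltxx.
- by have := arc_lt_y D2 D1 y12; rewrite p1 p2 ltxx.
Qed.

Lemma vertical_root x y1 y2 : y1 <= y2 -> peval2 p (x, y1) * peval2 p (x, y2) < 0 ->
  exists2 y, y1 < y < y2 & peval2 p (x, y) = 0.
Proof.
move=> y12; rewrite !peval2E/= => h.
by have [y yi /eqP ry] := polyrcf.poly_ivtoo y12 h; exists y => //; rewrite in_itv in yi.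
Qed.

Definition arc_dom : set R := [set x | exists2 y, D (x, y) & peval2 p (x, y) = 0].

(** The arc as a graph over the x-axis, with default value 0 outside [arc_dom]. *)
Definition arc_fun x : R := xget 0 [set y | D (x, y) /\ peval2 p (x, y) = 0].

Lemma arc_funP x : arc_dom x -> D (x, arc_fun x) /\ peval2 p (x, arc_fun x) = 0.
Proof. by move=> [y Dy py]; rewrite /arc_fun; case: xgetP => [_ -> //|/(_ y) []]. Qed.

Lemma arc_funE z : D z -> peval2 p z = 0 -> arc_fun z.1 = z.2.
Proof.
case: z => x y /= Dz pz; have [D' p'] : D (x, arc_fun x) /\ peval2 p (x, arc_fun x) = 0.
  by apply: arc_funP; exists y.
exact: arc_uniq D' Dz p' pz.
Qed.

(** Moving horizontally to abscissa x, rightwards from the first zero and leftwards from the second,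
    gives opposite signs of p at heights y1 and y2; so p has a zero between these heights, still
    inside the rectangle. *)
Lemma arc_dom_interval x1 x x2 : arc_dom x1 -> arc_dom x2 -> x1 < x -> x < x2 -> arc_dom x.
Proof.
move=> [y1 D1 p1] [y2 D2 p2] x1x xx2.
have /arcD[[a1 b1] [c1 d1]] := D1; have /arcD[[a2 b2] [c2 d2]] := D2.
have Dx y : c < y -> y < d -> D (x, y).
  by move=> cy yd; apply/arcD; split; split=> //; [exact: lt_trans x1x|exact: lt_trans b2].
have q1 := arc_lt_x D1 (Dx _ c1 d1) x1x; have q2 := arc_lt_x (Dx _ c2 d2) D2 xx2.
rewrite p1 mulr0 in q1; rewrite p2 mulr0 in q2.
have neg : peval2 p (x, y1) * peval2 p (x, y2) < 0.
  have : 0 < (sx * peval2 p (x, y1)) * (- (sx * peval2 p (x, y2))) by rewrite mulr_gt0// oppr_gt0.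
  rewrite (_ : _ * - _ = - (sx ^+ 2 * (peval2 p (x, y1) * peval2 p (x, y2)))); last by ring.
  rewrite oppr_gt0 pmulr_rlt0// lt_neqAle sqr_ge0 eq_sym sqrf_eq0 andbT.
  by apply/eqP => s0; rewrite s0 mul0r ltxx in q1.
have [y12|/ltW y21] := leP y1 y2.
- have [y /andP[h1 h2] py] := vertical_root y12 neg.
  by exists y => //; apply: Dx; [exact: lt_trans h1|exact: lt_trans d2].
- have [|y /andP[h1 h2] py] := @vertical_root x _ _ y21; first by rewrite mulrC.
  by exists y => //; apply: Dx; [exact: lt_trans h1|exact: lt_trans d1].
Qed.

(** Implicit function theorem by signs: p has opposite signs at heights y - h and y + h over x, and
    therefore over nearby x' too. [arc_dom] is thus open and [arc_fun] continuous. *)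
Lemma arc_local x (eta : R) : arc_dom x -> 0 < eta -> exists2 del, 0 < del &
  forall x', `|x' - x| < del -> arc_dom x' /\ `|arc_fun x' - arc_fun x| < eta.
Proof.
move=> domx eta0; have [] := arc_funP domx; set y := arc_fun x => Dxy pxy.
have /arcD[[ax xb] [cy yd]] := Dxy.
pose h := Num.min eta (Num.min ((y - c) / 2) ((d - y) / 2)).
have h0 : 0 < h by rewrite !lt_min eta0/=; apply/andP; split; lra.
have he : h <= eta by rewrite ge_min lexx.
have hc : h <= (y - c) / 2 by rewrite !ge_min lexx !orbT.
have hd : h <= (d - y) / 2 by rewrite !ge_min lexx !orbT.
have Dm : D (x, y - h) by apply/arcD; split; split=> //; lra.
have Dp : D (x, y + h) by apply/arcD; split; split=> //; lra.
have m1 : sy * peval2 p (x, y - h) < 0.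
  by have := arc_lt_y Dm Dxy; rewrite pxy mulr0; apply; lra.
have m2 : 0 < sy * peval2 p (x, y + h).
  by have := arc_lt_y Dxy Dp; rewrite pxy mulr0; apply; lra.
have e w : peval2 ((sy%:P)%:P * p) w = sy * peval2 p w by rewrite peval2M peval2C hornerC.
have [r1 r10 H1] : bnear (x, y - h) (fun w => peval2 ((sy%:P)%:P * p) w < 0).
  by apply: bnear_lt0; rewrite e.
have [r2 r20 H2] : bnear (x, y + h) (fun w => 0 < peval2 ((sy%:P)%:P * p) w).
  by apply: bnear_gt0; rewrite e.
pose del := Num.min (Num.min r1 r2) (Num.min (x - a) (b - x)).
exists del; first by rewrite !lt_min r10 r20 !subr_gt0 ax xb.
move=> x'; rewrite !lt_min => /andP[/andP[l1 l2] /andP[]].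
rewrite !ltr_norml => /andP[l3 _] /andP[_ l4].
have Dx' y' : c < y' -> y' < d -> D (x', y') by move=> ? ?; apply/arcD; split; split=> //; lra.
have g1 : sy * peval2 p (x', y - h) < 0.
  by rewrite -e; apply: H1; split=> //=; rewrite subrr normr0.
have g2 : 0 < sy * peval2 p (x', y + h).
  by rewrite -e; apply: H2; split=> //=; rewrite subrr normr0.
have neg : peval2 p (x', y - h) * peval2 p (x', y + h) < 0.
  have : 0 < (- (sy * peval2 p (x', y - h))) * (sy * peval2 p (x', y + h)) by rewrite mulr_gt0// oppr_gt0.
  rewrite (_ : - _ * _ = - (sy ^+ 2 * (peval2 p (x', y - h) * peval2 p (x', y + h)))); last by ring.
  rewrite oppr_gt0 pmulr_rlt0// lt_neqAle sqr_ge0 eq_sym sqrf_eq0 andbT.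
  by apply/eqP => s0; rewrite s0 mul0r ltxx in g2.
have yy : y - h <= y + h by lra.
have [y' /andP[k1 k2] py'] := vertical_root yy neg.
have Dy' : D (x', y') by apply: Dx'; lra.
have -> : arc_fun x' = y' by exact: (arc_funE (z := (x', y'))).
split; first by exists y'.
by apply/andP; split; lra.
Qed.

Lemma arc_fun_continuous x : arc_dom x -> {for x, continuous arc_fun}.
Proof.
move=> domx; apply/cvgrPdist_lt => e e0; have [del del0 H] := arc_local domx e0.
apply/nbhs_ballP; exists del => // x' xx'; rewrite distrC.
have xx2 : `|x' - x| < del by rewrite distrC; exact: xx'.
by have [] := H x' xx2.
Qed.

Lemma monotone_arc_connected F : F `<=` D `&` [set w | peval2 p w = 0] ->
  (forall P Q M, F P -> F Q -> D M -> peval2 p M = 0 -> P.1 <= M.1 -> M.1 <= Q.1 -> F M) ->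
  connected F.
Proof.
move=> FD FI; pose J : set R := [set x | F (x, arc_fun x)].
have FJ z : F z -> J z.1.
  by move=> Fz; have [Dz pz] := FD _ Fz; rewrite /J/= (arc_funE Dz pz) -surjective_pairing.
have Jdom x : J x -> arc_dom x by move=> /FD[D' p']; exists (arc_fun x).
have -> : F = (fun x => (x, arc_fun x)) @` J.
  apply/seteqP; split=> [z Fz|_ [x Jx <-]//]; exists z.1; first exact: FJ.
  by have [Dz pz] := FD _ Fz; rewrite (arc_funE Dz pz) -surjective_pairing.
apply: connected_continuous_connected.
  apply/connected_intervalP => x1 x2 J1 J2 x /andP[x1x xx2].
  move: x1x; rewrite le_eqVlt => /predU1P[<-//|x1x].
  move: xx2; rewrite le_eqVlt => /predU1P[->//|xx2].
  have [Dx px] := arc_funP (arc_dom_interval (Jdom _ J1) (Jdom _ J2) x1x xx2).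
  by apply: FI J1 J2 Dx px _ _; exact: ltW.
apply: within_pair => t Jt; first exact: cvg_id.
exact/arc_fun_continuous/Jdom.
Qed.

(** [arc_dom] is an interval, and open by [arc_local], so it is the open interval between its
    infimum and supremum; the rescaled first coordinate inverts the parametrization by the graph. *)
Lemma monotone_arc_1cell : D `&` [set w | peval2 p w = 0] !=set0 ->
  is_1cell (D `&` [set w | peval2 p w = 0]).
Proof.
move=> [z [Dz pz]]; have dz : arc_dom z.1 by exists z.2; rewrite -surjective_pairing.
have bnd x : arc_dom x -> a < x /\ x < b by move=> [y /arcD[]].
have hs : has_sup arc_dom by split; [exists z.1|exists b => x /bnd[_ /ltW]].
have hi : has_inf arc_dom by split; [exists z.1|exists a => x /bnd[/ltW]].
set u := inf arc_dom; set v := sup arc_dom.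
have domE x : arc_dom x <-> u < x /\ x < v.
  split=> [dx|[ux xv]].
    have [del del0 H] := arc_local dx ltr01.
    have q1 : u <= x - del / 2.
      apply: ge_inf; first exact: hi.2.
      have [|//] := H (x - del / 2); rewrite ltr_norml; apply/andP; split; lra.
    have q2 : x + del / 2 <= v.
      apply: ub_le_sup; first exact: hs.2.
      have [|//] := H (x + del / 2); rewrite ltr_norml; apply/andP; split; lra.
    by split; lra.
  have d1 : 0 < x - u by lra.
  have d2 : 0 < v - x by lra.
  have [x1 D1 l1] := inf_adherent d1 hi; have [x2 D2 l2] := sup_adherent d2 hs.
  rewrite -/u in l1; rewrite -/v in l2.
  by apply: (arc_dom_interval D1 D2); lra.
have /domE[uz zv] := dz.
have uv : 0 < v - u by lra.
have n0 : v - u != 0 by rewrite gt_eqF.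
pose g t := u + (v - u) * t.
have gd t : 0 < t -> t < 1 -> arc_dom (g t).
  move=> t0 t1; apply/domE; rewrite /g; split.
    by rewrite ltrDl mulr_gt0.
  have : 0 < (v - u) * (1 - t) by rewrite mulr_gt0// subr_gt0.
  lra.
exists (fun t => (g t, arc_fun (g t))), (fun z => (z.1 - u) / (v - u)); split.
- by move=> t; rewrite /= in_itv/= => /andP[t0 t1]; have [] := arc_funP (gd _ t0 t1).
- move=> w [Dw pw]; have /domE[uw wv] : arc_dom w.1 by exists w.2; rewrite -surjective_pairing.
  rewrite /= in_itv/=; apply/andP; split; first by rewrite divr_gt0// subr_gt0.
  by rewrite ltr_pdivrMr// mul1r; lra.
- by move=> t _; rewrite /= /g addrAC subrr add0r mulrC mulKf.
- move=> w [Dw pw] /=; have -> : g ((w.1 - u) / (v - u)) = w.1.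
    by rewrite /g mulrC divfK// addrC subrK.
  by rewrite (arc_funE Dw pw) -surjective_pairing.
split.
- have cg : continuous g.
    by move=> t; apply: cvgD; [exact: cvg_cst|apply: cvgM; [exact: cvg_cst|exact: cvg_id]].
  apply: within_pair => t; rewrite /= in_itv/= => /andP[t0 t1]; first exact: cg.
  apply: (@continuous_comp _ _ _ g arc_fun); first exact: cg.
  exact/arc_fun_continuous/gd.
- apply: continuous_subspaceT => w; apply: cvgM; last exact: cvg_cst.
  by apply: cvgB; [exact: cvg_fst|exact: cvg_cst].
Qed.

End MonotoneArcs.

(** * The decomposition *)

Section CellsOK.
Variable R : realType.
Notation pt := (R * R)%type.
Notation poly2 := {poly {poly R}}.
Implicit Types (X Z e : set pt) (z w : pt) (p q : poly2) (A B : set R).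

(** Zero polynomials have sign 0 everywhere and are dropped, so that the product of the others is
    nonzero. *)
Lemma semialgebraic_signs X : semialgebraic X -> exists2 Qs : seq poly2,
  (forall q, q \in Qs -> q != 0) &
  forall w w', (forall q, q \in Qs -> Num.sg (peval2 q w) = Num.sg (peval2 q w')) -> X w -> X w'.
Proof.
move=> [I [J [f [g ->]]]].
pose L := [seq f i j | i <- enum 'I_I, j <- enum 'I_J] ++ [seq g i j | i <- enum 'I_I, j <- enum 'I_J].
exists [seq q <- L | q != 0]; first by move=> q; rewrite mem_filter => /andP[].
move=> w w' H [i Hi]; exists i => j; have [fw gw] := Hi j.
have sgE q : q \in L -> Num.sg (peval2 q w) = Num.sg (peval2 q w').
  move=> qL; have [->|q0] := eqVneq q 0; first by rewrite !peval2_0.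
  by apply: H; rewrite mem_filter q0.
split.
- apply/eqP; rewrite -sgr_eq0 -sgE ?fw ?sgr0//.
  by rewrite mem_cat; apply/orP; left; apply: allpairs_f; rewrite mem_enum.
- rewrite -sgr_gt0 -sgE ?sgr_gt0//.
  by rewrite mem_cat; apply/orP; right; apply: allpairs_f; rewrite mem_enum.
Qed.

Lemma bnear_all (Qs : seq poly2) z (Pr : poly2 -> pt -> Prop) :
  (forall q, q \in Qs -> bnear z (Pr q)) -> bnear z (fun w => forall q, q \in Qs -> Pr q w).
Proof.
elim: Qs => [|q Qs IH] H; first by exists 1 => // w _ q; rewrite in_nil.
have h1 : bnear z (Pr q) by apply: H; rewrite mem_head.
have h2 : bnear z (fun w => forall q, q \in Qs -> Pr q w).
  by apply: IH => q' q'Q; apply: H; rewrite in_cons q'Q orbT.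
apply: bnear_imp (bnearI h1 h2) => w [w1 w2] q'; rewrite in_cons => /orP[/eqP ->//|].
exact: w2.
Qed.

(** Refers to no other cell, so cells can be found independently. For a 1-cell only the number of
    components is demanded, since a component with two points is a geodesic segment inside the cell
    itself. *)
Definition cellok X e : Prop :=
  [/\ e `<=` X, semialgebraic e, is_0cell e \/ is_1cell e \/ is_2cell e &
   forall gam, taut X gam -> let S := range gam `&` e in
     finite_set [set connected_component S x | x in S] /\
     (is_1cell e \/ forall x, S x -> (exists P, connected_component S x = [set P]) \/
       straight_segment (connected_component S x))].

Lemma cellok_prod X A B : cell1 A -> cell1 B -> prod_cell A B `<=` X -> cellok X (prod_cell A B).
Proof.
move=> cA cB sX; split=> //.
- rewrite -[prod_cell A B]setIT (_ : setT = [set w | peval2 (0 : poly2) w = 0]); last first.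
    by apply/seteqP; split=> w //= _; rewrite peval2_0.
  exact: semialgebraic_prod.
- exact: prod_cell_cell.
- move=> gam tg S; have [b Hb] := prod_cell_bounded cA cB.
  have [h1 h2] := taut_cvx tg sX (prod_cell_cvx cA cB) Hb.
  by split=> //; right.
Qed.

Lemma cellok_point X z : X z -> cellok X [set z].
Proof.
move=> Xz; rewrite (_ : [set z] = prod_cell [set z.1] [set z.2]).
  apply: cellok_prod; [by left; exists z.1|by left; exists z.2|].
  by move=> w [w1 w2]; rewrite [w]surjective_pairing w1 w2 -surjective_pairing.
apply/seteqP; split=> [w -> //|w [w1 w2] /=].
by rewrite [w]surjective_pairing w1 w2 -surjective_pairing.
Qed.

Lemma dsq_prod n z : dsq n z = prod_cell (dcell n z.1) (dcell n z.2).
Proof. by []. Qed.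

Lemma bnear_dsq z (Pr : pt -> Prop) : bnear z Pr -> exists n, forall w, dsq n z w -> Pr w.
Proof. by move=> [r r0 H]; have [n Hn] := dsq_box z r0; exists n => w /Hn; exact: H. Qed.

Lemma finite_roots (h : {poly R}) : h != 0 -> finite_set [set x | h.[x] = 0].
Proof.
move=> h0; apply/finite_seqP; exists (polyrcf.rootsR h).
apply/seteqP; split=> x /=.
- by move=> /eqP hx; rewrite -polyrcf.roots_on_rootsR// in_itv.
- by rewrite -polyrcf.roots_on_rootsR// => /andP[_ /eqP].
Qed.

(** If |h| is maximal at m, the mean value theorem gives |h(m)| <= C r |h(m)|, and C r < 1 makes
    this maximum 0. *)
Lemma horizontal_zero (h : {poly R}) (x0 C r : R) : 0 < r -> 0 <= C -> C * r < 1 -> h.[x0] = 0 ->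
  (forall x, `|x - x0| <= r -> `|h^`().[x]| <= C * `|h.[x]|) ->
  forall x, `|x - x0| <= r -> h.[x] = 0.
Proof.
move=> r0 C0 Cr hx0 H.
have ab : x0 - r <= x0 + r by lra.
have cn : continuous (fun x => `|h.[x]|).
  by move=> x; apply: (@cvg_comp _ _ _ (horner h) (fun x : R => `|x|)); [exact: horner_continuous|exact: norm_continuous].
have [m + mmax] := EVT_max ab (continuous_subspaceT cn).
rewrite in_itv/= => /andP[m1 m2].
have hm0 : h.[m] = 0.
  have mvt : exists c, `|c - x0| <= r /\ h.[m] = h^`().[c] * (m - x0).
    have [mx|mx|->] := ltgtP m x0; last by exists x0; rewrite !subrr normr0 mulr0 (ltW r0).
    - have [c [c1 c2 e]] := horner_mvt h mx; exists c; split.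
        by rewrite ler_norml; apply/andP; split; lra.
      by rewrite hx0 in e; lra.
    - have [c [c1 c2 e]] := horner_mvt h mx; exists c; split.
        by rewrite ler_norml; apply/andP; split; lra.
      by rewrite hx0 in e; lra.
  have [c [cr e]] := mvt.
  have hc := H c cr.
  have hcm : `|h.[c]| <= `|h.[m]|.
    by apply: mmax; rewrite in_itv/=; move: cr; rewrite ler_norml => /andP[? ?]; apply/andP; split; lra.
  have mr : `|m - x0| <= r by rewrite ler_norml; apply/andP; split; lra.
  have : `|h.[m]| <= C * `|h.[m]| * r.
    rewrite {1}e normrM ler_pM//; apply: le_trans hc _; exact: ler_wpM2l.
  have := normr_ge0 h.[m] => n0 le1.
  have : 0 <= (1 - C * r) * - `|h.[m]| by lra.
  rewrite pmulr_rge0 ?subr_gt0// oppr_ge0 => n1.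
  by apply/eqP; rewrite -normr_le0.
move=> x xr; apply/eqP; rewrite -normr_le0 -[leRHS](normr0 R) -hm0; apply: mmax.
by rewrite in_itv/=; move: xr; rewrite ler_norml => /andP[? ?]; apply/andP; split; lra.
Qed.

Lemma seg_sign q w w' : (forall v, seg w w' v -> peval2 q v != 0) ->
  Num.sg (peval2 q w) = Num.sg (peval2 q w').
Proof.
move=> H; pose k := line w (w'.1 - w.1, w'.2 - w.2) q.
have k0 : k.[0] = peval2 q w by rewrite horner_line !mul0r !addr0 -surjective_pairing.
have k1 : k.[1] = peval2 q w'.
  by rewrite horner_line !mul1r ![_ + (_ - _)]addrC !subrK -surjective_pairing.
have [h|h] := leP (k.[0] * k.[1]) 0.
  have [t + /eqP kt] := polyrcf.poly_ivt ler01 h; rewrite in_itv/= => t01.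
  have := H (lpt w w' t); rewrite lpt_line -/k kt eqxx => h'.
  by have := h' (ex_intro2 _ _ t t01 erefl).
rewrite -k0 -k1; have [a|a|a] := ltgtP k.[0] 0.
- have b : k.[1] < 0 by rewrite nmulr_rgt0 in h.
  by rewrite !ltr0_sg.
- have b : 0 < k.[1] by rewrite pmulr_rgt0 in h.
  by rewrite !gtr0_sg.
- by rewrite a mul0r ltxx in h.
Qed.

End CellsOK.

(** * Signs of the defining polynomials near a point *)

Section SignsOnSides.
Variable R : realType.
Notation pt := (R * R)%type.
Notation poly2 := {poly {poly R}}.
Implicit Types (e : set pt) (z w : pt) (p q : poly2) (A B : set R).
Variables (X : set pt) (Qs : seq poly2).
Hypothesis Qs_neq0 : forall q, q \in Qs -> q != 0.
Hypothesis X_signs : forall w w',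
  (forall q, q \in Qs -> Num.sg (peval2 q w) = Num.sg (peval2 q w')) -> X w -> X w'.

Let P : poly2 := \prod_(q <- Qs) q.
Let Z : set pt := [set w | peval2 P w = 0].

Lemma prod_neq0 : P != 0.
Proof. by rewrite prodf_seq_neq0; apply/allP => q /Qs_neq0. Qed.

Lemma factor_neq0 w q : peval2 P w != 0 -> q \in Qs -> peval2 q w != 0.
Proof.
rewrite /P peval2_prod prodf_seq_neq0 => /allP H qQ.
by have := H q qQ.
Qed.

Lemma off_zeros_ok z : X z -> ~ Z z -> exists n, cellok X (dsq n z `&` ~` Z).
Proof.
move=> Xz Zz; have Pz : peval2 P z != 0 by apply/eqP.
have near1 : bnear z (fun w => forall q, q \in Qs -> Num.sg (peval2 q w) = Num.sg (peval2 q z)).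
  by apply: bnear_all => q qQ; apply: bnear_neq0; exact: factor_neq0.
have [n Hn] := bnear_dsq (bnearI near1 (bnear_neq0 Pz)).
exists n.
have DZ : dsq n z `<=` ~` Z.
  move=> w /Hn[_]; rewrite /Z/= => h Pw; rewrite Pw sgr0 in h.
  by move/esym/eqP: h; rewrite sgr_eq0 (negbTE Pz).
rewrite (setIidl DZ) dsq_prod; apply: cellok_prod; try exact: dcell_cell1.
move=> w Dw; have [H _] := Hn w Dw.
by apply: (X_signs (w := z)) => // q qQ; rewrite H.
Qed.

(** Write P = (x - x0)^k f1. Where f1 is nonzero, Z is locally the line x = x0, and each polynomial
    of [Qs] vanishes on this line or, off finitely many of its points, keeps its sign nearby. [W]
    collects the exceptional points. *)
Lemma bad_fiber_ok (x0 : R) : exists2 W : {poly R}, W != 0 &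
  forall z, X z -> Z z -> z.1 = x0 -> W.[z.2] != 0 -> exists n, cellok X (dsq n z `&` Z).
Proof.
have [k [f1 [eP f10]]] := factor_fiber x0 prod_neq0.
pose sp (q : poly2) : {poly R} := map_poly (horner_eval x0) q.
exists (sp f1 * \prod_(q <- Qs | sp q != 0) sp q).
  by rewrite mulf_neq0// prodf_seq_neq0; apply/allP => q _; apply/implyP.
move=> z Xz Zz zx; rewrite hornerM mulf_eq0 negb_or horner_prod prodf_seq_neq0.
move=> /andP[f1z /allP Hq].
have spz q : (sp q).[z.2] = peval2 q z by rewrite peval2E zx.
have f1z' : peval2 f1 z != 0 by rewrite -spz.
have near1 : bnear z (fun w => forall q, q \in Qs -> sp q != 0 ->
    Num.sg (peval2 q w) = Num.sg (peval2 q z)).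
  apply: bnear_all => q qQ; have [q0|q0] := eqVneq (sp q) 0; first by exists 1.
  apply: bnear_imp (_ : bnear z (fun w => Num.sg (peval2 q w) = Num.sg (peval2 q z))); first by [].
  by apply: bnear_neq0; rewrite -spz; have := Hq q qQ; rewrite q0.
have [n Hn] := bnear_dsq (bnearI near1 (bnear_neq0 f1z')).
exists n.
have eD : dsq n z `&` Z = prod_cell [set x0] (dcell n z.2).
  apply/seteqP; split=> w.
  - move=> [Dw Zw]; split; last by case: Dw.
    have [_ h] := Hn w Dw; have f1w : peval2 f1 w != 0.
      by apply/eqP => f1w; rewrite f1w sgr0 in h; move/esym/eqP: h; rewrite sgr_eq0 (negbTE f1z').
    move: Zw; rewrite /Z/= eP peval2M peval2C horner_exp hornerXsubC => /eqP.
    by rewrite mulf_eq0 (negbTE f1w) orbF expf_eq0 subr_eq0 => /andP[_ /eqP].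
  - move=> [/= wx wD]; split.
      by split=> //=; rewrite wx -zx; exact: dcell_refl.
    rewrite /Z/= eP peval2M peval2C horner_exp hornerXsubC wx subrr.
    case: k eP => [|k] eP; last by rewrite expr0n mul0r.
    (* For k = 0 the point z would be a zero of f1. *)
    by move: Zz f1z'; rewrite /Z/= eP expr0 mul1r => ->; rewrite eqxx.
rewrite eD; apply: cellok_prod; [by left; exists x0|exact: dcell_cell1|].
move=> w Pw; have wx : w.1 = x0 by case: Pw.
have [Dw _] : (dsq n z `&` Z) w by rewrite eD.
have [H _] := Hn w Dw.
apply: (X_signs (w := z)) => // q qQ; have [q0|q0] := eqVneq (sp q) 0; last by rewrite H.
by rewrite !peval2E wx zx -/(sp q) q0 !horner0.
Qed.

(** A horizontal and then a vertical move lead from v to c, each in a direction in which tau p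
    increases: p stays nonzero on the way, hence so does q. *)
Lemma sign_to_corner p z (r sx sy tau : R) (v c : pt) q :
  (forall w, box z r w -> 0 < sx * peval2 (dx p) w) ->
  (forall w, box z r w -> 0 < sy * peval2 p^`() w) ->
  (forall w, box z r w -> peval2 p w != 0 -> peval2 q w != 0) ->
  box z r v -> box z r c -> 0 < tau * peval2 p v ->
  0 <= (tau * sx) * (c.1 - v.1) -> 0 <= (tau * sy) * (c.2 - v.2) ->
  Num.sg (peval2 q v) = Num.sg (peval2 q c).
Proof.
move=> Hx Hy Hq bv bc pv hx hy.
have sx0 : 0 < sx ^+ 2.
  rewrite lt_neqAle sqr_ge0 andbT eq_sym sqrf_eq0; apply/eqP => s0.
  by have := Hx v bv; rewrite s0 mul0r ltxx.
have sy0 : 0 < sy ^+ 2.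
  rewrite lt_neqAle sqr_ge0 andbT eq_sym sqrf_eq0; apply/eqP => s0.
  by have := Hy v bv; rewrite s0 mul0r ltxx.
have up (s a b d : R) : 0 < s ^+ 2 -> 0 < d -> 0 <= tau * s * d -> s * a < s * b ->
    0 < tau * a -> 0 < tau * b.
  move=> s0 d0; rewrite pmulr_lge0// => ts ab a0.
  have : 0 <= (tau * s) * (s * b - s * a) by rewrite mulr_ge0// subr_ge0 ltW.
  rewrite (_ : _ * _ = s ^+ 2 * (tau * b - tau * a)); last by ring.
  by rewrite pmulr_rge0// subr_ge0; apply: lt_le_trans.
have dn (s a b d : R) : 0 < s ^+ 2 -> d < 0 -> 0 <= tau * s * d -> s * b < s * a ->
    0 < tau * a -> 0 < tau * b.
  move=> s0 d0; rewrite nmulr_lge0// => ts ab a0.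
  have : 0 <= (- (tau * s)) * (s * a - s * b) by rewrite mulr_ge0 ?oppr_ge0// subr_ge0 ltW.
  rewrite (_ : - _ * _ = s ^+ 2 * (tau * b - tau * a)); last by ring.
  by rewrite pmulr_rge0// subr_ge0; apply: lt_le_trans.
have gx u x : box z r u -> box z r (x, u.2) -> 0 <= (tau * sx) * (x - u.1) ->
    0 < tau * peval2 p u -> 0 < tau * peval2 p (x, u.2).
  move=> bu bx h pu; have [ux|xu|<-] := ltgtP u.1 x; last by rewrite -surjective_pairing.
  - by apply: (up sx (peval2 p u) _ (x - u.1)) => //; [rewrite subr_gt0|exact: box_monotone_x Hx bu bx ux].
  - apply: (dn sx (peval2 p u) _ (x - u.1)) => //; first by rewrite subr_lt0.
    by have := box_monotone_x (w := (x, u.2)) (x := u.1) Hx bx; rewrite /= -surjective_pairing; exact.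
have gy u y : box z r u -> box z r (u.1, y) -> 0 <= (tau * sy) * (y - u.2) ->
    0 < tau * peval2 p u -> 0 < tau * peval2 p (u.1, y).
  move=> bu by_ h pu; have [uy|yu|<-] := ltgtP u.2 y; last by rewrite -surjective_pairing.
  - by apply: (up sy (peval2 p u) _ (y - u.2)) => //; [rewrite subr_gt0|exact: box_monotone_y Hy bu by_ uy].
  - apply: (dn sy (peval2 p u) _ (y - u.2)) => //; first by rewrite subr_lt0.
    by have := box_monotone_y (w := (u.1, y)) (y := u.2) Hy by_; rewrite /= -surjective_pairing; exact.
have tauN (a : R) : 0 < tau * a -> a != 0 by move=> h; apply/eqP => a0; rewrite a0 mulr0 ltxx in h.
have bm : box z r (c.1, v.2) by case: bv bc => [_ v2] [c1 _].
have pm := gx v c.1 bv bm hx pv.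
transitivity (Num.sg (peval2 q (c.1, v.2))).
  apply: seg_sign => u vu; have bu := box_cvx bv bm vu.
  case: vu => t /andP[t0 t1] eu; rewrite /= subrr mulr0 addr0 in eu.
  apply: Hq => //; apply: tauN; rewrite eu; rewrite eu in bu; apply: gx => //.
  by rewrite addrAC subrr add0r mulrCA mulr_ge0.
apply: seg_sign => u vu; have bu := box_cvx bm bc vu.
case: vu => t /andP[t0 t1] eu; rewrite /= subrr mulr0 addr0 in eu.
apply: Hq => //; apply: tauN; rewrite eu; rewrite eu in bu.
apply: (gy (c.1, v.2)) => //=.
by rewrite addrAC subrr add0r mulrCA mulr_ge0.
Qed.

(** The larger of x and y if s >= 0, the smaller otherwise: the value that both reach by moving in
    the direction of s. *)
Lemma corner_coord (s x y : R) : exists2 c, c = x \/ c = y & 0 <= s * (c - x) /\ 0 <= s * (c - y).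
Proof.
have [s0|/ltW s0] := leP 0 s; have [xy|/ltW yx] := leP x y.
- by exists y; [right|rewrite subrr mulr0 lexx mulr_ge0// subr_ge0].
- by exists x; [left|rewrite subrr mulr0 lexx mulr_ge0// subr_ge0].
- by exists x; [left|rewrite subrr mulr0 lexx mulr_le0// subr_le0].
- by exists y; [right|rewrite subrr mulr0 lexx mulr_le0// subr_le0].
Qed.

(** Both points run to one corner of their bounding rectangle, which replaces a proof that each side
    of the arc is connected. *)
Lemma zero_sides_sign p z (r sx sy tau : R) (w w' : pt) q :
  (forall w, box z r w -> 0 < sx * peval2 (dx p) w) ->
  (forall w, box z r w -> 0 < sy * peval2 p^`() w) ->
  (forall w, box z r w -> peval2 p w != 0 -> peval2 q w != 0) ->
  box z r w -> box z r w' -> 0 < tau * peval2 p w -> 0 < tau * peval2 p w' ->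
  Num.sg (peval2 q w) = Num.sg (peval2 q w').
Proof.
move=> Hx Hy Hq bw bw' pw pw'.
have [cx ecx [cx1 cx2]] := corner_coord (tau * sx) w.1 w'.1.
have [cy ecy [cy1 cy2]] := corner_coord (tau * sy) w.2 w'.2.
have bc : box z r (cx, cy).
  by case: bw bw' => [? ?] [? ?]; split=> /=; [case: ecx => ->|case: ecy => ->].
transitivity (Num.sg (peval2 q (cx, cy))).
  exact: (sign_to_corner Hx Hy Hq bw bc pw).
by symmetry; exact: (sign_to_corner Hx Hy Hq bw' bc pw').
Qed.

End SignsOnSides.

(** * Cells cut out of a strictly monotone arc *)

Section ArcCells.
Variable R : realType.
Notation pt := (R * R)%type.
Notation poly2 := {poly {poly R}}.
Implicit Types (e : set pt) (z w : pt) (p q : poly2) (A B : set R).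
Variables (X : set pt) (Qs : seq poly2).
Hypothesis Qs_neq0 : forall q, q \in Qs -> q != 0.
Hypothesis X_signs : forall w w',
  (forall q, q \in Qs -> Num.sg (peval2 q w) = Num.sg (peval2 q w')) -> X w -> X w'.

Let P : poly2 := \prod_(q <- Qs) q.
Let Z : set pt := [set w | peval2 P w = 0].

Lemma arc_ok p z (C : R) : X z -> peval2 p z = 0 -> peval2 (dx p) z != 0 -> peval2 p^`() z != 0 ->
  0 <= C -> bnear z (fun w => peval2 (curv p) w <= C * `|peval2 p w|) ->
  bnear z (fun w => peval2 P w = 0 <-> peval2 p w = 0) ->
  bnear z (fun w => peval2 p w = 0 -> forall q, q \in Qs -> Num.sg (peval2 q w) = Num.sg (peval2 q z)) ->
  exists n, cellok X (dsq n z `&` Z).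
Proof.
move=> Xz pz pxz pyz C0 ncurv nZ nsign.
set sx := Num.sg (peval2 (dx p) z); set sy := Num.sg (peval2 p^`() z).
have [r1 r10 cvxE] := local_cvx C0 pyz ncurv.
have [r0 r00 H] := bnearI (bnearI (bnear_sg pxz) (bnear_sg pyz)) (bnearI nZ nsign).
pose r := Num.min r0 r1.
have r_gt0 : 0 < r by rewrite lt_min r00.
have r_r0 : r <= r0 by rewrite ge_min lexx.
have r_r1 : r <= r1 by rewrite ge_min lexx orbT.
have Hx w : box z r w -> 0 < sx * peval2 (dx p) w by move=> /(box_le r_r0)/H[[]].
have Hy w : box z r w -> 0 < sy * peval2 p^`() w by move=> /(box_le r_r0)/H[[]].
have HZ w : box z r w -> peval2 P w = 0 <-> peval2 p w = 0 by move=> /(box_le r_r0)/H[_ []].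
have Hs w : box z r w -> peval2 p w = 0 ->
    forall q, q \in Qs -> Num.sg (peval2 q w) = Num.sg (peval2 q z).
  by move=> /(box_le r_r0)/H[_ []].
have bz : box z r z by exact: box_center.
(* A square within r / 2 of z keeps the boxes of radius r / 2 around its points inside the box of
   radius r. *)
have h0 : 0 < r / 2 by rewrite divr_gt0.
have hr : r / 2 <= r by lra.
have [n Hn] := dsq_box z h0.
have DU : dsq n z `<=` box z r by move=> w /Hn bw; exact: (box_le hr bw).
have arcX w : box z r w -> peval2 p w = 0 -> X w.
  by move=> bw pw; apply: (X_signs (w := z)) => // q qQ; rewrite (Hs w bw pw q qQ).
have y_uniq := zero_uniq_y Hy; have x_uniq := zero_uniq_x Hx.
exists n.
have Zz : Z z by apply/HZ.
(* A square degenerate to a point or an interval meets the strictly monotone arc only in z. *)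
have single : (forall w, dsq n z w -> Z w -> w = z) -> cellok X (dsq n z `&` Z).
  move=> Hw; rewrite (_ : _ `&` _ = [set z]); first exact: cellok_point.
  apply/seteqP; split=> [w [Dw Zw]|w ->]; first exact: Hw.
  by split=> //; exact: dsq_refl.
have [[a ea]|[a [b [ab eab]]]] := dcell_cell1 n z.1.
  apply: single => w Dw /HZ pw; apply: y_uniq => //; try exact: DU; first exact/pw/DU.
  case: Dw => [+ _]; have := dcell_refl n z.1; rewrite ea /= => -> ->.
  by [].
have [[c ec]|[c [d [cd ecd]]]] := dcell_cell1 n z.2.
  apply: single => w Dw /HZ pw; apply: x_uniq => //; try exact: DU; first exact/pw/DU.
  case: Dw => [_ +]; have := dcell_refl n z.2; rewrite ec /= => -> ->.
  by [].
have eD : dsq n z = prod_cell `]a, b[%classic `]c, d[%classic by rewrite dsq_prod eab ecd.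
have eZ : dsq n z `&` Z = prod_cell `]a, b[%classic `]c, d[%classic `&` [set w | peval2 p w = 0].
  rewrite -eD; apply/seteqP; split=> w [Dw Zw]; split=> //; first by apply/HZ => //; exact: DU.
  by apply/HZ => //; exact: DU.
have DU' : prod_cell `]a, b[%classic `]c, d[%classic `<=` box z r by rewrite -eD.
have cell : is_1cell (dsq n z `&` Z).
  rewrite eZ; apply: (monotone_arc_1cell Hx Hy DU'); exists z.
  by rewrite -eD; split=> //; exact: dsq_refl.
split.
- by rewrite eZ -eD => w [Dw pw]; apply: arcX => //; exact: DU.
- by rewrite dsq_prod; apply: semialgebraic_prod; exact: dcell_cell1.
- by right; left.
move=> gam tg S; split; last by left.
(* One point of X on a side puts the whole side into X, since no polynomial of [Qs] changes sign
   there. *)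
have side (tau : R) : (forall w, box z r w -> 0 < tau * peval2 p w -> X w) \/
                (forall w, box z r w -> 0 < tau * peval2 p w -> ~ X w).
  have [[w [bw pw Xw]]|no] := pselect (exists w, [/\ box z r w, 0 < tau * peval2 p w & X w]); last first.
    by right => w bw pw Xw; apply: no; exists w.
  left=> w' bw' pw'; apply: (X_signs _ Xw) => q qQ.
  apply: (zero_sides_sign Hx Hy _ bw bw' pw pw') => u bu pu.
  by apply: (factor_neq0 (Qs := Qs)) => //; apply/eqP => /(HZ _ bu)/eqP; apply/negP.
rewrite /S eZ.
apply: (@arc_finite_comps R (peval2 p) (box z r) _ _ _ _ X _ (r / 2)) => //.
- exact: peval2_continuous.
- move=> w [w1 w2]; exists (Num.min (r - `|w.1 - z.1|) (r - `|w.2 - z.2|)).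
    by rewrite lt_min !subr_gt0 w1.
  move=> u [u1 u2]; rewrite !lt_min in u1 u2; split.
    have := ler_distD w.1 u.1 z.1; case/andP: u1; lra.
  have := ler_distD w.2 u.2 z.2; case/andP: u2; lra.
- exact: cvxE.
(* A vertical move by eta in the direction in which p decreases; eta is small enough for both
   boxes. *)
- move=> w bw pw rho rho0.
  have [w1 w2] := bw.
  pose eta := Num.min (rho / 2) ((r - `|w.2 - z.2|) / 2).
  have eta0 : 0 < eta by rewrite lt_min !divr_gt0// subr_gt0.
  have eta1 : eta <= rho / 2 by rewrite ge_min lexx.
  have eta2 : eta <= (r - `|w.2 - z.2|) / 2 by rewrite ge_min lexx orbT.
  have sub y : `|y - w.2| <= eta -> box z r (w.1, y) /\ box w rho (w.1, y).
    move=> ye; split; split=> //=.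
    - have := ler_distD w.2 y z.2; lra.
    - by rewrite subrr normr0.
    - lra.
  have sy2 : sy ^+ 2 = 1 by rewrite /sy sqr_sg pyz.
  have below : `|w.2 - eta - w.2| <= eta by rewrite addrAC subrr add0r normrN gtr0_norm.
  have above : `|w.2 + eta - w.2| <= eta by rewrite addrAC subrr add0r gtr0_norm.
  have [b1 b1'] := sub _ below; have [b2 b2'] := sub _ above.
  have m1 : sy * peval2 p (w.1, w.2 - eta) < 0.
    have := box_monotone_y (w := (w.1, w.2 - eta)) (y := w.2) Hy b1.
    by rewrite /= -surjective_pairing pw mulr0; apply=> //; lra.
  have m2 : 0 < sy * peval2 p (w.1, w.2 + eta).
    have := box_monotone_y (y := w.2 + eta) Hy bw b2.
    by rewrite pw mulr0; apply; lra.
  have [s1|s1] := leP 0 sy.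
    exists (w.1, w.2 - eta) => //; rewrite ltNge; apply/negP => h.
    by have := mulr_ge0 s1 h; lra.
  exists (w.1, w.2 + eta) => //; rewrite ltNge; apply/negP => h.
  by have := mulr_le0_ge0 (ltW s1) h; lra.
- by apply: prod_cell_cvx; right; [exists a, b|exists c, d].
- rewrite -eD => w /Hn[w1 w2] u [u1 u2]; split.
    have := ler_distD w.1 u.1 z.1; lra.
  have := ler_distD w.2 u.2 z.2; lra.
- move=> F; exact: (monotone_arc_connected Hx Hy DU').
- by have [h|h] := side 1; [left|right] => w bw pw; apply: (h w bw); rewrite mul1r.
- by have [h|h] := side (-1); [left|right] => w bw pw; apply: (h w bw); rewrite mulN1r oppr_gt0.
Qed.

End ArcCells.

(** * Generic points and the finiteness property *)

Section Decomposition.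
Variable R : realType.
Notation pt := (R * R)%type.
Notation poly2 := {poly {poly R}}.
Implicit Types (e : set pt) (z w : pt) (p q : poly2) (A B : set R).

Section GenericCells.
Variables (X : set pt) (Qs : seq poly2).
Hypothesis Qs_neq0 : forall q, q \in Qs -> q != 0.
Hypothesis X_signs : forall w w',
  (forall q, q \in Qs -> Num.sg (peval2 q w) = Num.sg (peval2 q w')) -> X w -> X w'.

Let P : poly2 := \prod_(q <- Qs) q.
Let Z : set pt := [set w | peval2 P w = 0].

(** On the horizontal line through z, p vanishes at z and its derivative is bounded by C |p|, so it
    vanishes along the line near z; the zero set is locally this line. *)
Lemma horizontal_ok p z (C : R) : X z -> peval2 p z = 0 -> peval2 p^`() z != 0 ->
  0 <= C -> bnear z (fun w => `|peval2 (dx p) w| <= C * `|peval2 p w|) ->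
  bnear z (fun w => peval2 P w = 0 <-> peval2 p w = 0) ->
  bnear z (fun w => peval2 p w = 0 -> forall q, q \in Qs -> Num.sg (peval2 q w) = Num.sg (peval2 q z)) ->
  exists n, cellok X (dsq n z `&` Z).
Proof.
move=> Xz pz pyz C0 ndx nZ nsign.
have [r r0 H] := bnearI (bnearI (bnear_sg pyz) ndx) (bnearI nZ nsign).
(* The second bound ensures C rho < 1 for [horizontal_zero]. *)
pose rho := Num.min (r / 2) (2 * C + 1)^-1.
have C1 : 0 < 2 * C + 1 by lra.
have rho0 : 0 < rho by rewrite lt_min divr_gt0//= invr_gt0.
have rhor : rho < r by rewrite /rho gt_min; apply/orP; left; lra.
have Crho : C * rho < 1.
  have : (2 * C + 1) * rho <= 1.
    by rewrite -ler_pdivlMl// mulr1 ge_min lexx orbT.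
  by have : 0 <= C * rho by [rewrite mulr_ge0// ltW]; lra.
have flat x : `|x - z.1| <= rho -> peval2 p (x, z.2) = 0.
  pose h := line (0, z.2) (1, 0) p.
  have hE y : h.[y] = peval2 p (y, z.2) by rewrite horner_line /= add0r mulr1 mulr0 addr0.
  have h'E y : h^`().[y] = peval2 (dx p) (y, z.2).
    by rewrite deriv_line /= scale1r scale0r addr0 horner_line /= add0r mulr1 mulr0 addr0.
  move=> xr; rewrite -hE.
  apply: (horizontal_zero rho0 C0 Crho _ _ xr); first by rewrite hE -surjective_pairing.
  move=> y yr; rewrite h'E hE.
  have [|[_ h1] _] := H (y, z.2); last exact: h1.
  by split=> /=; [exact: le_lt_trans yr rhor|rewrite subrr normr0].
have brho w : box z rho w -> box z r w by apply: box_le; exact: ltW.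
have [n Hn] := dsq_box z rho0.
have pE w : box z rho w -> peval2 p w = 0 <-> w.2 = z.2.
  move=> bw; have [bw1 bw2] := bw.
  have f := flat w.1 (ltW bw1).
  split=> [pw|wz]; last by rewrite [w]surjective_pairing wz.
  have -> // : w = (w.1, z.2).
  apply: (@zero_uniq_y _ p z r (Num.sg (peval2 p^`() z))) => //.
  - by move=> u /H[[]].
  - exact: brho.
  - by apply: brho; split=> //=; rewrite subrr normr0.
exists n.
have eD : dsq n z `&` Z = prod_cell (dcell n z.1) [set z.2].
  apply/seteqP; split=> w.
  - move=> [Dw Zw]; split; first by case: Dw.
    by apply/(pE _ (Hn _ Dw)); have [_ [h _]] := H w (brho _ (Hn w Dw)); exact/h.
  - move=> [Dw1 Dw2]; have Dw : dsq n z w by split=> //; rewrite Dw2; exact: dcell_refl.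
    split=> //; have [_ [h _]] := H w (brho _ (Hn w Dw)).
    by apply/h/(pE _ (Hn _ Dw)).
rewrite eD; apply: cellok_prod; [exact: dcell_cell1|by left; exists z.2|].
move=> w; rewrite -eD => -[Dw Zw]; have [_ [h1 h2]] := H w (brho _ (Hn w Dw)).
by apply: (X_signs (w := z)) => // q qQ; rewrite h2//; exact/h1.
Qed.

(** [D] excludes the lines on which p may have a multiple root, or on which p_x, the curvature
    numerator or a polynomial of [Qs] may vanish at a zero of p without being locally O(p). *)
Lemma generic_ok : exists2 D : {poly R}, D != 0 &
  forall z, X z -> Z z -> D.[z.1] != 0 -> exists n, cellok X (dsq n z `&` Z).
Proof.
have [p [D0 [D00 HD0]]] := simple_roots (prod_neq0 Qs_neq0).
have [Dx Dx0 HDx] := vanish_along p (dx p).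
have [Dc Dc0 HDc] := vanish_along p (curv p).
have [Dq Dq0 HDq] : exists2 Dq : {poly R}, Dq != 0 & forall q, q \in Qs ->
    forall z, Dq.[z.1] != 0 -> peval2 p z = 0 -> peval2 p^`() z != 0 -> peval2 q z = 0 ->
    exists2 C : R, 0 <= C & bnear z (fun w => `|peval2 q w| <= C * `|peval2 p w|).
  elim: (Qs) => [|q s [D1 D10 H1]]; first by exists 1 => //; exact: oner_neq0.
  have [D2 D20 H2] := vanish_along p q.
  exists (D1 * D2); first by rewrite mulf_neq0.
  move=> q'; rewrite in_cons => /orP[/eqP ->|q's] z; rewrite hornerM mulf_eq0 negb_or => /andP[z1 z2].
    exact: H2.
  exact: H1.
exists (D0 * Dx * Dc * Dq); first by rewrite !mulf_neq0.
move=> z Xz Zz; rewrite !hornerM !mulf_eq0 !negb_or => /andP[/andP[/andP[z0 zx] zc] zq].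
have [Pp psimple] := HD0 z z0.
have pz : peval2 p z = 0 by apply/Pp.
have pyz := psimple pz.
have nZ : bnear z (fun w => peval2 P w = 0 <-> peval2 p w = 0).
  have : bnear z (fun w => Num.sg (peval2 D0%:P w) = Num.sg (peval2 D0%:P z)).
    by apply: bnear_neq0; rewrite peval2C.
  apply: bnear_imp => w; rewrite !peval2C => h; apply: (HD0 w _).1.
  by rewrite -sgr_eq0 h sgr_eq0.
have nsign : bnear z (fun w => peval2 p w = 0 -> forall q, q \in Qs -> Num.sg (peval2 q w) = Num.sg (peval2 q z)).
  suff : bnear z (fun w => forall q, q \in Qs -> peval2 p w = 0 -> Num.sg (peval2 q w) = Num.sg (peval2 q z)).
    by apply: bnear_imp => w H pw q qQ; exact: H.
  apply: bnear_all => q qQ; have [qz|qz] := eqVneq (peval2 q z) 0; last first.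
    by apply: bnear_imp (bnear_neq0 qz).
  have [C C0 nC] := HDq q qQ z zq pz pyz qz.
  apply: bnear_imp nC => w + pw; rewrite pw normr0 mulr0 normr_le0 => /eqP ->.
  by rewrite qz.
have [pxz|pxz] := eqVneq (peval2 (dx p) z) 0.
  have [C C0 nC] := HDx z zx pz pyz pxz.
  exact: horizontal_ok Xz pz pyz C0 nC nZ nsign.
(* A negative curvature numerator makes {p >= 0} convex near z; a positive one is reversed by
   passing to -p, and one that vanishes at z is locally O(p). *)
have [cz|cz|cz] := ltgtP (peval2 (curv p) z) 0.
- apply: (arc_ok X_signs Xz pz pxz pyz (lexx (0 : R)) _ nZ nsign).
  by apply: bnear_imp (bnear_lt0 cz) => w; rewrite mul0r; exact: ltW.
- apply: (arc_ok X_signs (p := - p) Xz _ _ _ (lexx (0 : R))).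
  + by rewrite peval2N pz oppr0.
  + by rewrite dxN peval2N oppr_eq0.
  + by rewrite derivN peval2N oppr_eq0.
  + by apply: bnear_imp (bnear_gt0 cz) => w; rewrite mul0r curvN peval2N oppr_le0; exact: ltW.
  + apply: bnear_imp nZ => w [h1 h2]; rewrite peval2N; split=> [/h1 ->|/eqP]; first by rewrite oppr0.
    by rewrite oppr_eq0 => /eqP /h2.
  + by apply: bnear_imp nsign => w h /eqP; rewrite peval2N oppr_eq0 => /eqP; exact: h.
- have [C C0 nC] := HDc z zc pz pyz cz.
  apply: (arc_ok X_signs Xz pz pxz pyz C0 _ nZ nsign).
  by apply: bnear_imp nC => w; apply: le_trans; exact: ler_norm.
Qed.

End GenericCells.

Lemma cellok_finiteness X (C : set (set pt)) : (forall e, C e -> cellok X e) -> finiteness_property X C.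
Proof.
move=> HC A B gam sg e Ce S; right.
have [tg img] := shortest_taut sg; rewrite /S img.
have [_ _ _ fe] := HC e Ce; have [fin cmp] := fe _ tg.
split=> // x Sx; case: cmp => [e1|/(_ x Sx)[]]; [|by left|by move=> h; right; left].
have [[y [cy yx]]|no] := pselect (exists y, connected_component (range (gam \o @clamp R) `&` e) x y /\ y <> x).
  right; right; split; first exact: component_connected.
    exists y, x; split=> //; split=> //; exact: connected_component_refl.
  by exists e; split=> //; split=> // u /connected_component_sub[].
left; exists x; apply/seteqP; split=> [y cy|_ ->]; last exact: connected_component_refl.
by apply: contrapT => yx; apply: no; exists y.
Qed.

End Decomposition.

Lemma countable_setU T (A B : set T) : countable A -> countable B -> countable (A `|` B).
Proof.
by move=> cA cB; rewrite -bigcup2E; apply: bigcup_countable => // -[|[|n]].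
Qed.

Theorem theorem5p5 (R : realType) (X : set (R * R)) :
  semialgebraic X ->
  exists C : set (set (R * R)),
    cell_decomposition X C /\ finiteness_property X C.
Proof.
move=> /semialgebraic_signs[Qs Qs0 HX].
have [D D0 HD] := generic_ok Qs0 HX.
pose Z := [set w | peval2 (\prod_(q <- Qs) q) w = 0].
pose good1 E := cellok X (E `&` ~` Z); pose good2 E := cellok X (E `&` Z).
(* Points of the zero set without any good square; they become singleton cells. *)
pose F := [set z | [/\ X z, Z z & forall n, ~ good2 (dsq n z)]].
pose C1 := [set E `&` ~` Z | E in maximal_good good1].
pose C2 := [set E `&` Z | E in maximal_good good2].
pose C3 := [set [set z] | z in F].
have HC e : (C1 `|` C2 `|` C3) e -> cellok X e.
  move=> [[[E /maximal_good_good gE <-]|[E /maximal_good_good gE <-]]|[z [Xz _ _] <-]] //.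
  exact: cellok_point.
exists (C1 `|` C2 `|` C3); split; last exact: cellok_finiteness.
have cF : countable F.
  have FW x0 : exists W : {poly R}, W != 0 /\ forall z, F z -> z.1 = x0 -> W.[z.2] = 0.
    have [W W0 HW] := bad_fiber_ok Qs0 HX x0; exists W; split=> // z [Xz Zz no] zx.
    apply: contrapT => /eqP Wz; have [n ok] := HW z Xz Zz zx Wz; exact: (no n).
  have [W HW] := choice FW.
  (* Finitely many vertical lines by [generic_ok], and finitely many points on each by
     [bad_fiber_ok]. *)
  have sub : F `<=` \bigcup_(x in [set x | D.[x] = 0]) [set (x, y) | y in [set y | (W x).[y] = 0]].
    move=> z Fz; exists z.1.
      apply: contrapT => /eqP Dz; have [Xz Zz no] := Fz.
      have [n ok] := HD z Xz Zz Dz; exact: (no n).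
    by exists z.2; [exact: (HW z.1).2|rewrite -surjective_pairing].
  apply: (sub_countable (subset_card_le sub)); apply: finite_set_countable.
  apply: bigcup_finite; first exact: finite_roots.
  by move=> x _; apply: finite_image; apply: finite_roots; exact: (HW x).1.
split.
- by apply: countable_setU; [apply: countable_setU|]; apply: (sub_countable (card_image_le _ _)) => //;
    exact: countable_maximal_good.
- by move=> e /HC[_ h1 h2 _].
- move=> e e' [[[E mE <-]|[E mE <-]]|[z Fz <-]] [[[E' mE' <-]|[E' mE' <-]]|[z' Fz' <-]] [w [h1 h2]].
  + by congr (_ `&` _); apply: maximal_good_disjoint mE mE' _; exists w; split; [case: h1|case: h2].
  + by case: h1 h2 => [_ nZ] [_ /nZ].
  + by case: h1 => _; rewrite h2; case: Fz' => _ /[swap].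
  + by case: h2 h1 => [_ nZ] [_ /nZ].
  + by congr (_ `&` _); apply: maximal_good_disjoint mE mE' _; exists w; split; [case: h1|case: h2].
  (* A square containing a point of F is that point's own square at its level, hence not good. *)
  + exfalso; have [n [u [eE gE _]]] := mE; have [_ _ no] := Fz'; apply: (no n).
    by move: h1; rewrite h2 eE => -[/dsq_eq <- _]; rewrite -eE.
  + by case: h2 => _; rewrite h1; case: Fz => _ /[swap].
  + exfalso; have [n [u [eE gE _]]] := mE'; have [_ _ no] := Fz; apply: (no n).
    by move: h2; rewrite h1 eE => -[/dsq_eq <- _]; rewrite -eE.
  + by rewrite -h1 -h2.
- apply/seteqP; split=> [z [e Ce ez]|z Xz]; first by have [eX _ _ _] := HC e Ce; exact: eX.
  have [Zz|Zz] := pselect (Z z); last first.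
    have [n ok] := off_zeros_ok HX Xz Zz.
    have [E mE Ez] := maximal_good_cover (good := good1) ok.
    by exists (E `&` ~` Z) => //; left; left; exists E.
  have [[n ok]|no] := pselect (exists n, good2 (dsq n z)).
    have [E mE Ez] := maximal_good_cover ok.
    by exists (E `&` Z) => //; left; right; exists E.
  exists [set z] => //; right; exists z => //; split=> // n gn; apply: no; by exists n.
Qed.
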